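(* Let $X$ be a square integrable real-valued (càdlàg) martingale, let $T>0$, and let $M^T_t=\mathbb E\left[\int_0^T X_u\,du\,\middle|\,\mathcal F_t\right]$. Then for $0\le t\le T$, $$dM^T_t=(T-t)\,dX_t,\qquad \Delta M^T_t=(T-t)\,\Delta X_t,$$ $$d[M^T]_t=(T-t)^2\,d[X]_t,\qquad d\langle M^T\rangle_t=(T-t)^2\,d\langle X\rangle_t .$$
   Context: $(\Omega,\mathcal F,\mathbb P,(\mathcal F_t)_{t\ge0})$ is a filtered probability space satisfying the usual conditions, and $X$ is a martingale for $(\mathcal F_t)$. Square integrable means $\mathbb E X_t^2<\infty$ for all $t\ge0$. $M^T$ is chosen right-continuous with left limits. $\Delta Y_t=Y_t-Y_{t-}$; $[\cdot]$ is the quadratic variation and $\langle\cdot\rangle$ the predictable quadratic variation. *)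

(* Defs.v *)
From HB Require Import structures.
From mathcomp Require Import all_boot all_order all_algebra.
From mathcomp Require Import all_classical all_reals all_analysis.

Set Implicit Arguments.
Unset Strict Implicit.
Unset Printing Implicit Defensive.

Import Order.TTheory GRing.Theory Num.Theory.
Import numFieldNormedType.Exports.

Local Open Scope classical_set_scope.
Local Open Scope ring_scope.

(* Processes are functions [Y : R -> Omega -> R]; only their values at times
   [0 <= t] are meaningful.  A filtration is a family [F] of sets of events. *)
Section StochasticProcesses.
Context {d : measure_display} {Omega : measurableType d} {R : realType}.
Variable P : probability Omega R.
Implicit Types (F : R -> set (set Omega)) (X Y H I : R -> Omega -> R).

Definition usual_conditions F : Prop :=
  [/\ forall t, 0 <= t -> sigma_algebra setT (F t) /\ F t `<=` measurable,
      forall s t, 0 <= s -> s <= t -> F s `<=` F t,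
      forall t, 0 <= t -> F t = \bigcap_(s in [set s | t < s]) F s
    & forall N, P.-negligible N -> F 0 N].

Definition measurable_wrt (G : set (set Omega)) (f : Omega -> R) : Prop :=
  forall B : set R, measurable B -> G (f @^-1` B).

Definition adapted F Y : Prop :=
  forall t, 0 <= t -> measurable_wrt (F t) (Y t).

(* [Y] is a version of the conditional expectation of [Z] given [G] *)
Definition is_cond_exp (G : set (set Omega)) (Z Y : Omega -> R) : Prop :=
  [/\ measurable_wrt G Y,
      P.-integrable setT (EFin \o Y)
    & forall A, G A ->
        (\int[P]_(w in A) (Y w)%:E = \int[P]_(w in A) (Z w)%:E)%E].

Definition martingale F Y : Prop :=
  adapted F Y /\
  forall s t, 0 <= s -> s <= t -> is_cond_exp (F s) (Y t) (Y s).

Definition square_integrable Y : Prop :=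
  forall t, 0 <= t -> (\int[P]_w (Y t w ^+ 2)%:E < +oo)%E.

Definition cadlag Y : Prop :=
  forall w,
    (forall t, 0 <= t -> Y s w @[s --> t^'+] --> Y t w) /\
    (forall t, 0 < t -> cvg (Y s w @[s --> t^'-])).

(* Jump process, with the convention Y_{0-} = Y_0 *)
Definition jump Y (t : R) (w : Omega) : R :=
  if t == 0 then 0 else Y t w - lim (Y s w @[s --> t^'-]).

Definition cvg_in_probability (S : nat -> Omega -> R) (L : Omega -> R) : Prop :=
  forall e : R, 0 < e ->
    P [set w | e <= `|S n w - L w|] @[n --> \oo] --> 0%E.

(* The subdivision [s] of an interval starting at 0 stands for the points
   0 :: s, i.e. the intervals ]part_pt s i, part_pt s i.+1] for i < size s. *)
Definition part_pt (s : seq R) (i : nat) : R := nth 0 (0 :: s) i.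

Definition mesh (s : seq R) : R :=
  \big[Num.max/0]_(i < size s) (part_pt s i.+1 - part_pt s i).

Definition sum_squares Y (s : seq R) (w : Omega) : R :=
  \sum_(i < size s) (Y (part_pt s i.+1) w - Y (part_pt s i) w) ^+ 2.

(* Right-continuous nondecreasing processes are given by their paths
   [Q : Omega -> cumulative R R], so that [lebesgue_stieltjes_measure (Q w)]
   is the measure dQ(w); only its restriction to ]0, +oo[ is ever used. *)
Implicit Types Q A : Omega -> cumulative R R.

(* [Q] is (a version of) the quadratic variation [Y], normalised by
   [Y]_0 = 0 *)
Definition is_quadratic_variation F Y Q : Prop :=
  [/\ adapted F (fun t w => Q w t),
      forall w, Q w 0 = 0
    & forall (t : R) (pi : nat -> seq R), 0 <= t ->
        (forall n, itv_partition 0 t (pi n)) ->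
        mesh (pi n) @[n --> \oo] --> (0 : R) ->
        cvg_in_probability (fun n => sum_squares Y (pi n)) (fun w => Q w t)].

Definition predictable_rectangles F : set (set (R * Omega)) :=
  [set S | (exists2 B, F 0 B & S = [set 0] `*` B) \/
           (exists s t B, [/\ 0 <= s, s < t, F s B & S = `]s, t] `*` B])].

(* The predictable sigma-algebra on [0, +oo[ x Omega *)
Definition predictable_sets F : set (set (R * Omega)) :=
  <<s [set tw : R * Omega | 0 <= tw.1], predictable_rectangles F >>.

Definition predictable F H : Prop :=
  forall B : set R, measurable B ->
    predictable_sets F [set tw | 0 <= tw.1 /\ B (H tw.1 tw.2)].

(* [A] is (a version of) the predictable quadratic variation <Y>, i.e. the
   Doob-Meyer compensator of Y^2, normalised by <Y>_0 = 0 *)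
Definition is_predictable_quadratic_variation F Y A : Prop :=
  [/\ predictable F (fun t w => A w t),
      forall w, A w 0 = 0
    & martingale F (fun t w => Y t w ^+ 2 - A w t)].

(* Elementary predictable processes
   \sum_i sp_coef i * 1_{]t_i, t_{i+1}]}, t_i := part_pt sp_times i *)
Record simple_process F := SimpleProcess {
  sp_times : seq R ;
  sp_coef : nat -> Omega -> R ;
  sp_sorted : path <%R 0 sp_times ;
  sp_measurable : forall i, (i < size sp_times)%N ->
    measurable_wrt (F (part_pt sp_times i)) (sp_coef i) ;
  sp_bounded : forall i, (i < size sp_times)%N ->
    exists K : R, forall w, `|sp_coef i w| <= K }.

Definition sp_eval F (h : simple_process F) (s : R) (w : Omega) : R :=
  \sum_(i < size (sp_times h))
    sp_coef h i w *
    \1_(`]part_pt (sp_times h) i, part_pt (sp_times h) i.+1]) s.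

Definition sp_integral F (h : simple_process F) X (t : R) (w : Omega) : R :=
  \sum_(i < size (sp_times h))
    sp_coef h i w * (X (Num.min (part_pt (sp_times h) i.+1) t) w -
                     X (Num.min (part_pt (sp_times h) i) t) w).

(* [h n] tends to [H] in L^2(dP x dA) on ]0, T] *)
Definition approximates F A (T : R) H (h : nat -> simple_process F) : Prop :=
  (\int[P]_w \int[lebesgue_stieltjes_measure (A w)]_(s in `]0%R, T])
     ((sp_eval (h n) s w - H s w) ^+ 2)%:E)%E @[n --> \oo] --> 0%E.

(* Ito integral for a square integrable martingale [X] with predictable
   quadratic variation [A]: the continuous extension to L^2(dP x dA) of the
   integral of elementary processes.
   [I] is (a version of) t |-> \int_{]0, t]} H_s dX_s for 0 <= t <= T. *)
Definition is_ito_integral F X A (T : R) H I : Prop :=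
  [/\ predictable F H, adapted F I, cadlag I,
      exists h : nat -> simple_process F, approximates A T H h
    & forall h : nat -> simple_process F, approximates A T H h ->
        forall t, 0 <= t <= T ->
        (\int[P]_w ((sp_integral (h n) X t w - I t w) ^+ 2)%:E)%E
          @[n --> \oo] --> 0%E].

End StochasticProcesses.

(* Main.v *)
Require Import Defs.
From HB Require Import structures.
From mathcomp Require Import all_boot all_order all_algebra finmap.
From mathcomp Require Import all_classical all_reals all_analysis.
From mathcomp Require Import measurable_realfun ring lra.

Set Implicit Arguments.
Unset Strict Implicit.
Unset Printing Implicit Defensive.

Import Order.TTheory GRing.Theory Num.Theory.
Import numFieldNormedType.Exports.
Import HBNNSimple.

Local Open Scope classical_set_scope.
Local Open Scope ring_scope.
(** Write g s = max 0 (T - s) for the remaining time, and let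
      N_t = g t * X_t + \int_[0,t] 1_{u < T} X_u du.
    Then N_T is the integral of X over [0, T], N is constant after T, and for
    s <= t integration by parts gives
      N_t - N_s = g s * (X_t - X_s) - r(s,t),
      r(s,t) = \int_[s,t] 1_{u < T} (X_t - X_u) du      ([avg_incr]).
    The remainder has second order: by Cauchy-Schwarz on Riemann sums and
    Fatou, E r(s,t)^2 <= (t - s)^2 E (X_t - X_s)^2 ([arem_bound]).  So over a
    fine subdivision N moves like the discrete integral of g against X, and
    each of the four identities follows from this one expansion.

    Martingale property.  Over a uniform subdivision the remainders add up to
    nothing while the terms g s * (X_t - X_s) have mean zero on every event of
    F_s; hence N is a square integrable martingale ([avg_mart]) and M_t = N_t
    almost surely for every t ([cond_exp_avg]).  Both processes are
    right-continuous, so they are indistinguishable, and only N has to be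
    studied.

    Jumps.  The Lebesgue integral in N is continuous in t and so is g; what
    jumps is g t * X_t ([avg_jump]).

    Ito integral.  For F_s-measurable bounded c and b, the variable
    c (X_t - X_s) - b (N_t - N_s) has second moment
    E \int_]s,t] (c - b g)^2 dA, where A is the compensator of X^2
    ([increment_isometry]).  With b = 1, summing over the cells of a simple
    process and using orthogonality of martingale increments, the distance
    between its integral and N_t - N_0 is exactly its distance to g in
    L^2(dP x dA) ([ito_isometry]); this gives convergence for every
    approximating sequence.

    Predictable quadratic variation.  With c = 0 and b the indicator of an
    event of F_s, the same isometry says that N^2 - \int g^2 dA is a
    martingale, and \int g^2 dA is predictable as a limit of Riemann sums.
    Uniqueness of the compensator is proved directly ([compensator_ae_eq]).
    If A and B are predictable and increasing with E 1_C (A_t - A_s) =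
    E 1_C (B_t - B_s) for C in F_s, then E \int H dA = E \int H dB for every
    predictable H >= 0 ([matched_predictable]).  Take for H the restrictions
    of A + A_- and of B + B_- to the set A + B <= k.  For each outcome the
    times s <= tau in that set form an initial interval J, and Fubini on the
    square J x J ([triangle_split]) turns the two equalities into
    E dA(J)^2 + E dB(J)^2 = 2 E dA(J) dB(J).  So dA(J) = dB(J) almost surely,
    and k is arbitrary.

    Quadratic variation.  By the bound on the remainder, the sum of squares
    of N over a subdivision p is close in L^1 to
    sum_i g(p_i)^2 (X_{p_{i+1}} - X_{p_i})^2.  Grouping the cells by a coarse
    uniform grid, on whose cells g^2 is nearly constant, this is close to a
    Riemann-Stieltjes sum of g^2 against t |-> [X]_t, because the sums of
    squares of X stopped at each coarse point converge to [X]; the cell that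
    straddles a coarse point costs an increment of X to the right of that
    point, which vanishes by right-continuity ([coarse_sum],
    [averaged_sum_squares]).  Limits in probability being unique, any
    quadratic variation of M is \int g^2 d[X]. *)

(** * Cadlag paths and Riemann sums *)

Lemma cvg_toEFin (R : realType) (u : R^nat) (l : R) :
  u @ \oo --> l -> (u n)%:E @[n --> \oo] --> l%:E.
Proof. by move=> ul; apply: cvg_EFin => //; exact: nearW. Qed.

Lemma Rintegral_dominated_cvg d (T : measurableType d) (R : realType)
    (mu : {measure set T -> \bar R}) (D : set T) (f_ : (T -> R)^nat)
    (f g : T -> R) :
  measurable D -> (forall n, measurable_fun D (f_ n)) ->
  (forall x, D x -> f_ ^~ x @ \oo --> f x) ->
  mu.-integrable D (EFin \o g) ->
  (forall x n, D x -> `|f_ n x| <= g x) ->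
  mu.-integrable D (EFin \o f) /\
  \int[mu]_(x in D) f_ n x @[n --> \oo] --> \int[mu]_(x in D) f x.
Proof.
move=> mD mf ff ig fg.
have mfl : measurable_fun D f by exact: measurable_fun_cvg mf ff.
have [] := @dominated_convergence _ _ _ mu D mD (fun n => EFin \o f_ n)
  (EFin \o f) (EFin \o g).
- by move=> n; exact/measurable_EFinP.
- exact/measurable_EFinP.
- by apply: aeW => x Dx; apply: cvg_toEFin; exact: ff.
- by [].
- by apply: aeW => x n Dx; rewrite lee_fin fg.
- move=> iF _ h; split => //.
  by apply: fine_cvg; rewrite fineK//; exact: integrable_fin_num.
Qed.

Section Paths.
Context {R : realType}.
Implicit Types (x y : R -> R) (a b s t u e : R).

Lemma right_cvgP y u (l : R) :
  y s @[s --> u^'+] --> l <->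
  forall e, 0 < e -> exists2 dl, 0 < dl &
    forall s, u < s -> s < u + dl -> `|y s - l| < e.
Proof.
split=> [/cvgr_dist_lt yl e e0|h].
  have [dl /= dl0 h] := yl _ e0.
  exists dl => // s us sd; rewrite distrC; apply: h => //=.
  by rewrite ltr0_norm ?subr_lt0// opprB ltrBlDl.
apply/cvgrPdist_lt => e e0; have [dl dl0 hd] := h _ e0.
exists dl => //= s /= + us; rewrite ltr0_norm ?subr_lt0// opprB ltrBlDl => sd.
by rewrite distrC hd.
Qed.

Lemma left_cvgP y u (l : R) :
  y s @[s --> u^'-] --> l <->
  forall e, 0 < e -> exists2 dl, 0 < dl &
    forall s, u - dl < s -> s < u -> `|y s - l| < e.
Proof.
split=> [/cvgr_dist_lt yl e e0|h].
  have [dl /= dl0 h] := yl _ e0.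
  exists dl => // s us sd; rewrite distrC; apply: h => //=.
  by rewrite gtr0_norm ?subr_gt0// ltrBlDl -ltrBlDr.
apply/cvgrPdist_lt => e e0; have [dl dl0 hd] := h _ e0.
exists dl => //= s /= + us; rewrite gtr0_norm ?subr_gt0// => sd.
by rewrite distrC hd// ltrBlDr -ltrBlDl.
Qed.

Lemma seq_cvgP (f : R^nat) (l : R) :
  f @ \oo --> l <->
  forall e, 0 < e -> exists N, forall n, (N <= n)%N -> `|f n - l| < e.
Proof.
split=> [/cvgr_dist_lt fl e e0|h].
  by have [N _ h] := fl _ e0; exists N => n Nn; rewrite distrC; apply: h.
apply/cvgrPdist_lt => e e0; have [N hN] := h _ e0.
by exists N => // n /= /hN; rewrite distrC.
Qed.

(** The index is an arbitrary natural number, so that the grid is monotone on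
    all of nat; its points 0, ..., n.+1 cut [a, b] into n.+1 equal cells. *)
Definition grid a b (n i : nat) : R := a + (b - a) / n.+1%:R * i%:R.

Lemma grid0 a b n : grid a b n 0 = a.
Proof. by rewrite /grid mulr0 addr0. Qed.

Lemma gridn a b n : grid a b n n.+1 = b.
Proof. by rewrite /grid divfK ?pnatr_eq0// addrC subrK. Qed.

Lemma gridS a b n i : grid a b n i.+1 - grid a b n i = (b - a) / n.+1%:R.
Proof. by rewrite /grid -natr1; ring. Qed.

Lemma grid_le a b n : a <= b -> {homo grid a b n : i j / (i <= j)%N >-> i <= j}.
Proof.
by move=> ab i j ij; rewrite lerD2l ler_wpM2l ?ler_nat// divr_ge0// subr_ge0.
Qed.

Lemma grid_ge a b n i : a <= b -> a <= grid a b n i.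
Proof. by move=> ab; rewrite -[leLHS](grid0 a b n) grid_le. Qed.

Lemma grid_leb a b n i : a <= b -> (i <= n.+1)%N -> grid a b n i <= b.
Proof. by move=> ab ?; rewrite -[leRHS](gridn a b n) grid_le. Qed.

Lemma inv_small e : 0 < e -> exists N, forall n, (N <= n)%N -> n.+1%:R^-1 < e :> R.
Proof.
move=> e0; exists (Num.truncn e^-1) => n Nn.
rewrite invf_plt ?posrE//.
have /andP[_ h] := truncn_itv (ltW (eqbRL (invr_gt0 e) e0)).
by apply: lt_le_trans h _; rewrite ler_nat.
Qed.

(** Right endpoints are used in these Riemann sums because the integrand is only
    right-continuous: on [a, b[ it is then the pointwise limit of the step
    functions [st], and dominated convergence gives measurability,
    integrability and convergence of the sums together. *)
Section Riemann.
Variables (a b : R) (y : R -> R) (K : R).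
Hypothesis ab : a < b.
Hypothesis yrc : forall u, a <= u -> u < b -> y s @[s --> u^'+] --> y u.
Hypothesis yK : forall u, a <= u -> u <= b -> `|y u| <= K.

Local Notation p := (grid a b).

Let st n u := \sum_(j < n.+1) y (p n j.+1) * \1_(`[p n j, p n j.+1[) u.

Let cell n u : a <= u -> u < b ->
  exists k : 'I_n.+1, [/\ p n k <= u, u < p n k.+1 & st n u = y (p n k.+1)].
Proof.
move=> au ub; pose v := (u - a) * (n.+1%:R / (b - a)).
have v0 : 0 <= v by rewrite mulr_ge0 ?divr_ge0 ?subr_ge0// ltW.
have uE : u = a + (b - a) / n.+1%:R * v.
  rewrite /v; field; rewrite subr_eq0 gt_eqF// ?pnatr_eq0.
  by rewrite /= addrC natr1 pnatr_eq0.
have d0 : 0 < (b - a) / n.+1%:R by rewrite divr_gt0 ?subr_gt0.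
have cellE m : (p n m <= u) = (m%:R <= v).
  by rewrite /grid uE lerD2l ler_pM2l.
have /andP[k1 k2] := truncn_itv v0; set k := Num.truncn v in k1 k2.
have kn : (k < n.+1)%N.
  rewrite -(ltr_nat R); apply: le_lt_trans k1 _.
  by rewrite ltNge -cellE gridn -ltNge.
exists (Ordinal kn); split => /=.
- by rewrite cellE.
- by rewrite ltNge cellE -ltNge.
- rewrite /st (bigD1 (Ordinal kn))//= indicE mem_set ?mulr1; last first.
    by rewrite /= in_itv/= cellE k1 ltNge cellE -ltNge.
  rewrite big1 ?addr0// => j; rewrite -val_eqE/= => jk.
  rewrite indicE memNset ?mulr0//= in_itv/= cellE ltNge cellE -ltNge.
  move=> /andP[j1 j2]; move/negP: jk; apply.
  have: (j%:R : R) < k.+1%:R := le_lt_trans j1 k2.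
  have: (k%:R : R) < j.+1%:R := le_lt_trans k1 j2.
  by rewrite !ltr_nat !ltnS eqn_leq => -> ->.
Qed.

Let st_cvg u : u \in `[a, b[ -> st n u @[n --> \oo] --> y u.
Proof.
rewrite in_itv/= => /andP[au ub]; apply/seq_cvgP => e e0.
have [dl dl0 hd] := (right_cvgP _ _ _).1 (yrc au ub) e e0.
have [|N hN] := @inv_small (dl / (b - a)); first by rewrite divr_gt0 ?subr_gt0.
exists N => n Nn; have [k [k1 k2 ->]] := cell n au ub.
apply: hd => //; rewrite -ltrBlDl; apply: le_lt_trans (_ : p n k.+1 - p n k < _).
  by rewrite lerD2l lerN2.
by rewrite gridS mulrC -ltr_pdivlMr ?subr_gt0//; exact: hN.
Qed.

Let st_meas n : measurable_fun setT (st n).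
Proof.
apply: measurable_sum => j; apply: measurable_funM; first exact: measurable_cst.
exact: measurable_indic.
Qed.

Let st_bd n u : u \in `[a, b[ -> `|st n u| <= K.
Proof.
rewrite in_itv/= => /andP[au ub]; have [k [_ _ ->]] := cell n au ub.
by apply: yK; [exact/grid_ge/ltW|apply: grid_leb; rewrite ?ltW].
Qed.

Let yco_meas : measurable_fun `[a, b[ y.
Proof.
apply: (@measurable_fun_cvg _ _ _ _ (fun n => st n)).
- by move=> n; apply: measurable_funTS; exact: st_meas.
- by move=> u uD; apply: st_cvg.
Qed.

Lemma riemann_measurable : measurable_fun `[a, b] y.
Proof.
rewrite -(@setUitv1 _ _ (BLeft a) b true)/= ?bnd_simp ?ltW//.
apply/measurable_funU => //; split => //; exact: measurable_fun_set1.
Qed.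

Lemma riemann_integrable : lebesgue_measure.-integrable `[a, b] (EFin \o y).
Proof.
apply: measurable_bounded_integrable => //=.
- by rewrite lebesgue_measure_itv/=; case: ifP => //; rewrite -EFinB ltry.
- exact: riemann_measurable.
- exists K; split; first exact: num_real.
  move=> M KM u /=; rewrite in_itv/= => /andP[au ub].
  by apply: le_trans (ltW KM); exact: yK.
Qed.

Lemma riemann_cvg :
  (b - a) / n.+1%:R * (\sum_(j < n.+1) y (p n j.+1)) @[n --> \oo] -->
  \int[lebesgue_measure]_(u in `[a, b]) y u.
Proof.
rewrite -Rintegral_itv_bndo_bndc; last first.
  apply: integrableS riemann_integrable => //; apply: subset_itvl.
  by rewrite bnd_simp.
have stE n : (\int[lebesgue_measure]_(u in `[a, b[) (st n u)%:E)%E =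
    ((b - a) / n.+1%:R * (\sum_(j < n.+1) y (p n j.+1)))%:E.
  under eq_integral do rewrite -sumEFin.
  have intj (j : 'I_n.+1) : lebesgue_measure.-integrable `[a, b[
      (fun u => (y (p n j.+1) * \1_(`[p n j, p n j.+1[) u)%:E).
    apply: measurable_bounded_integrable => //=.
    - by rewrite lebesgue_measure_itv/=; case: ifP => //; rewrite -EFinB ltry.
    - by apply: measurable_funM; [exact: measurable_cst|exact: measurable_indic].
    - exists `|y (p n j.+1)|; split; first exact: num_real.
      move=> M KM u _ /=; apply: le_trans (ltW KM).
      by rewrite normrM ler_piMr// indicE; case: (_ \in _); rewrite ?normr1 ?normr0.
  rewrite integral_sum//= mulr_sumr -sumEFin; apply: eq_bigr => j _.
  under eq_integral do rewrite EFinM.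
  rewrite integralZl//; last first.
    apply: measurable_bounded_integrable => //=.
    - by rewrite lebesgue_measure_itv/=; case: ifP => //; rewrite -EFinB ltry.
    - exists 1; split; first exact: num_real.
      move=> M KM u _ /=; apply: le_trans (ltW KM).
      by rewrite indicE; case: (_ \in _); rewrite ?normr1 ?normr0.
  rewrite integral_indic// mulrC EFinM; congr (_ * _)%E.
  rewrite setIidl; last first.
    apply: subset_itv; rewrite bnd_simp; first exact/grid_ge/ltW.
    by apply: grid_leb; rewrite ?ltW.
  rewrite [LHS]lebesgue_measure_itv/= lte_fin ifT -?EFinB ?gridS//.
  by rewrite -subr_gt0 gridS divr_gt0 ?subr_gt0.
have ibd : lebesgue_measure.-integrable `[a, b[ (EFin \o cst K).
  apply: measurable_bounded_integrable => //=.
  - by rewrite lebesgue_measure_itv/=; case: ifP => //; rewrite -EFinB ltry.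
  - exists `|K|; split; first exact: num_real.
    by move=> M KM u _ /=; exact: ltW.
have [_] := @Rintegral_dominated_cvg _ _ _ lebesgue_measure `[a, b[%classic st y
  (cst K) (measurable_itv _) (fun n => measurable_funTS (@st_meas n))
  (fun u uD => st_cvg uD) ibd (fun u n uD => st_bd n uD).
by rewrite /Rintegral; under eq_fun do rewrite stE.
Qed.

End Riemann.

(** Only times t >= 0 matter, as for the processes. *)
Definition cadlag_path x :=
  (forall t, 0 <= t -> x s @[s --> t^'+] --> x t) /\
  (forall t, 0 < t -> cvg (x s @[s --> t^'-])).

(** Local bounds, from the right limit and the left limit at each point, are
    patched together by compactness of [0, t]. *)
Lemma cadlag_path_bounded x t : cadlag_path x ->
  exists K, forall u, 0 <= u -> u <= t -> `|x u| <= K.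
Proof.
move=> [xr xl].
(* the bound i goes to infinity along the filter +oo *)
have /compact_near_coveringP/(_ R (+oo_R) (fun i u => 0 <= u -> `|x u| <= i)) :=
  @segment_compact R 0 t.
have hloc u : 0 <= u -> exists K dl : R, 0 < dl /\
    forall v, `|u - v| < dl -> 0 <= v -> `|x v| <= K.
  move=> u0.
  have [d1 d10 h1] := (right_cvgP _ _ _).1 (xr _ u0) 1 ltr01.
  have [l [d2 d20 h2]] : exists l, exists2 d2 : R, 0 < d2 &
      forall v, u - d2 < v -> v < u -> 0 <= v -> `|x v - l| < 1.
    move: u0; rewrite le_eqVlt => /predU1P[<-|u0].
      by exists 0, 1 => // v _ v0; rewrite leNgt v0.
    have [d2 d20 h2] := (left_cvgP _ _ _).1 (xl _ u0) 1 ltr01.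
    by exists (lim (x s @[s --> u^'-])), d2 => // v ? ? _; exact: h2.
  exists (`|x u| + `|l| + 1), (Num.min d1 d2); split; first by rewrite lt_min d10.
  move=> v; rewrite lt_min => /andP[uv1 uv2] v0.
  have [vu|uv|->] := ltgtP v u.
  - have : `|x v - l| < 1 by apply: h2 => //; move: uv2; rewrite gtr0_norm ?subr_gt0//; lra.
    move=> h1'; have := ler_normD (x v - l) l; rewrite subrK => /le_trans; apply.
    have := normr_ge0 (x u); lra.
  - have : `|x v - x u| < 1 by apply: h1 => //; move: uv1; rewrite ltr0_norm ?subr_lt0//; lra.
    move=> h1'; have := ler_normD (x v - x u) (x u); rewrite subrK => /le_trans; apply.
    have := normr_ge0 l; lra.
  - have := normr_ge0 l; lra.
have hcov : forall u : R, u \in `[0, t] ->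
    \forall u' \near u & i \near +oo_R, 0 <= u' -> `|x u'| <= i.
  move=> u; rewrite in_itv/= => /andP[u0 _]; have [K [dl [dl0 h]]] := hloc u u0.
  exists (ball u dl, [set i | K < i]) => /=.
    split; first by exists dl.
    by exists K; split => //; exact: num_real.
  by move=> [v i]/= [uv Ki] v0; apply: le_trans (ltW Ki); exact: h.
move=> /(_ _ hcov) [M [_ hM]].
exists (M + 1) => u u0 ut; apply: (hM (M + 1)) => //=; first by rewrite ltrDl.
by rewrite in_itv/= u0.
Qed.

(** * Averaging a path over the remaining time *)

Section AveragedPath.
Variables (x : R -> R) (T : R).
Hypothesis x_cadlag : cadlag_path x.
Hypothesis T0 : 0 < T.

(** The remaining time, stopped at 0 so that it makes sense for all t. *)
Definition weight (t : R) : R := Num.max 0 (T - t).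

(** On [0, T] this is (T - t) x_t + \int_[0,t] x_u du, the conditional mean at
    time t of the integral of a martingale over [0, T]. *)
Definition avg_path t : R :=
  weight t * x t + \int[lebesgue_measure]_(u in `[0, t]) (if u < T then x u else 0).

Definition avg_rem s t : R :=
  \int[lebesgue_measure]_(u in `[s, t]) (if u < T then x t - x u else 0).

Lemma weight_ge0 t : 0 <= weight t.
Proof. by rewrite /weight le_max lexx. Qed.

Lemma weight_le t : 0 <= t -> weight t <= T.
Proof. by move=> t0; rewrite /weight ge_max ltW//= lerBlDr lerDl. Qed.

Lemma weightE t : t <= T -> weight t = T - t.
Proof. by move=> tT; rewrite /weight max_r// subr_ge0. Qed.

Lemma weight0 t : T <= t -> weight t = 0.
Proof. by move=> tT; rewrite /weight max_l// subr_le0. Qed.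

Lemma weight_lip s t : `|weight s - weight t| <= `|s - t|.
Proof.
have wE r : weight r = if r <= T then T - r else 0.
  by case: ifPn => [/weightE//|]; rewrite -ltNge => /ltW/weight0.
rewrite !wE ler_norml; case: ifPn; case: ifPn; rewrite -?ltNge;
  have := ler_norm (s - t); have := ler_norm (t - s); rewrite (distrC t); lra.
Qed.

(** The affine form c + k x covers at once the integrands x_u and x_t - x_u of
    [avg_path] and [avg_rem]; the cut-off at u < T preserves right-continuity
    since it is strict. *)
Lemma truncated_right_cvg (c k : R) u : 0 <= u ->
  (if s < T then c + k * x s else 0) @[s --> u^'+] -->
  (if u < T then c + k * x u else 0).
Proof.
move=> u0; have [uT|Tu] := ltP u T; last first.
  apply/right_cvgP => e e0; exists 1 => // s us _.
  by rewrite ifF ?subrr ?normr0// ltNge (ltW (le_lt_trans Tu us)).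
have : (c + k * x s) @[s --> u^'+] --> c + k * x u.
  by apply: cvgD; [exact: cvg_cst|apply: cvgM; [exact: cvg_cst|exact: x_cadlag.1]].
move=> /right_cvgP h; apply/right_cvgP => e /h[dl dl0 hd].
exists (Num.min dl (T - u)); first by rewrite lt_min dl0 subr_gt0.
move=> s us sd; have [/andP[h1 h2]] : (s < u + dl) && (s < T).
  by move: sd; rewrite -ltrBlDl lt_min !ltrBlDl (addrC u (T - u)) subrK.
by rewrite h2 hd.
Qed.

Lemma truncated_bounded (c k : R) t : exists K,
  forall u, 0 <= u -> u <= t -> `|if u < T then c + k * x u else 0| <= K.
Proof.
have [K hK] := cadlag_path_bounded t x_cadlag.
exists (`|c| + `|k| * K) => u u0 ut.
have K0 : 0 <= K by apply: le_trans (hK _ u0 ut).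
case: ifP => _; last by rewrite normr0 addr_ge0// mulr_ge0.
by apply: le_trans (ler_normD _ _) _; rewrite lerD2l normrM ler_wpM2l// hK.
Qed.

Lemma truncated_integrable (c k : R) s t : 0 <= s ->
  lebesgue_measure.-integrable `[s, t]
    (EFin \o (fun u => if u < T then c + k * x u else 0)).
Proof.
move=> s0; have [st|] := ltP s t; last first.
  rewrite le_eqVlt => /predU1P[->|ts].
    rewrite set_itv1; apply: measurable_bounded_integrable => //=.
    - by rewrite lebesgue_measure_set1.
    - exact: measurable_fun_set1.
    - exists `|if s < T then c + k * x s else 0|; split; first exact: num_real.
      by move=> M KM u /= ->; exact: ltW.
  by rewrite set_itv_ge ?bnd_simp -?ltNge//; exact: integrable_set0.
have [K hK] := truncated_bounded c k t.
apply: (riemann_integrable st (K := K)) => u su ut.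
  by apply: truncated_right_cvg; exact: le_trans su.
by apply: hK => //; exact: le_trans su.
Qed.

Lemma truncated_incr s t : 0 <= s -> s <= t ->
  \int[lebesgue_measure]_(u in `[0, t]) (if u < T then x u else 0) -
  \int[lebesgue_measure]_(u in `[0, s]) (if u < T then x u else 0) =
  \int[lebesgue_measure]_(u in `[s, t]) (if u < T then x u else 0).
Proof.
move=> s0 st.
have xE : (fun u => if u < T then x u else 0) = (fun u => if u < T then 0 + 1 * x u else 0).
  by apply/funext => u; rewrite add0r mul1r.
rewrite Rintegral_itvB ?bnd_simp//; last by rewrite xE; exact: truncated_integrable.
rewrite Rintegral_itv_obnd_cbnd//.
have := truncated_integrable 0 1 t s0; rewrite -xE.
by apply: integrableS => //; apply: subset_itvr; rewrite bnd_simp.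
Qed.

Lemma integral_before s t : 0 <= s -> s <= t ->
  \int[lebesgue_measure]_(u in `[s, t]) (if u < T then 1 else 0) =
  weight s - weight t.
Proof.
move=> s0 st.
have -> : (fun u => if u < T then 1 else 0) = \1_(`]-oo, T[) :> (R -> R).
  by apply/funext => u; rewrite indicE mem_setE/= in_itv/=; case: ifP.
rewrite /Rintegral integral_indic//.
have [Ts|sT] := leP T s.
  rewrite !weight0 ?subrr//; last exact: le_trans st.
  rewrite (_ : _ `&` _ = set0) ?measure0// -subset0 => u [] /=.
  by rewrite !in_itv/= => uT /andP[su _]; rewrite ltNge (le_trans Ts su) in uT.
have [tT|Tt] := ltP t T.
  rewrite setIidr; last first.
    move=> u /=; rewrite !in_itv/= => /andP[_ ut]; exact: le_lt_trans ut tT.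
  rewrite [X in fine X]lebesgue_measure_itv/= !weightE ?(ltW sT) ?(ltW tT)//.
  case: ifPn => [_|]; first by rewrite -EFinB/=; ring.
  rewrite lte_fin -leNgt => ts; have -> : s = t by apply/eqP; rewrite eq_le st.
  by rewrite subrr.
rewrite (_ : _ `&` _ = `[s, T[%classic); last first.
  apply/seteqP; split=> u /=; rewrite !in_itv/=.
    by move=> [-> /andP[->]].
  by move=> /andP[-> uT]; rewrite uT (le_trans (ltW uT) Tt).
rewrite [X in fine X]lebesgue_measure_itv/= lte_fin sT -EFinB/=.
by rewrite weightE ?(ltW sT)// weight0// subr0.
Qed.

(** Integration by parts: the length of [s, t] before T is the decrease of the
    weight, so the increment of the Lebesgue integral is x_t times that decrease,
    up to the remainder. *)
Lemma avg_incr s t : 0 <= s -> s <= t ->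
  avg_path t - avg_path s = weight s * (x t - x s) - avg_rem s t.
Proof.
move=> s0 st; have t0 := le_trans s0 st.
have -> : avg_rem s t = x t * (weight s - weight t) -
    \int[lebesgue_measure]_(u in `[s, t]) (if u < T then x u else 0).
  rewrite -integral_before// -RintegralZl//; last first.
    have := truncated_integrable 1 0 t s0; apply: eq_integrable => // u _ /=.
    by rewrite mul0r addr0.
  rewrite -RintegralB//.
  - by apply: eq_Rintegral => u _; case: ifP => _; rewrite ?mulr1 ?mulr0 ?subrr.
  - have := truncated_integrable (x t) 0 t s0; apply: eq_integrable => // u _ /=.
    by rewrite mul0r addr0; case: ifP => _; rewrite ?mulr1 ?mulr0.
  - have := truncated_integrable 0 1 t s0; apply: eq_integrable => // u _ /=.
    by rewrite mul1r add0r.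
by rewrite -truncated_incr// /avg_path; ring.
Qed.

Lemma avg_rem_bound K s t : 0 <= s -> s <= t ->
  (forall u, s <= u -> u <= t -> `|x u| <= K) ->
  `|avg_rem s t| <= 2 * K * (t - s).
Proof.
move=> s0 st hK.
have K0 : 0 <= K by apply: le_trans (hK _ st (lexx t)).
have rE : (fun u => if u < T then x t - x u else 0) =
    (fun u => if u < T then x t + (-1) * x u else 0).
  by apply/funext => u; rewrite mulN1r.
have ir : lebesgue_measure.-integrable `[s, t]
    (EFin \o (fun u => if u < T then x t - x u else 0)).
  by rewrite rE; exact: truncated_integrable.
have ic : lebesgue_measure.-integrable `[s, t] (EFin \o cst (2 * K)).
  apply: measurable_bounded_integrable => //=.
  - by rewrite lebesgue_measure_itv/=; case: ifP => //; rewrite -EFinB ltry.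
  - exists `|2 * K|; split; first exact: num_real.
    by move=> M KM u _ /=; exact: ltW.
apply: le_trans (le_normr_Rintegral _ ir) _ => //.
apply: (@le_trans _ _ (\int[lebesgue_measure]_(u in `[s, t]) (2 * K))).
  apply: le_Rintegral => //.
    exact: integrable_norm.
  move=> u /=; rewrite in_itv/= => /andP[su ut]; case: ifP => _; last by rewrite normr0 mulr_ge0.
  apply: le_trans (ler_normB _ _) _.
  have := hK _ st (lexx t); have := hK _ su ut; lra.
rewrite Rintegral_cst// ler_wpM2l ?mulr_ge0//.
rewrite [X in fine X]lebesgue_measure_itv/=; case: ifP => _; first by rewrite -EFinB.
by rewrite subr_ge0.
Qed.

Lemma avg_rem_riemann s t : 0 <= s -> s < t ->
  (t - s) / n.+1%:R * (\sum_(j < n.+1)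
     (if grid s t n j.+1 < T then x t - x (grid s t n j.+1) else 0))
  @[n --> \oo] --> avg_rem s t.
Proof.
move=> s0 st.
have [K hK] := truncated_bounded (x t) (-1) t.
have rE : (fun u => if u < T then x t - x u else 0) =
    (fun u => if u < T then x t + (-1) * x u else 0).
  by apply/funext => u; rewrite mulN1r.
apply: (@riemann_cvg s t (fun u => if u < T then x t - x u else 0) K) => //.
  move=> u su ut; have := @truncated_right_cvg (x t) (-1) u (le_trans s0 su).
  by rewrite mulN1r -rE.
move=> u su ut; have := hK u (le_trans s0 su) ut.
by case: ifP => // _; rewrite mulN1r.
Qed.

Lemma avg_final : avg_path T = \int[lebesgue_measure]_(u in `[0, T]) x u.
Proof.
rewrite /avg_path weight0// mul0r add0r.
have [K hK] := cadlag_path_bounded T x_cadlag.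
rewrite -!Rintegral_itv_bndo_bndc.
- by apply: eq_Rintegral => u; rewrite inE/= in_itv/= => /andP[_ ->].
- have : lebesgue_measure.-integrable `[0, T] (EFin \o x).
    by apply: (riemann_integrable T0 (K := K)) => // u u0 _; exact: x_cadlag.1.
  by apply: integrableS => //; apply: subset_itvl; rewrite bnd_simp.
- have := truncated_integrable 0 1 T (lexx 0).
  have -> : (fun u => if u < T then 0 + 1 * x u else 0) = (fun u => if u < T then x u else 0).
    by apply/funext => u; rewrite mul1r add0r.
  by apply: integrableS => //; apply: subset_itvl; rewrite bnd_simp.
Qed.

Lemma avg_stopped t : T <= t -> avg_path t = avg_path T.
Proof.
move=> Tt; apply/eqP; rewrite -subr_eq0 avg_incr// ?(ltW T0)// weight0// mul0r sub0r.
rewrite oppr_eq0 /avg_rem (@eq_Rintegral _ _ _ lebesgue_measure _ (cst 0)) ?Rintegral_cst ?mul0r//.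
by move=> u; rewrite inE/= in_itv/= => /andP[Tu _]; rewrite ltNge Tu.
Qed.

(** Both the remainder and the variation of the weight over [s, t] are O(t - s),
    because the path is bounded; only weight t * (x t - x s) survives as s
    increases to t. *)
Lemma avg_jump t : 0 < t ->
  avg_path s @[s --> t^'-] -->
  avg_path t - weight t * (x t - lim (x s @[s --> t^'-])).
Proof.
move=> t0; set l := lim _; have xl : x s @[s --> t^'-] --> l by exact: x_cadlag.2.
have [K hK] := cadlag_path_bounded t x_cadlag.
have K0 : 0 <= K by apply: le_trans (hK 0 (lexx 0) (ltW t0)).
apply/left_cvgP => e e0.
have C0 : 0 < T + 1 by rewrite ltr_wpDr// ltW.
have e'0 : 0 < e / (2 * (T + 1)) by rewrite divr_gt0// mulr_gt0.
have [d1 d10 h1] := (left_cvgP _ _ _).1 xl _ e'0.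
pose D := 2 * (2 * K + (K + `|l|)) + 1.
have D0 : 0 < D by rewrite ltr_wpDl// mulr_ge0// !addr_ge0// mulr_ge0.
exists (Num.min d1 (Num.min t (e / D))) => [|s].
  by rewrite !lt_min d10 t0 divr_gt0.
rewrite ltrBlDr -ltrBlDl !lt_min => /and3P[sd st se] s_t.
have s0 : 0 <= s by lra.
have /h1 - /(_ s_t) {}h1 : t - d1 < s by lra.
have -> : avg_path s - (avg_path t - weight t * (x t - l)) =
    - ((weight s - weight t) * (x t - l)) + weight s * (x s - l) + avg_rem s t.
  have := avg_incr s0 (ltW s_t); lra.
have hr := avg_rem_bound s0 (ltW s_t) (fun u su ut => hK u (le_trans s0 su) ut).
apply: le_lt_trans (ler_normD _ _) _.
apply: le_lt_trans (lerD (ler_normD _ _) hr) _.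
rewrite normrN !normrM.
have hw : `|weight s - weight t| <= t - s.
  by apply: le_trans (weight_lip _ _) _; rewrite distrC gtr0_norm ?subr_gt0.
have hw2 : `|weight s| <= T by rewrite ger0_norm ?weight_ge0// weight_le.
have h3 : `|x t - l| <= K + `|l|.
  by apply: le_trans (ler_normB _ _) _; rewrite lerD2r hK// ltW.
have e1 : `|weight s - weight t| * `|x t - l| <= (t - s) * (K + `|l|).
  by rewrite ler_pM.
have e2 : `|weight s| * `|x s - l| <= T * (e / (2 * (T + 1))).
  by rewrite ler_pM// ltW.
have e3 : T * (e / (2 * (T + 1))) < e / 2.
  rewrite [X in X < _](_ : _ = (e / 2) * (T / (T + 1))); last by field; rewrite gt_eqF.
  by rewrite gtr_pMr ?divr_gt0// ltr_pdivrMr// mul1r ltrDl.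
have e4 : (t - s) * D < e by rewrite -ltr_pdivlMr.
have e5 : (t - s) * D = 2 * ((t - s) * (2 * K + (K + `|l|))) + (t - s).
  by rewrite /D; ring.
nra.
Qed.

Lemma avg_cadlag : cadlag_path avg_path.
Proof.
split=> t t0; last by apply/cvg_ex; eexists; exact: avg_jump.
have [K hK] := cadlag_path_bounded (t + 1) x_cadlag.
have t1 : t <= t + 1 by rewrite lerDl.
have K0 : 0 <= K by apply: le_trans (hK _ t0 t1).
apply/right_cvgP => e e0.
have C0 : 0 < T + 1 by rewrite ltr_wpDr// ltW.
have e'0 : 0 < e / (2 * (T + 1)) by rewrite divr_gt0// mulr_gt0.
have [d1 d10 h1] := (right_cvgP _ _ _).1 (x_cadlag.1 _ t0) _ e'0.
pose D := 4 * K + 1.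
have D0 : 0 < D by rewrite ltr_wpDl// mulr_ge0.
exists (Num.min d1 (Num.min 1 (e / D))) => [|s ts].
  by rewrite !lt_min d10 ltr01 divr_gt0.
rewrite -ltrBlDl !lt_min => /and3P[sd s1 se].
have /h1 {}h1 : s < t + d1 by lra.
have := avg_rem_bound t0 (ltW ts) (fun u tu us =>
  hK u (le_trans t0 tu) (le_trans us (ltW (eqbLR (ltrBlDl _ _ _) s1)))).
move=> hr; rewrite (avg_incr t0 (ltW ts)).
apply: le_lt_trans (ler_normB _ _) _.
apply: le_lt_trans (lerD (lexx _) hr) _.
rewrite normrM (ger0_norm (weight_ge0 _)).
have e2 : weight t * `|x s - x t| <= T * (e / (2 * (T + 1))).
  by rewrite ler_pM ?weight_ge0 ?weight_le// ltW// h1.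
have e3 : T * (e / (2 * (T + 1))) < e / 2.
  rewrite [X in X < _](_ : _ = (e / 2) * (T / (T + 1))); last by field; rewrite gt_eqF.
  by rewrite gtr_pMr ?divr_gt0// ltr_pdivrMr// mul1r ltrDl.
have e4 : (s - t) * D < e by rewrite -ltr_pdivlMr.
have e5 : (s - t) * D = 2 * (2 * K * (s - t)) + (s - t) by rewrite /D; ring.
nra.
Qed.

End AveragedPath.
End Paths.

(** * Integrable and square integrable random variables *)

Section RealIntegral.
Context {d : measure_display} {T : measurableType d} {R : realType}.
Variable P : {finite_measure set T -> \bar R}.
Implicit Types (f g h : T -> R).

Definition Int f := P.-integrable setT (EFin \o f).
Definition Ex f : R := \int[P]_w f w.

Lemma Int_meas f : Int f -> measurable_fun setT f.
Proof. by move=> /measurable_int/measurable_EFinP. Qed.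

Lemma IntD f g : Int f -> Int g -> Int (fun w => f w + g w).
Proof. by move=> hf hg; exact: (integrableD measurableT hf hg). Qed.

Lemma IntB f g : Int f -> Int g -> Int (fun w => f w - g w).
Proof. by move=> hf hg; exact: (integrableB measurableT hf hg). Qed.

Lemma IntZ k f : Int f -> Int (fun w => k * f w).
Proof. by move=> hf; exact: (integrableZl measurableT k hf). Qed.

Lemma Int_dom f g : measurable_fun setT f -> Int g ->
  (forall w, `|f w| <= g w) -> Int f.
Proof.
move=> mf ig fg; apply: le_integrable ig => //; first exact/measurable_EFinP.
by move=> w _ /=; rewrite lee_fin (le_trans (fg w))// ler_norm.
Qed.

Lemma Int_bd f K : measurable_fun setT f -> (forall w, `|f w| <= K) -> Int f.
Proof.
move=> mf fK; apply: measurable_bounded_integrable => //.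
  exact: fin_num_fun_lty.
exists K; split; first exact: num_real.
by move=> M KM w _ /=; exact: le_trans (ltW KM).
Qed.

Lemma Int_cst k : Int (fun=> k).
Proof. by apply: (@Int_bd _ `|k|). Qed.

Lemma Int_norm f : Int f -> Int (fun w => `|f w|).
Proof. exact: integrable_norm. Qed.

Lemma Int_sum n (f : nat -> T -> R) : (forall i, (i < n)%N -> Int (f i)) ->
  Int (fun w => \sum_(i < n) f i w).
Proof.
elim: n => [|n IHn] hf.
  by under eq_fun do rewrite big_ord0; exact: Int_cst.
under eq_fun do rewrite big_ord_recr/=.
by apply: IntD; [apply: IHn => i /ltnW; exact: hf|exact: hf].
Qed.

Lemma ExD f g : Int f -> Int g -> Ex (fun w => f w + g w) = Ex f + Ex g.
Proof. by move=> hf hg; apply: RintegralD. Qed.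

Lemma ExB f g : Int f -> Int g -> Ex (fun w => f w - g w) = Ex f - Ex g.
Proof. by move=> hf hg; apply: RintegralB. Qed.

Lemma ExZ k f : Int f -> Ex (fun w => k * f w) = k * Ex f.
Proof. by move=> hf; apply: RintegralZl. Qed.

Lemma Ex_cst k : Ex (fun=> k) = k * fine (P setT).
Proof. exact: Rintegral_cst. Qed.

Lemma Ex_sum n (f : nat -> T -> R) : (forall i, (i < n)%N -> Int (f i)) ->
  Ex (fun w => \sum_(i < n) f i w) = \sum_(i < n) Ex (f i).
Proof.
elim: n => [|n IHn] hf.
  by under eq_fun do rewrite big_ord0; rewrite big_ord0 Ex_cst mul0r.
under eq_fun do rewrite big_ord_recr/=; rewrite big_ord_recr/= ExD ?IHn//.
- by move=> i /ltnW; exact: hf.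
- by apply: Int_sum => i /ltnW; exact: hf.
- exact: hf.
Qed.

Lemma Ex_ge0 f : (forall w, 0 <= f w) -> 0 <= Ex f.
Proof. by move=> f0; apply: Rintegral_ge0. Qed.

Lemma Ex_le f g : Int f -> Int g -> (forall w, f w <= g w) -> Ex f <= Ex g.
Proof. by move=> hf hg fg; apply: le_Rintegral. Qed.

Lemma Ex_norm f : Int f -> `|Ex f| <= Ex (fun w => `|f w|).
Proof. by move=> hf; apply: le_normr_Rintegral. Qed.

Lemma Ex_EFin f : Int f -> (Ex f)%:E = (\int[P]_w (f w)%:E)%E.
Proof. by move=> hf; rewrite /Ex /Rintegral fineK//; exact: integrable_fin_num. Qed.

Lemma Int_ge0 f : measurable_fun setT f -> (forall w, 0 <= f w) ->
  (\int[P]_w (f w)%:E < +oo)%E -> Int f.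
Proof.
move=> mf f0 fi; apply/integrableP; split; first exact/measurable_EFinP.
by under eq_integral do rewrite /= ger0_norm//.
Qed.

Lemma Ex_eq0 f : Int f -> (forall w, 0 <= f w) -> Ex f = 0 ->
  {ae P, forall w, f w = 0}.
Proof.
move=> hf f0 h.
have : (\int[P]_w `|(f w)%:E| = 0)%E.
  by under eq_integral do rewrite /= ger0_norm//; rewrite -Ex_EFin// h.
move/(ae_eq_integral_abs P measurableT (measurable_int P hf)).1.
by apply: filterS => w /(_ I)/= -[].
Qed.

Lemma Int_ae f g : measurable_fun setT f -> Int g -> {ae P, forall w, f w = g w} -> Int f.
Proof.
move=> mf ig fg; apply/integrableP; split; first exact/measurable_EFinP.
have [mg ig'] := integrableP _ _ _ ig.
suff -> : (\int[P]_w `|(EFin \o f) w| = \int[P]_w `|(EFin \o g) w|)%E by [].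
apply: ae_eq_integral => //.
- by apply: measurableT_comp => //; exact/measurable_EFinP.
- by apply: measurableT_comp => //; exact/measurable_EFinP.
- by apply: filterS fg => w /= ->.
Qed.

Lemma Ex_ae f g : measurable_fun setT f -> measurable_fun setT g ->
  {ae P, forall w, f w = g w} -> Ex f = Ex g.
Proof.
move=> mf mg fg; congr fine; apply: ae_eq_integral => //.
- exact/measurable_EFinP.
- exact/measurable_EFinP.
- by apply: filterS fg => w /= ->.
Qed.

Lemma Ex_ind f (A : set T) : measurable A -> Int f ->
  (\int[P]_(w in A) (f w)%:E = (Ex (fun w => \1_A w * f w))%:E)%E.
Proof.
move=> mA hf; rewrite Ex_EFin.
  rewrite integral_mkcond; apply: eq_integral => w _; rewrite patchE indicE.
  by case: (w \in A); rewrite ?mul1r ?mul0r.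
apply: Int_dom (Int_norm hf) _.
  by apply: measurable_funM; [exact: measurable_indic|exact: Int_meas].
by move=> w; rewrite normrM ler_piMl// indicE; case: (_ \in _); rewrite ?normr1 ?normr0.
Qed.

Definition L2 f := measurable_fun setT f /\ Int (fun w => f w ^+ 2).

Lemma L2_dom f h : measurable_fun setT f -> Int h ->
  (forall w, f w ^+ 2 <= h w) -> L2 f.
Proof.
move=> mf hh fh; split => //; apply: Int_dom hh _; first exact: measurable_funX.
by move=> w; rewrite ger0_norm ?sqr_ge0.
Qed.

Lemma L2M_Int f g : L2 f -> L2 g -> Int (fun w => f w * g w).
Proof.
move=> [mf f2] [mg g2]; apply: Int_dom (IntD f2 g2) _.
  exact: measurable_funM.
move=> w; rewrite normrM -(real_normK (num_real (f w))) -(real_normK (num_real (g w))).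
nra.
Qed.

Lemma L2_Int f : L2 f -> Int f.
Proof.
move=> [mf f2]; apply: Int_dom (IntD (Int_cst 1) f2) _ => // w.
rewrite -(real_normK (num_real (f w))); have := sqr_ge0 (`|f w| - 1).
have := normr_ge0 (f w); nra.
Qed.

Lemma L2D f g : L2 f -> L2 g -> L2 (fun w => f w + g w).
Proof.
move=> hf hg; apply: (L2_dom _ (IntD (IntZ 2 hf.2) (IntZ 2 hg.2))).
  by apply: measurable_funD; [exact: hf.1|exact: hg.1].
by move=> w; have := sqr_ge0 (f w - g w); nra.
Qed.

Lemma L2bM K (c : T -> R) f : measurable_fun setT c -> (forall w, `|c w| <= K) ->
  L2 f -> L2 (fun w => c w * f w).
Proof.
move=> mc cK [mf f2]; apply: (L2_dom _ (IntZ (K ^+ 2) f2)).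
  exact: measurable_funM.
move=> w; rewrite exprMn ler_wpM2r ?sqr_ge0//.
by rewrite -(real_normK (num_real (c w))) lerXn2r ?nnegrE// (le_trans _ (cK w)).
Qed.

Lemma L2Z k f : L2 f -> L2 (fun w => k * f w).
Proof. by apply: (@L2bM `|k|). Qed.

Lemma L2B f g : L2 f -> L2 g -> L2 (fun w => f w - g w).
Proof.
move=> hf hg; have := L2D hf (L2Z (-1) hg).
by under eq_fun do rewrite mulN1r.
Qed.

Lemma L2_cst k : L2 (fun=> k).
Proof. by split => //; exact: Int_cst. Qed.

Lemma L2_sum n (f : nat -> T -> R) : (forall i, (i < n)%N -> L2 (f i)) ->
  L2 (fun w => \sum_(i < n) f i w).
Proof.
elim: n => [|n IHn] hf.
  by under eq_fun do rewrite big_ord0; exact: L2_cst.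
under eq_fun do rewrite big_ord_recr/=.
by apply: L2D; [apply: IHn => i /ltnW; exact: hf|exact: hf].
Qed.

Lemma pythagoras n (f : nat -> T -> R) : (forall i, (i < n)%N -> L2 (f i)) ->
  (forall i, (i < n)%N -> Ex (fun w => (\sum_(j < i) f j w) * f i w) = 0) ->
  Ex (fun w => (\sum_(i < n) f i w) ^+ 2) = \sum_(i < n) Ex (fun w => f i w ^+ 2).
Proof.
elim: n => [|n IHn] hf h0.
  by under eq_fun do rewrite big_ord0 expr0n/=; rewrite big_ord0 Ex_cst mul0r.
have hS : L2 (fun w => \sum_(i < n) f i w).
  by apply: L2_sum => i /ltnW; exact: hf.
rewrite big_ord_recr/= -IHn; [|by move=> i /ltnW; exact: hf|by move=> i /ltnW; exact: h0].
under eq_fun do rewrite big_ord_recr/= sqrrD -mulr_natl.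
have i1 := hS.2; have i2 := L2M_Int hS (hf n (ltnSn n)); have i3 := (hf n (ltnSn n)).2.
by rewrite ExD// ?ExD// ?ExZ ?h0 ?mulr0 ?addr0//; [exact: IntZ|apply: IntD => //; exact: IntZ].
Qed.

Lemma sqr_sum_le n (y : nat -> R) :
  (\sum_(i < n) y i) ^+ 2 <= n%:R * \sum_(i < n) y i ^+ 2.
Proof.
elim: n => [|n IHn]; first by rewrite !big_ord0 mul0r expr0n.
rewrite !big_ord_recr/= -natr1 sqrrD.
have : (\sum_(i < n) y i) * y n *+ 2 <= \sum_(i < n) y i ^+ 2 + n%:R * y n ^+ 2.
  rewrite mulr_suml -sumrMnl.
  have -> : n%:R * y n ^+ 2 = \sum_(i < n) y n ^+ 2.
    by rewrite sumr_const card_ord mulr_natl.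
  rewrite -big_split/=; apply: ler_sum => i _; rewrite mulr2n.
  by have := sqr_ge0 (y i - y n); nra.
nra.
Qed.

(** The second moments are only bounded up to an arbitrarily small error for
    large n, which is what discretizations provide. *)
Lemma fatou_L2 (f_ : nat -> T -> R) f C : (forall n, L2 (f_ n)) ->
  (forall w, f_ n w @[n --> \oo] --> f w) ->
  (forall e, 0 < e -> exists N, forall n, (N <= n)%N ->
    Ex (fun w => f_ n w ^+ 2) <= C + e) ->
  L2 f /\ Ex (fun w => f w ^+ 2) <= C.
Proof.
move=> h_ fcvg hC.
have mf : measurable_fun setT f.
  by apply: (@measurable_fun_cvg _ _ _ _ f_) => [n|w _]; [exact: (h_ n).1|exact: fcvg].
have hfat e : 0 < e -> (\int[P]_w (f w ^+ 2)%:E <= (C + e)%:E)%E.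
  move=> /hC[N hN].
  (* shift the sequence by N so that the bound on second moments holds for all
     indices *)
  have fE : (fun w => (f w ^+ 2)%:E) =
      (fun w => limn_einf (fun n => (f_ (n + N)%N w ^+ 2)%:E)).
    apply/funext => w; apply/esym.
    have h : (f_ (n + N)%N w ^+ 2)%:E @[n --> \oo] --> (f w ^+ 2)%:E.
      apply: cvg_toEFin; rewrite expr2; under eq_fun do rewrite expr2.
      by apply: cvgM; rewrite (cvg_shiftn N (fun n => f_ n w)); exact: fcvg.
    exact: (cvg_limn_einf_sup h).1.
  rewrite fE; apply: le_trans.
    apply: (@fatou _ _ _ P setT measurableT (fun n w => (f_ (n + N)%N w ^+ 2)%:E)).
    - by move=> n; exact: (measurable_int P (h_ (n + N)%N).2).
    - by move=> n w _; rewrite lee_fin sqr_ge0.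
  rewrite limn_einf_lim; apply: lime_le; first exact: is_cvg_einfs.
  apply: nearW => n; apply: le_trans (_ : (\int[P]_w (f_ (n + N)%N w ^+ 2)%:E <= _)%E).
    by apply: ereal_inf_lbound; exists n => /=.
  by rewrite -Ex_EFin ?lee_fin ?hN ?leq_addl//; exact: (h_ _).2.
have if2 : Int (fun w => f w ^+ 2).
  apply: Int_ge0; first exact: measurable_funX.
    by move=> w; exact: sqr_ge0.
  by apply: le_lt_trans (hfat _ ltr01) _; rewrite ltry.
split=> //; apply/ler_addgt0Pr => e e0.
by rewrite -lee_fin Ex_EFin// hfat.
Qed.

Lemma Ex_cvg (f_ : nat -> T -> R) f g : (forall n, measurable_fun setT (f_ n)) ->
  (forall w, f_ n w @[n --> \oo] --> f w) -> Int g ->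
  (forall n w, `|f_ n w| <= g w) ->
  Int f /\ Ex (f_ n) @[n --> \oo] --> Ex f.
Proof.
move=> mf fc ig fg.
exact: (@Rintegral_dominated_cvg _ _ _ P setT f_ f g).
Qed.

End RealIntegral.

Lemma Ex_cstP d (T : measurableType d) (R : realType) (P : probability T R) (k : R) :
  Ex P (fun=> k) = k.
Proof.
rewrite Ex_cst (_ : fine _ = 1) ?mulr1// -[RHS]/(fine 1%E); congr fine.
exact: probability_setT.
Qed.

Lemma ind_le1 {d} {T : measurableType d} {R : realType} (A : set T) w :
  `|\1_A w : R| <= 1.
Proof. by rewrite indicE; case: (_ \in _); rewrite ?normr1 ?normr0. Qed.

(** * Random variables measurable for a sub-sigma-algebra *)

Section SubSigmaAlgebra.
Context {d : measure_display} {T : measurableType d} {R : realType}.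
Variable P : probability T R.
Variable G : set (set T).
Hypothesis Gsig : sigma_algebra setT G.
Hypothesis Gmeas : G `<=` measurable.
Implicit Types f g Y Z : T -> R.

Lemma mwrtP f : measurable_wrt G f <-> measurable_fun setT (f : g_sigma_algebraType G -> R).
Proof.
have GE := sigma_algebra_id Gsig.
split=> [mf _ B mB|mf B mB].
  by rewrite setTI /measurable/= GE; exact: mf.
by have := mf measurableT B mB; rewrite setTI /measurable/= GE.
Qed.

Lemma mwrt_meas f : measurable_wrt G f -> measurable_fun setT f.
Proof. by move=> mf _ B mB; rewrite setTI; apply: Gmeas; exact: mf. Qed.

Lemma mwrtD f g : measurable_wrt G f -> measurable_wrt G g ->
  measurable_wrt G (fun w => f w + g w).
Proof. by move=> /mwrtP ? /mwrtP ?; apply/mwrtP; exact: measurable_funD. Qed.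

Lemma mwrtB f g : measurable_wrt G f -> measurable_wrt G g ->
  measurable_wrt G (fun w => f w - g w).
Proof. by move=> /mwrtP ? /mwrtP ?; apply/mwrtP; exact: measurable_funB. Qed.

Lemma mwrtM f g : measurable_wrt G f -> measurable_wrt G g ->
  measurable_wrt G (fun w => f w * g w).
Proof. by move=> /mwrtP ? /mwrtP ?; apply/mwrtP; exact: measurable_funM. Qed.

Lemma mwrt_cst (k : R) : measurable_wrt G (fun=> k).
Proof. by apply/mwrtP; exact: measurable_cst. Qed.

Lemma mwrtZ k f : measurable_wrt G f -> measurable_wrt G (fun w => k * f w).
Proof. by apply: mwrtM; exact: mwrt_cst. Qed.

Lemma mwrtX n f : measurable_wrt G f -> measurable_wrt G (fun w => f w ^+ n).
Proof. by move=> /mwrtP ?; apply/mwrtP; exact: measurable_funX. Qed.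

Lemma mwrt_sum n (f : nat -> T -> R) :
  (forall i, (i < n)%N -> measurable_wrt G (f i)) ->
  measurable_wrt G (fun w => \sum_(i < n) f i w).
Proof.
elim: n => [|n IHn] hf.
  by under eq_fun do rewrite big_ord0; exact: mwrt_cst.
under eq_fun do rewrite big_ord_recr/=.
by apply: mwrtD; [apply: IHn => i /ltnW; exact: hf|exact: hf].
Qed.

Lemma mwrt_cvg (f_ : nat -> T -> R) f : (forall n, measurable_wrt G (f_ n)) ->
  (forall w, f_ n w @[n --> \oo] --> f w) -> measurable_wrt G f.
Proof.
move=> mf fc; apply/mwrtP.
apply: (@measurable_fun_cvg _ (g_sigma_algebraType G) R setT f_) => [n|w _].
  exact/mwrtP.
exact: fc.
Qed.

Lemma mwrt_indic A : G A -> measurable_wrt G (\1_A : T -> R).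
Proof.
move=> GA; apply/mwrtP; apply: measurable_indic.
by rewrite /measurable/= (sigma_algebra_id Gsig).
Qed.

(** A variable Z with mean zero on every event of G is orthogonal to every
    G-measurable Y with Y Z integrable: indicators, simple functions, dominated
    limits, then positive and negative parts. *)
Section Pullout.
Variable Z : T -> R.
Hypothesis iZ : Int P Z.
Hypothesis Z0 : forall A, G A -> (\int[P]_(w in A) (Z w)%:E = 0)%E.

Lemma pullout_indic A : G A -> Ex P (fun w => \1_A w * Z w) = 0.
Proof.
move=> GA; have mA := Gmeas GA.
rewrite /Ex /Rintegral -[RHS]/(fine 0%E) -(Z0 GA) [in RHS]integral_mkcond/=.
congr fine; apply: eq_integral => w _; rewrite patchE indicE.
by case: (w \in A); rewrite ?mul1r ?mul0r.
Qed.

Lemma pullout_nnsfun (h : {nnsfun (g_sigma_algebraType G) >-> R}) :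
  Ex P (fun w => h w * Z w) = 0.
Proof.
have -> : (fun w => h w * Z w) = (fun w =>
    \sum_(y <- fset_set (range h)) (y * \1_(h @^-1` [set y]) w * Z w)).
  by apply/funext => w; rewrite {1}fimfunE fsbig_finite//= mulr_suml.
have Gh y : G (h @^-1` [set y]).
  have := @measurable_sfunP _ _ _ _ h [set y] (measurable_set1 y).
  by rewrite /measurable/= (sigma_algebra_id Gsig).
have iy y : Int P (fun w => y * \1_(h @^-1` [set y]) w * Z w).
  under eq_fun do rewrite -mulrA; apply: IntZ.
  apply: Int_dom (Int_norm iZ) _.
    apply: measurable_funM; last exact: Int_meas iZ.
    by apply: measurable_indic; exact: Gmeas.
  move=> w; rewrite normrM ler_piMl// indicE.
  by case: (_ \in _); rewrite ?normr1 ?normr0.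
elim: (fset_set _ : seq R) => [|y s IHs].
  by under eq_fun do rewrite big_nil; rewrite Ex_cst mul0r.
under eq_fun do rewrite big_cons; rewrite ExD//.
  rewrite IHs addr0; under eq_fun do rewrite -mulrA.
  rewrite ExZ ?pullout_indic ?mulr0//.
  apply: Int_dom (Int_norm iZ) _.
    apply: measurable_funM; last exact: Int_meas iZ.
    by apply: measurable_indic; exact: Gmeas.
  move=> w; rewrite normrM ler_piMl// indicE.
  by case: (_ \in _); rewrite ?normr1 ?normr0.
elim: (s) => [|z s' IH].
  by under eq_fun do rewrite big_nil; exact: Int_cst.
by under eq_fun do rewrite big_cons; exact: IntD.
Qed.

Lemma pullout_ge0 Y : measurable_wrt G Y -> (forall w, 0 <= Y w) ->
  Int P (fun w => Y w * Z w) -> Ex P (fun w => Y w * Z w) = 0.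
Proof.
move=> mY Y0 iYZ; have /mwrtP mY' := mY.
have mYe : measurable_fun setT (EFin \o Y : g_sigma_algebraType G -> \bar R).
  exact/measurable_EFinP.
pose h n := nnsfun_approx (@measurableT _ (g_sigma_algebraType G)) mYe n.
have hY w : h n w @[n --> \oo] --> Y w.
  have := @cvg_nnsfun_approx _ (g_sigma_algebraType G) R setT measurableT _ mYe
    (fun w _ => Y0 w) w I.
  by move=> /fine_cvg; apply.
have hle n w : h n w <= Y w.
  rewrite /h nnsfun_approxE -lee_fin.
  apply: (@le_approx _ (g_sigma_algebraType G) R setT (EFin \o Y)) => // w' _.
  by rewrite lee_fin.
have hm n : measurable_fun setT (h n : T -> R).
  apply: mwrt_meas; apply/mwrtP; exact: measurable_funP.
have m1 n : measurable_fun setT (fun w : T => h n w * Z w).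
  by apply: measurable_funM; [exact: hm|exact: Int_meas iZ].
have c1 w : h n w * Z w @[n --> \oo] --> Y w * Z w.
  by apply: cvgM; [exact: hY|exact: cvg_cst].
have d1 n w : `|h n w * Z w| <= `|Y w * Z w|.
  by rewrite !normrM ler_wpM2r// !ger0_norm.
have [_] := Ex_cvg m1 c1 (Int_norm iYZ) d1.
under eq_fun do rewrite pullout_nnsfun.
by move=> h0; apply/esym/(cvg_unique _ _ h0) => //; exact: cvg_cst.
Qed.

Lemma pullout Y : measurable_wrt G Y ->
  Int P (fun w => Y w * Z w) -> Ex P (fun w => Y w * Z w) = 0.
Proof.
move=> mY iYZ; have /mwrtP mY' := mY.
have mp : measurable_wrt G (fun w => Num.max (Y w) 0).
  by apply/mwrtP; apply: measurable_maxr => //; exact: measurable_cst.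
have mn : measurable_wrt G (fun w => Num.max (- Y w) 0).
  apply/mwrtP; apply: measurable_maxr; last exact: measurable_cst.
  exact: measurableT_comp.
have iZm := Int_meas iZ.
have ip : Int P (fun w => Num.max (Y w) 0 * Z w).
  apply: Int_dom (Int_norm iYZ) _ => [|w].
    by apply: measurable_funM => //; exact: mwrt_meas.
  rewrite !normrM ler_wpM2r//.
  by have [Y0|Y0] := leP (Y w) 0; rewrite ?normr0.
have im : Int P (fun w => Num.max (- Y w) 0 * Z w).
  apply: Int_dom (Int_norm iYZ) _ => [|w].
    by apply: measurable_funM => //; exact: mwrt_meas.
  rewrite !normrM ler_wpM2r//.
  by have [Y0|Y0] := leP (- Y w) 0; rewrite ?normr0// normrN.
have -> : (fun w => Y w * Z w) =
    (fun w => Num.max (Y w) 0 * Z w - Num.max (- Y w) 0 * Z w).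
  apply/funext => w; rewrite -mulrBl; congr (_ * _).
  have [Y0|Y0] := leP (Y w) 0; have [Y1|Y1] := leP (- Y w) 0; lra.
by rewrite ExB// !pullout_ge0 ?subrr// => w; rewrite le_max lexx orbT.
Qed.

End Pullout.

(** Pairing D with its own sign, which is G-measurable, gives E |D| = 0. *)
Lemma mwrt_ae_eq0 D : measurable_wrt G D -> Int P D ->
  (forall A, G A -> (\int[P]_(w in A) (D w)%:E = 0)%E) ->
  {ae P, forall w, D w = 0}.
Proof.
move=> mD iD D0.
have mA : G (D @^-1` `[0, +oo[) by apply: mD; exact: measurable_itv.
(* the sign of D *)
pose Y (w : T) : R := 2 * \1_(D @^-1` `[0, +oo[) w - 1.
have YD w : Y w * D w = `|D w|.
  rewrite /Y indicE; have [D0'|D0'] := ger0P (D w).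
    by rewrite mem_set/= ?in_itv/= ?D0'//; lra.
  by rewrite memNset/= ?in_itv/= ?leNgt ?D0'//; lra.
have : Ex P (fun w => `|D w|) = 0.
  under eq_fun do rewrite -YD; apply: pullout => //.
    by apply: mwrtB; [apply: mwrtZ; exact: mwrt_indic|exact: mwrt_cst].
  by under eq_fun do rewrite YD; exact: Int_norm.
move=> /(Ex_eq0 (Int_norm iD) (fun w => normr_ge0 _)).
by apply: filterS => w /eqP; rewrite normr_eq0 => /eqP.
Qed.

End SubSigmaAlgebra.

(** * Square integrable martingales *)

Section SquareIntegrableMartingale.
Context {d : measure_display} {Omega : measurableType d} {R : realType}.
Variable P : probability Omega R.
Variable F : R -> set (set Omega).
Hypothesis Fsig : forall t, 0 <= t -> sigma_algebra setT (F t) /\ F t `<=` measurable.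
Hypothesis Fmon : forall s t, 0 <= s -> s <= t -> F s `<=` F t.
Implicit Types (X Y N : R -> Omega -> R) (s t : R).
Local Notation E := (Ex P).

(** The martingale property is stated on increments, the form from which
    orthogonality follows. *)
Definition sqmart X := [/\ adapted F X, forall t, 0 <= t -> L2 P (X t) &
  forall s t, 0 <= s -> s <= t -> forall A, F s A ->
    (\int[P]_(w in A) (X t w - X s w)%:E = 0)%E].

Lemma adaptedS Y s t : adapted F Y -> 0 <= s -> s <= t -> measurable_wrt (F t) (Y s).
Proof. by move=> aY s0 st B mB; apply: (Fmon s0 st); exact: aY. Qed.

Lemma mwrtS f s t : 0 <= s -> s <= t -> measurable_wrt (F s) f ->
  measurable_wrt (F t) (f : Omega -> R).
Proof. by move=> s0 st mf B mB; apply: (Fmon s0 st); exact: mf. Qed.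

Lemma Fmeas_fun f t : 0 <= t -> measurable_wrt (F t) f ->
  measurable_fun setT (f : Omega -> R).
Proof. by move=> t0; apply: mwrt_meas; exact: (Fsig t0).2. Qed.

Lemma martingale_sqmart X : martingale P F X -> square_integrable P X -> sqmart X.
Proof.
move=> [aX mX] sX; split => //.
  move=> t t0; have mXt := Fmeas_fun t0 (aX _ t0); split => //.
  apply: Int_ge0; [exact: measurable_funX|by move=> w; exact: sqr_ge0|].
  exact: sX.
move=> s t s0 st A FA; have t0 := le_trans s0 st.
have [_ iXs h] := mX s t s0 st; have [_ iXt _] := mX t t t0 (lexx _).
have mA : measurable A by apply: (Fsig s0).2.
rewrite integralB_EFin//; last 2 first.
- exact: integrableS iXt.
- exact: integrableS iXs.
rewrite h// subee//; apply: integrable_fin_num => //; exact: integrableS iXt.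
Qed.

Section Orth.
Variable X : R -> Omega -> R.
Hypothesis smX : sqmart X.

Lemma sqmart_L2 t : 0 <= t -> L2 P (X t).
Proof. by case: smX => _ h _; exact: h. Qed.

Lemma sqmart_L2B s t : 0 <= s -> 0 <= t -> L2 P (fun w => X t w - X s w).
Proof. by move=> s0 t0; apply: L2B; exact: sqmart_L2. Qed.

Lemma sqmart_orth s t (V : Omega -> R) : 0 <= s -> s <= t -> measurable_wrt (F s) V -> L2 P V ->
  E (fun w => V w * (X t w - X s w)) = 0.
Proof.
move=> s0 st mV L2V; have dX := sqmart_L2B s0 (le_trans s0 st).
apply: (pullout (Fsig s0).1 (Fsig s0).2 (L2_Int dX)) => //.
  by case: smX => _ _ h A FA; exact: h.
exact: L2M_Int.
Qed.

(** Successive increments are orthogonal, so their second moments add up. *)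
Lemma sqmart_pythagoras (u : nat -> R) n : 0 <= u 0%N ->
  {homo u : i j / (i <= j)%N >-> i <= j} ->
  \sum_(i < n) E (fun w => (X (u i.+1) w - X (u i) w) ^+ 2) =
  E (fun w => (X (u n) w - X (u 0%N) w) ^+ 2).
Proof.
move=> u0 um; have ui i : 0 <= u i by apply: le_trans u0 _; exact: um.
have S k w : \sum_(i < k) (X (u i.+1) w - X (u i) w) = X (u k) w - X (u 0%N) w.
  by rewrite -[RHS](telescope_sumr (fun i => X (u i) w))// big_mkord.
rewrite -(@pythagoras _ _ _ _ n (fun i w => X (u i.+1) w - X (u i) w)).
- by under eq_fun do rewrite S.
- by move=> i _; exact: sqmart_L2B.
- move=> i _; under eq_fun do rewrite S; apply: sqmart_orth => //.
  + exact: um.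
  + apply: mwrtB; [exact: (Fsig (ui _)).1| |].
      by case: smX => aX _ _; exact: aX.
    by apply: adaptedS (um _ _ (leq0n i)) => //; case: smX.
  + exact: sqmart_L2B.
Qed.

Lemma sqmart_incr_le s u t : 0 <= s -> s <= u -> u <= t ->
  E (fun w => (X t w - X u w) ^+ 2) <= E (fun w => (X t w - X s w) ^+ 2).
Proof.
move=> s0 su ut; pose v (i : nat) := if i is 0%N then s else if i is 1%N then u else t.
have vm : {homo v : i j / (i <= j)%N >-> i <= j}.
  by move=> [|[|i]] [|[|j]]//= _; rewrite ?lexx// (le_trans su).
rewrite -(@sqmart_pythagoras v 2)// !big_ord_recr big_ord0/= add0r.
by rewrite lerDr Ex_ge0// => w; exact: sqr_ge0.
Qed.
End Orth.

End SquareIntegrableMartingale.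

(** * The averaged martingale *)

Section AveragedMartingale.
Context {d : measure_display} {Omega : measurableType d} {R : realType}.
Variable P : probability Omega R.
Variable F : R -> set (set Omega).
Hypothesis Fsig : forall t, 0 <= t -> sigma_algebra setT (F t) /\ F t `<=` measurable.
Hypothesis Fmon : forall s t, 0 <= s -> s <= t -> F s `<=` F t.
Variables (X : R -> Omega -> R) (T : R).
Hypothesis smX : sqmart P F X.
Hypothesis cX : forall w, cadlag_path (X ^~ w).
Hypothesis T0 : 0 < T.
Local Notation E := (Ex P).
Local Notation g := (weight T).

Definition avg t w := avg_path (X ^~ w) T t.
Definition arem s t w := avg_rem (X ^~ w) T s t.

Let aX : adapted F X. Proof. by case: smX. Qed.

Lemma avgB s t w : 0 <= s -> s <= t ->
  avg t w - avg s w = g s * (X t w - X s w) - arem s t w.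
Proof. by move=> s0 st; exact: avg_incr. Qed.

Lemma arem0 s w : 0 <= s -> arem s s w = 0.
Proof.
by move=> s0; have := avgB w s0 (lexx s); rewrite !subrr mulr0 sub0r => /esym/eqP;
  rewrite oppr_eq0 => /eqP.
Qed.

(** The remainder is a limit of Riemann sums (t - s)/n sum_i (X_t - X_{p_i}).
    Cauchy-Schwarz bounds the square of such a sum by (t - s)^2 times the mean
    of the squares, each at most E (X_t - X_s)^2 in expectation, and Fatou
    passes to the limit. *)
Lemma arem_bound s t : 0 <= s -> s <= t ->
  [/\ measurable_wrt (F t) (arem s t), L2 P (arem s t) &
   E (fun w => arem s t w ^+ 2) <= (t - s) ^+ 2 * E (fun w => (X t w - X s w) ^+ 2)].
Proof.
move=> s0; rewrite le_eqVlt => /predU1P[<-|st].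
  have -> : arem s s = fun=> 0 by apply/funext => w; exact: arem0.
  split; [exact: (mwrt_cst (Fsig s0).1)|exact: L2_cst|].
  by rewrite expr0n Ex_cst mul0r mulr_ge0 ?sqr_ge0// Ex_ge0// => w; exact: sqr_ge0.
have t0 := le_trans s0 (ltW st).
pose p n i := grid s t n i.
have sp n i : s <= p n i by apply: grid_ge; exact: ltW.
have pt n i : (i <= n.+1)%N -> p n i <= t by apply: grid_leb; exact: ltW.
pose y n i w := if p n i < T then X t w - X (p n i) w else 0.
have yF n i : (i <= n.+1)%N -> measurable_wrt (F t) (y n i).
  move=> ni; rewrite /y; case: (p n i < T); last exact: (mwrt_cst (Fsig t0).1).
  apply: (mwrtB (Fsig t0).1); first exact: aX.
  by apply: adaptedS (pt _ _ ni) => //; exact: le_trans (sp _ _).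
have yL n i : L2 P (y n i).
  rewrite /y; case: (p n i < T); last exact: L2_cst.
  by apply: (sqmart_L2B smX) => //; exact: le_trans (sp _ _).
have yE n i : (i <= n.+1)%N ->
    E (fun w => y n i w ^+ 2) <= E (fun w => (X t w - X s w) ^+ 2).
  move=> ni; rewrite /y; case: (p n i < T); last first.
    by rewrite expr0n Ex_cst mul0r Ex_ge0// => w; exact: sqr_ge0.
  by apply: (sqmart_incr_le Fsig Fmon smX) => //; exact: pt.
pose r n w := (t - s) / n.+1%:R * \sum_(i < n.+1) y n i.+1 w.
have rcvg w : r n w @[n --> \oo] --> arem s t w by exact: (avg_rem_riemann (cX w)).
have rF n : measurable_wrt (F t) (r n).
  apply: (mwrtZ (Fsig t0).1); apply: (mwrt_sum (Fsig t0).1 (f := fun i => y n i.+1)).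
  by move=> i ni; exact: yF.
have rL n : L2 P (r n).
  by apply: L2Z; apply: (@L2_sum _ _ _ _ _ (fun i => y n i.+1)) => i _; exact: yL.
split; first exact: (mwrt_cvg (Fsig t0).1 rF rcvg).
all: have [] := @fatou_L2 _ _ _ P r (arem s t)
   ((t - s) ^+ 2 * E (fun w => (X t w - X s w) ^+ 2)) rL rcvg => //.
all: move=> e e0; exists 0%N => n _; apply: (@le_trans _ _ 
   ((t - s) ^+ 2 * E (fun w => (X t w - X s w) ^+ 2))); last by rewrite lerDl ltW.
all: set C := E (fun w => (X t w - X s w) ^+ 2).
all: apply: (@le_trans _ _ (E (fun w => ((t - s) / n.+1%:R) ^+ 2 * n.+1%:R *
   \sum_(i < n.+1) y n i.+1 w ^+ 2))).
all: try (apply: Ex_le; [exact: (rL n).2 | apply: IntZ; 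
   apply: (@Int_sum _ _ _ _ _ (fun i w => y n i.+1 w ^+ 2)) => i _; exact: (yL n i.+1).2
  | move=> w; rewrite /r exprMn -mulrA ler_wpM2l ?sqr_ge0//; 
    exact: (@sqr_sum_le _ n.+1 (fun i => y n i.+1 w)) ]).
all: rewrite ExZ; last by 
   apply: (@Int_sum _ _ _ _ _ (fun i w => y n i.+1 w ^+ 2)) => i _; exact: (yL n i.+1).2.
all: rewrite (@Ex_sum _ _ _ _ _ (fun i w => y n i.+1 w ^+ 2)) => [|i _]; last exact: (yL n i.+1).2.
all: apply: (@le_trans _ _ (((t - s) / n.+1%:R) ^+ 2 * n.+1%:R * \sum_(i < n.+1) C)).
all: try by apply: ler_wpM2l; [rewrite mulr_ge0 ?sqr_ge0|apply: ler_sum => i _; exact: yE].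
all: rewrite sumr_const card_ord -mulr_natl le_eqVlt; apply/orP; left; apply/eqP.
all: by field; rewrite addrC natr1 pnatr_eq0.
Qed.

Lemma avg0 w : avg 0 w = T * X 0 w.
Proof.
rewrite /avg /avg_path weightE ?subr0 ?ltW// set_itv1 Rintegral_set1.
by rewrite addr0.
Qed.

Lemma avgE t w : 0 <= t -> avg t w = T * X t w - arem 0 t w.
Proof.
move=> t0; have := avgB w (lexx 0) t0; rewrite weightE ?subr0 ?ltW// avg0; lra.
Qed.

Lemma avg_adapted : adapted F avg.
Proof.
move=> t t0; have -> : avg t = fun w => T * X t w - arem 0 t w.
  by apply/funext => w; exact: avgE.
apply: (mwrtB (Fsig t0).1); first by apply: (mwrtZ (Fsig t0).1); exact: aX.
by have [] := arem_bound (lexx 0) t0.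
Qed.

Lemma avg_L2 t : 0 <= t -> L2 P (avg t).
Proof.
move=> t0; have -> : avg t = fun w => T * X t w - arem 0 t w.
  by apply/funext => w; exact: avgE.
apply: L2B; first by apply: L2Z; exact: (sqmart_L2 smX).
by have [] := arem_bound (lexx 0) t0.
Qed.

(** Over n cells of [s, t] the terms weight * (increment of X) have mean zero
    on A, so only remainders are left.  Since |q| <= 1/a + a q^2, the sum of their
    means is at most n/a + a (t - s)^2 C / n^2, where C = E (X_t - X_s)^2.  With
    n = m^2 and a = m^3 this is (1 + (t - s)^2 C) / m. *)
Lemma avg_mart s t A : 0 <= s -> s <= t -> F s A ->
  E (fun w => \1_A w * (avg t w - avg s w)) = 0.
Proof.
move=> s0 st FA; have t0 := le_trans s0 st.
have mA : measurable A by exact: (Fsig s0).2.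
have mI : measurable_fun setT (\1_A : Omega -> R) by exact: measurable_indic.
set C := E (fun w => (X t w - X s w) ^+ 2).
have C0 : 0 <= C by apply: Ex_ge0 => w; exact: sqr_ge0.
suff h m : `|E (fun w => \1_A w * (avg t w - avg s w))| <=
    m.+1%:R^-1 * (1 + (t - s) ^+ 2 * C).
  apply/eqP; rewrite -normr_le0; apply/ler_addgt0Pr => e e0; rewrite add0r.
  have D0 : 0 < 1 + (t - s) ^+ 2 * C by rewrite ltr_pwDl// mulr_ge0// sqr_ge0.
  have [N /(_ _ (leqnn N)) hN] := @inv_small R (e / (1 + (t - s) ^+ 2 * C)) (divr_gt0 e0 D0).
  by apply: le_trans (h N) _; rewrite -ler_pdivlMr// ltW.
(* n.+1 = m.+1 ^ 2 cells *)
pose n := ((m.+1) ^ 2).-1; have nE : n.+1 = (m.+1 ^ 2)%N by rewrite prednK// expn_gt0.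
pose u i := grid s t n i.
have um : {homo u : i j / (i <= j)%N >-> i <= j} by apply: grid_le.
have su i : s <= u i by apply: grid_ge.
have u0 i : 0 <= u i by apply: le_trans (su i).
have uS i : u i <= u i.+1 by apply: um.
have rL i : L2 P (arem (u i) (u i.+1)) by have [] := arem_bound (u0 i) (uS i).
have irL i : L2 P (fun w => \1_A w * arem (u i) (u i.+1) w).
  by apply: (@L2bM _ _ _ _ 1) => // w; exact: ind_le1.
have tel w : \1_A w * (avg t w - avg s w) =
    \sum_(i < n.+1) (\1_A w * (avg (u i.+1) w - avg (u i) w)).
  rewrite -mulr_sumr; congr (_ * _).
  have := telescope_sumr (fun i => avg (u i) w) (leq0n n.+1).
  by rewrite big_mkord /u gridn grid0.
have dL i : L2 P (fun w => \1_A w * (avg (u i.+1) w - avg (u i) w)).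
  apply: (@L2bM _ _ _ _ 1) => //; first by move=> w; exact: ind_le1.
  by apply: L2B; exact: avg_L2.
under eq_fun do rewrite tel.
rewrite (@Ex_sum _ _ _ _ _ (fun i w => \1_A w * (avg (u i.+1) w - avg (u i) w))); last first.
  by move=> i _; exact: L2_Int.
have step i : E (fun w => \1_A w * (avg (u i.+1) w - avg (u i) w)) =
    - E (fun w => \1_A w * arem (u i) (u i.+1) w).
  under eq_fun do rewrite avgB// mulrBr mulrCA.
  have dX : L2 P (fun w => X (u i.+1) w - X (u i) w) by exact: (sqmart_L2B smX).
  have iX : L2 P (fun w => \1_A w * (X (u i.+1) w - X (u i) w)).
    by apply: (@L2bM _ _ _ _ 1) => // w; exact: ind_le1.
  rewrite ExB; [|by apply: L2_Int; exact: L2Z|exact: L2_Int].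
  rewrite ExZ; last exact: L2_Int.
  rewrite (sqmart_orth Fsig smX)// ?mulr0 ?sub0r//.
    by apply: (mwrt_indic (Fsig (u0 i)).1); exact: (Fmon s0 (su i)).
  have := @L2bM _ _ _ P 1 _ _ mI (@ind_le1 _ _ _ A) (L2_cst P 1).
  by under eq_fun do rewrite mulr1.
apply: le_trans (ler_norm_sum _ _ _) _.
pose M : R := m.+1%:R; have M0 : 0 < M by rewrite /M ltr0n.
have rem_le i : `|E (fun w => \1_A w * (avg (u i.+1) w - avg (u i) w))| <=
    M ^- 3 + M ^+ 3 * (((t - s) / n.+1%:R) ^+ 2 *
    E (fun w => (X (u i.+1) w - X (u i) w) ^+ 2)).
  rewrite step normrN; apply: le_trans (Ex_norm (L2_Int (irL i))) _.
  have [_ [_ ri] rle] := arem_bound (u0 i) (uS i).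
  rewrite /u gridS in rle.
  apply: le_trans (_ : M ^- 3 + M ^+ 3 * E (fun w => arem (u i) (u i.+1) w ^+ 2) <= _); last first.
    by rewrite lerD2l ler_wpM2l// exprn_ge0// ltW.
  rewrite -ExZ// -[leLHS]/(E _).
  have -> : M ^- 3 = E (fun=> M ^- 3) by rewrite Ex_cstP.
  rewrite -ExD; [|exact: Int_cst|exact: IntZ].
  apply: Ex_le; [exact/Int_norm/L2_Int|by apply: IntD; [exact: Int_cst|exact: IntZ]|].
  move=> w; rewrite normrM.
  set q := arem _ _ w.
  have h1 : `|\1_A w : R| * `|q| <= `|q|.
    by rewrite ler_piMl// ind_le1.
  apply: le_trans h1 _; rewrite -(real_normK (num_real q)).
  have a0 : 0 < M ^+ 3 by rewrite exprn_gt0.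
  set a := M ^+ 3 in a0 *; have := sqr_ge0 (a * `|q| - 1); have q0 := normr_ge0 q.
  have b0 : 0 < a^-1 by rewrite invr_gt0.
  have ab : a * a^-1 = 1 by rewrite divff ?gt_eqF.
  move=> hsq; have : 0 <= a^-1 * (a * `|q| - 1) ^+ 2 by rewrite mulr_ge0// ltW.
  have -> : a^-1 * (a * `|q| - 1) ^+ 2 = a * `|q| ^+ 2 - 2 * `|q| + a^-1.
    by field; rewrite gt_eqF.
  lra.
apply: (@le_trans _ _ (\sum_(i < n.+1) (M ^- 3 + M ^+ 3 * (((t - s) / n.+1%:R) ^+ 2 *
    E (fun w => (X (u i.+1) w - X (u i) w) ^+ 2))))).
  by apply: ler_sum => i _; exact: rem_le.
rewrite big_split/= sumr_const card_ord -!mulr_sumr.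
rewrite (sqmart_pythagoras Fsig Fmon smX)// /u gridn grid0 -/C nE.
rewrite -mulr_natl natrX -/M le_eqVlt; apply/orP; left; apply/eqP.
by field; rewrite gt_eqF.
Qed.

Lemma avg_sqmart : sqmart P F avg.
Proof.
split; [exact: avg_adapted|exact: avg_L2|move=> s t s0 st A FA].
have t0 := le_trans s0 st.
have mA : measurable A by exact: (Fsig s0).2.
have := congr1 (@EFin R) (avg_mart s0 st FA); rewrite Ex_EFin; last first.
  apply: L2_Int; apply: (@L2bM _ _ _ _ 1).
  - exact: measurable_indic.
  - by move=> w; exact: ind_le1.
  - by apply: L2B; exact: avg_L2.
move=> h; rewrite -[RHS]h integral_mkcond; apply: eq_integral => w _.
by rewrite patchE indicE; case: (w \in A); rewrite ?mul1r ?mul0r.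
Qed.

Variable M : R -> Omega -> R.
Hypothesis hM : forall t, 0 <= t ->
  is_cond_exp P (F t) (fun w => \int[lebesgue_measure]_(u in `[0, T]) X u w) (M t).

(** N_T is the integral of X over [0, T], so both N_t and M_t are versions of
    its conditional expectation given F_t; after T the process N is constant. *)
Lemma cond_exp_avg t : 0 <= t -> {ae P, forall w, M t w = avg t w}.
Proof.
move=> t0; have [mM iM hA] := hM t0.
have iN s : 0 <= s -> Int P (avg s) by move=> s0; exact/L2_Int/avg_L2.
have ZE : (fun w => \int[lebesgue_measure]_(u in `[0, T]) X u w) = avg T.
  by apply/funext => w; rewrite /avg (avg_final (cX w)).
have {}hA A : F t A -> (\int[P]_(w in A) (M t w)%:E = \int[P]_(w in A) (avg T w)%:E)%E.
  by rewrite -ZE; exact: hA.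
have : {ae P, forall w, M t w - avg t w = 0}.
  apply: (mwrt_ae_eq0 (Fsig t0).1 (Fsig t0).2).
  - apply: (mwrtB (Fsig t0).1) => //; exact: avg_adapted.
  - exact: IntB (iN _ t0).
  - move=> A FA; have mA := (Fsig t0).2 _ FA.
    rewrite integralB_EFin//; last 2 first.
    + exact: integrableS iM.
    + exact: integrableS (iN _ t0).
    rewrite hA//.
    have [tT|Tt] := leP t T; last first.
      have -> : avg t = avg T by apply/funext => w; rewrite /avg avg_stopped// ltW.
      rewrite subee//; apply: integrable_fin_num => //.
      by apply: integrableS (iN _ (ltW T0)).
    rewrite -integralB_EFin//; last 2 first.
    + by apply: integrableS (iN _ (ltW T0)).
    + by apply: integrableS (iN _ t0).
    by case: avg_sqmart => _ _ h; exact: h.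
by apply: filterS => w /eqP; rewrite subr_eq0 => /eqP.
Qed.

End AveragedMartingale.

(** * Stieltjes integrals of the squared weight *)

Section Stieltjes.
Context {R : realType}.
Implicit Types (Q : cumulative R R) (f : R -> R) (s t : R).
Local Notation ls := lebesgue_stieltjes_measure.

Lemma ls_itv Q s t : s <= t -> ls Q `]s, t] = (Q t - Q s)%:E.
Proof.
move=> st; rewrite /lebesgue_stieltjes_measure /measure_extension measurable_mu_extE/=.
  exact: wlength_itv_bnd.
exact: is_ocitv.
Qed.

Lemma ls_itv_fin Q s t : (ls Q `]s, t] < +oo)%E.
Proof.
have [st|ts] := leP s t; first by rewrite ls_itv// ltry.
by rewrite set_itv_ge ?measure0// bnd_simp -leNgt ltW.
Qed.

Lemma cumulative_le Q s t : s <= t -> Q s <= Q t.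
Proof. by move=> st; exact: cumulative_is_nondecreasing. Qed.

Lemma ls_integrable Q f s t K : measurable_fun setT f ->
  (forall r, s < r -> r <= t -> `|f r| <= K) ->
  (ls Q).-integrable `]s, t] (EFin \o f).
Proof.
move=> mf fK; apply: measurable_bounded_integrable => //.
- exact: ls_itv_fin.
- exact: measurable_funTS.
- exists K; split; first exact: num_real.
  move=> M KM r /=; rewrite in_itv/= => /andP[sr rt].
  by apply: le_trans (ltW KM); exact: fK.
Qed.

Lemma ls_cat Q f s r t : measurable_fun setT f ->
  (exists K, forall v, s < v -> v <= t -> `|f v| <= K) -> s <= r -> r <= t ->
  \int[ls Q]_(v in `]s, t]) f v =
  \int[ls Q]_(v in `]s, r]) f v + \int[ls Q]_(v in `]r, t]) f v.
Proof.
move=> mf [K fK] sr rt.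
have E : `]s, t]%classic = `]s, r] `|` `]r, t] :> set R.
  by rewrite -itv_bndbnd_setU// bnd_simp.
rewrite [in LHS]E Rintegral_setU//.
  by rewrite -E; exact: ls_integrable fK.
apply/disj_setPS => v [/=]; rewrite !in_itv/= => /andP[_ vr] /andP[].
by rewrite ltNge vr.
Qed.

(** A function within e of a constant c is integrated as c, up to e times the
    mass; with c = 0 this is the usual bound on an integral. *)
Lemma ls_cst_bound Q f c e s t : measurable_fun setT f -> s <= t -> 0 <= e ->
  (forall r, s < r -> r <= t -> `|f r - c| <= e) ->
  `|\int[ls Q]_(v in `]s, t]) f v - c * (Q t - Q s)| <= e * (Q t - Q s).
Proof.
move=> mf st e0 fe.
have fK r : s < r -> r <= t -> `|f r| <= e + `|c|.
  move=> sr rt; rewrite -[f r](subrK c); apply: le_trans (ler_normD _ _) _.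
  by rewrite lerD2r fe.
have cE k : \int[ls Q]_(v in `]s, t]) k = k * (Q t - Q s).
  by rewrite Rintegral_cst//; congr (_ * _); rewrite -[RHS]/(fine (Q t - Q s)%:E) -ls_itv.
have if1 := ls_integrable Q mf fK.
have ic k : (ls Q).-integrable `]s, t] (EFin \o cst k).
  by apply: (@ls_integrable _ _ _ _ `|k|).
rewrite -cE -RintegralB//; last exact: ic.
have ib : (ls Q).-integrable `]s, t] (EFin \o (fun v => f v - c)).
  have mfc : measurable_fun setT (fun v => f v - c).
    by apply: measurable_funB => //; exact: measurable_cst.
  exact: ls_integrable mfc fe.
apply: le_trans (le_normr_Rintegral _ ib) _ => //.
rewrite -cE; apply: le_Rintegral => //; [exact: integrable_norm|exact: ic|].
by move=> v /=; rewrite in_itv/= => /andP[sv vt]; exact: fe.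
Qed.

Lemma ls_riemann Q f (u c : nat -> R) n e : measurable_fun setT f ->
  (exists K, forall v, u 0%N < v -> v <= u n -> `|f v| <= K) ->
  {homo u : i j / (i <= j)%N >-> i <= j} -> 0 <= e ->
  (forall i r, (i < n)%N -> u i < r -> r <= u i.+1 -> `|f r - c i| <= e) ->
  `|\int[ls Q]_(v in `]u 0%N, u n]) f v - \sum_(i < n) c i * (Q (u i.+1) - Q (u i))|
    <= e * (Q (u n) - Q (u 0%N)).
Proof.
move=> mf + um e0; elim: n => [_ _|n IHn [K fK] fe].
  by rewrite big_ord0 set_itv_ge ?bnd_simp ?ltxx// Rintegral_set0 !subrr normr0 mulr0.
rewrite (@ls_cat _ _ _ (u n))//; [|by exists K|exact: um|exact: um].
rewrite big_ord_recr/= opprD addrACA.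
apply: le_trans (ler_normD _ _) _.
have -> : e * (Q (u n.+1) - Q (u 0%N)) =
  e * (Q (u n) - Q (u 0%N)) + e * (Q (u n.+1) - Q (u n)) by ring.
apply: lerD.
  apply: IHn => [|i r ni]; last by apply: fe; exact: ltnW.
  by exists K => v v0 vn; apply: fK => //; apply: le_trans vn _; exact: um.
by apply: ls_cst_bound => //; [exact: um|move=> r; exact: fe].
Qed.

Lemma weight_continuous (T : R) : continuous (weight T).
Proof.
move=> t; apply/cvgrPdist_lt => e e0; near=> s.
apply: le_lt_trans (weight_lip T t s) _; near: s.
by apply: cvgr_dist_lt => //; exact: cvg_id.
Unshelve. all: by end_near. Qed.

Lemma weight_meas (T : R) : measurable_fun setT (weight T).
Proof. by apply: continuous_measurable_fun; exact: weight_continuous. Qed.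

Section WeightedStieltjes.
Variable T : R.
Hypothesis T0 : 0 < T.
Local Notation g := (weight T).

(** The weight vanishes after T, hence this process is constant after T. *)
Definition wint Q t : R := \int[ls Q]_(s in `]0, t]) g s ^+ 2.

Lemma wsq_meas : measurable_fun setT (fun s => g s ^+ 2).
Proof. by apply: measurable_funX; exact: weight_meas. Qed.

Lemma wsq_bound s : 0 <= s -> `|g s ^+ 2| <= T ^+ 2.
Proof.
move=> s0; by rewrite ger0_norm ?sqr_ge0// lerXn2r ?nnegrE ?weight_ge0 ?weight_le// ltW.
Qed.

Lemma wsq_lip s t : 0 <= s -> 0 <= t -> `|g s ^+ 2 - g t ^+ 2| <= 2 * T * `|s - t|.
Proof.
move=> s0 t0; rewrite subr_sqr normrM mulrC ler_pM//; last exact: weight_lip.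
rewrite ger0_norm ?addr_ge0 ?weight_ge0//.
by have := @weight_le R T T0 s s0; have := @weight_le R T T0 t t0; lra.
Qed.

Lemma wint_nonpos Q t : t <= 0 -> wint Q t = 0.
Proof.
by move=> t0; rewrite /wint set_itv_ge ?Rintegral_set0// bnd_simp -leNgt.
Qed.

Lemma wintB Q s t : 0 <= s -> s <= t ->
  wint Q t - wint Q s = \int[ls Q]_(r in `]s, t]) g r ^+ 2.
Proof.
move=> s0 st; rewrite /wint (@ls_cat _ _ 0 s t)//; first by rewrite addrC addKr.
  exact: wsq_meas.
by exists (T ^+ 2) => v v0 _; apply: wsq_bound; exact: ltW.
Qed.

Lemma wint_incr Q s t : 0 <= s -> s <= t ->
  0 <= wint Q t - wint Q s <= T ^+ 2 * (Q t - Q s).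
Proof.
move=> s0 st; rewrite wintB//; apply/andP; split.
  by apply: Rintegral_ge0 => r _; exact: sqr_ge0.
have := @ls_cst_bound Q (fun r => g r ^+ 2) 0 (T ^+ 2) s t wsq_meas st (sqr_ge0 _).
rewrite mul0r subr0 => h; apply: le_trans (ler_norm _) (h _) => r sr rt.
by rewrite subr0 wsq_bound// (le_trans s0)// ltW.
Qed.

Lemma wint_nd Q : nondecreasing (wint Q).
Proof.
move=> s t st; have [s0|s0] := leP 0 s.
  by rewrite -subr_ge0; have /andP[] := wint_incr Q s0 st.
rewrite wint_nonpos ?(ltW s0)//.
by apply: Rintegral_ge0 => r _; exact: sqr_ge0.
Qed.

Lemma wint_rc Q : right_continuous (wint Q).
Proof.
move=> t; apply/right_cvgP => e e0; have [t0|t0] := leP 0 t; last first.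
  exists (- t); first by rewrite oppr_gt0.
  move=> s ts; rewrite subrr => s0.
  by rewrite -/(wint Q s) !wint_nonpos ?ltW// subrr normr0.
have TT : 0 < T ^+ 2 by rewrite exprn_gt0.
have [dl dl0 h] := (right_cvgP _ _ _).1 (cumulative_is_right_continuous Q t)
  (e / T ^+ 2) (divr_gt0 e0 TT).
exists dl => // s ts sd; have /andP[h1 h2] := wint_incr Q t0 (ltW ts).
rewrite ger0_norm//; apply: le_lt_trans h2 _.
rewrite mulrC -ltr_pdivlMr//; apply: le_lt_trans (ler_norm _) _; exact: h.
Qed.

(** Packaged as a cumulative function, so that it can be the path of a bracket. *)
Definition wint_cumulative Q : cumulative R R :=
  HB.pack (wint Q) (isCumulative.Build R _ R (wint Q) (wint_nd Q) (@wint_rc Q)).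

(** The grid points are stopped at t: for fixed n the sums depend on t only
    through values of Q at min p_i t, which is what makes the limit adapted, and
    predictable when Q is. *)
Lemma wint_riemann Q t : 0 <= t ->
  \sum_(i < n.+1) g (grid 0 T n i) ^+ 2 *
     (Q (Num.min (grid 0 T n i.+1) t) - Q (Num.min (grid 0 T n i) t))
  @[n --> \oo] --> wint Q t.
Proof.
move=> t0; apply/seq_cvgP => e e0.
(* the stopped grid ends at min T t, and the weight vanishes after T *)
set m := Num.min T t; have m0 : 0 <= m by rewrite le_min t0 ltW.
have D0 : 0 <= Q m - Q 0 by rewrite subr_ge0 cumulative_le.
have C0 : 0 < 2 * T * T * (Q m - Q 0) + 1.
  by rewrite ltr_wpDl// !mulr_ge0// ltW.
have [N hN] := inv_small (divr_gt0 e0 C0); exists N => n /hN {}hN.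
pose u i := Num.min (grid 0 T n i) t.
have um : {homo u : i j / (i <= j)%N >-> i <= j}.
  move=> i j ij; rewrite /u le_min !ge_min lexx orbT andbT.
  by rewrite grid_le// ltW.
have u0 : u 0%N = 0 by rewrite /u grid0 min_l.
have un : u n.+1 = m by rewrite /u gridn.
have mE : wint Q t = wint Q m.
  have := @wintB Q m t m0; rewrite ge_min lexx orbT => /(_ isT) h.
  apply/eqP; rewrite -subr_eq0 h (@eq_Rintegral _ _ _ _ _ (cst 0)) ?Rintegral_cst ?mul0r//.
  move=> r /set_mem; rewrite /= in_itv/= gt_min => /andP[+ rt].
  move=> /orP[/ltW Tr|tr]; first by rewrite weight0// expr0n.
  by have := lt_le_trans tr rt; rewrite ltxx.
have e'0 : 0 <= 2 * T * (T / n.+1%:R) by rewrite !mulr_ge0 ?divr_ge0 ?ltW.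
have := @ls_riemann Q (fun r => g r ^+ 2) u (fun i => g (grid 0 T n i) ^+ 2) n.+1
  (2 * T * (T / n.+1%:R)) wsq_meas _ um e'0 _.
rewrite u0 un mE distrC => h; apply: le_lt_trans (h _ _) _.
- by exists (T ^+ 2) => v v0 _; apply: wsq_bound; exact: ltW.
- move=> i r _ ir ri.
  have gi0 j : 0 <= grid 0 T n j by apply: grid_ge; exact: ltW.
  have uE : u i = grid 0 T n i.
    rewrite /u min_l// leNgt; apply/negP => ti.
    have := lt_le_trans ir ri; rewrite /u (min_r (ltW ti)) ltNge => /negP; apply.
    by rewrite ge_min lexx orbT.
  apply: le_trans (wsq_lip _ _) _ => //.
    by apply: le_trans (gi0 i) _; rewrite -uE ltW.
  rewrite ler_wpM2l ?mulr_ge0 ?(ltW T0)//.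
  rewrite ger0_norm; last by rewrite subr_ge0 -uE ltW.
  rewrite -[X in X / _](subr0 T) -(gridS 0 T n i) lerB//.
  by rewrite (le_trans ri)// /u ge_min lexx.
- rewrite -mulrA [X in X < _](_ : _ = n.+1%:R^-1 * (2 * T * T * (Q m - Q 0))); last by ring.
  apply: le_lt_trans (_ : n.+1%:R^-1 * (2 * T * T * (Q m - Q 0) + 1) < _).
    by rewrite ler_wpM2l// lerDl.
  by rewrite -ltr_pdivlMr.
Qed.

End WeightedStieltjes.
End Stieltjes.

(** * Compensators and the isometry on one time interval *)

Section Compensator.
Context {d : measure_display} {Omega : measurableType d} {R : realType}.
Variable P : probability Omega R.
Variable F : R -> set (set Omega).
Hypothesis Fsig : forall t, 0 <= t -> sigma_algebra setT (F t) /\ F t `<=` measurable.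
Variables N W : R -> Omega -> R.
Hypothesis smN : sqmart P F N.
Hypothesis aW : adapted F W.
Hypothesis iW : forall t, 0 <= t -> Int P (W t).
Local Notation E := (Ex P).
Hypothesis hW : forall s t B, 0 <= s -> s <= t -> F s B ->
  E (fun w => \1_B w * (N t w - N s w) ^+ 2) = E (fun w => \1_B w * (W t w - W s w)).

(** M_t^2 - M_s^2 = (M_t - M_s)^2 + 2 M_s (M_t - M_s), and the second term has
    mean zero on events of F_s. *)
Lemma compensated_martingale M : adapted F M ->
  (forall t, 0 <= t -> {ae P, forall w, M t w = N t w}) ->
  martingale P F (fun t w => M t w ^+ 2 - W t w).
Proof.
move=> aM MN; split=> [t t0|s t s0 st].
  have sg := (Fsig t0).1.
  by apply: (mwrtB sg); [apply: (mwrtX sg); exact: aM|exact: aW].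
have t0 := le_trans s0 st.
have iN u : 0 <= u -> Int P (fun w => N u w ^+ 2 - W u w).
  by move=> u0; apply: IntB; [exact: (sqmart_L2 smN u0).2|exact: iW].
have mW u : 0 <= u -> measurable_fun setT (fun w => M u w ^+ 2 - W u w).
  move=> u0; apply: (Fmeas_fun Fsig u0); have sg := (Fsig u0).1.
  by apply: (mwrtB sg); [apply: (mwrtX sg); exact: aM|exact: aW].
have aeW u B : 0 <= u -> measurable B ->
    (\int[P]_(w in B) (M u w ^+ 2 - W u w)%:E =
     \int[P]_(w in B) (N u w ^+ 2 - W u w)%:E)%E.
  move=> u0 mB; apply: ae_eq_integral => //.
  - by apply/measurable_EFinP; apply: measurable_funTS; exact: mW.
  - by apply/measurable_EFinP; apply: measurable_funTS; exact: Int_meas (iN u u0).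
  - by have := MN u u0; apply: filterS => w -> _.
split.
- have sg := (Fsig s0).1.
  by apply: (mwrtB sg); [apply: (mwrtX sg); exact: aM|exact: aW].
- apply: (Int_ae (mW s s0) (iN s s0)).
  by have := MN s s0; apply: filterS => w ->.
- move=> B FB; have mB := (Fsig s0).2 _ FB.
  rewrite (aeW s B s0 mB) (aeW t B t0 mB).
  apply: etrans (Ex_ind mB (iN s s0)) _; apply: etrans _ (esym (Ex_ind mB (iN t t0))).
  congr EFin.
  have mI : measurable_fun setT (\1_B : Omega -> R) by exact: measurable_indic.
  have hb := hW s0 st FB.
  have sg := (Fsig s0).1; have FI := mwrt_indic (R := R) sg FB.
  have L2s := sqmart_L2 smN s0; have L2t := sqmart_L2 smN t0.
  have L2d := sqmart_L2B smN s0 t0.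
  have L2Is : L2 P (fun w => \1_B w * N s w).
    by apply: (@L2bM _ _ _ _ 1) => // w; exact: ind_le1.
  have ho : E (fun w => (\1_B w * N s w) * (N t w - N s w)) = 0.
    apply: (sqmart_orth Fsig smN) => //; apply: (mwrtM sg) => //.
    by case: smN => aN _ _; exact: aN.
  have ibd h : Int P h -> Int P (fun w => \1_B w * h w).
    move=> ih; apply: (Int_dom _ (Int_norm ih)).
      by apply: measurable_funM => //; exact: Int_meas ih.
    by move=> w; rewrite normrM ler_piMl// ind_le1.
  have i1 := ibd _ L2d.2.
  have i2 := ibd _ (IntB (iW t0) (iW s0)).
  have i3 := L2M_Int L2Is L2d.
  have i4 := ibd _ (iN s s0).
  have -> : (fun w => \1_B w * (N t w ^+ 2 - W t w)) = (fun w =>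
    (\1_B w * (N s w ^+ 2 - W s w) +
    (\1_B w * (N t w - N s w) ^+ 2 -
     \1_B w * (W t w - W s w))) +
    2 * ((\1_B w * N s w) * (N t w - N s w))).
    by apply/funext => w; ring.
  rewrite ExD ?ExZ ?ho ?mulr0 ?addr0//; last 2 first.
  - by apply: IntD => //; exact: IntB.
  - exact: IntZ.
  by rewrite ExD// ?ExB// ?hb ?subrr ?addr0//; exact: IntB.
Qed.

End Compensator.

(** For a = p^2/m, b = m q^2, c = 2 p q and y = q^2, the first two hypotheses are
    the squares (p +- m q)^2 / m, and the conclusion bounds |(p + q)^2 - p^2|. *)
Lemma norm_cross_term_le (R : realType) (a b c y r1 r2 : R) : 0 <= a + b + c ->
  0 <= a + b - c -> a <= r1 -> y + b <= r2 -> 0 <= y -> `|c + y| <= r1 + r2.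
Proof. by move=> *; rewrite ler_norml; apply/andP; split; lra. Qed.

Lemma wint_adapted {d : measure_display} {Omega : measurableType d} {R : realType}
    (F : R -> set (set Omega)) (T : R) (A : Omega -> cumulative R R) :
  (forall t, 0 <= t -> sigma_algebra setT (F t) /\ F t `<=` measurable) ->
  (forall s t, 0 <= s -> s <= t -> F s `<=` F t) -> 0 < T ->
  adapted F (fun t w => A w t) -> adapted F (fun t w => wint T (A w) t).
Proof.
move=> Fsig Fmon T0 aA.
move=> t t0; have sg := (Fsig t t0).1.
apply: (@mwrt_cvg _ _ _ _ sg (fun n w => \sum_(i < n.+1) weight T (grid 0 T n i) ^+ 2 *
  (A w (Num.min (grid 0 T n i.+1) t) - A w (Num.min (grid 0 T n i) t)))); last first.
  by move=> w; exact: wint_riemann.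
move=> n.
apply: (mwrt_sum sg (f := fun i w => weight T (grid 0 T n i) ^+ 2 *
  (A w (Num.min (grid 0 T n i.+1) t) - A w (Num.min (grid 0 T n i) t)))) => i _.
have mA j : measurable_wrt (F t) (fun w => A w (Num.min (grid 0 T n j) t)).
  apply: (adaptedS Fmon aA).
    by rewrite le_min t0 grid_ge// ltW.
  by rewrite ge_min lexx orbT.
by apply: (mwrtZ sg); apply: (mwrtB sg).
Qed.

Section Isometry.
Context {d : measure_display} {Omega : measurableType d} {R : realType}.
Variable P : probability Omega R.
Variable F : R -> set (set Omega).
Hypothesis Fsig : forall t, 0 <= t -> sigma_algebra setT (F t) /\ F t `<=` measurable.
Hypothesis Fmon : forall s t, 0 <= s -> s <= t -> F s `<=` F t.
Variables (X : R -> Omega -> R) (T : R).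
Hypothesis smX : sqmart P F X.
Hypothesis cX : forall w, cadlag_path (X ^~ w).
Hypothesis T0 : 0 < T.
Variable A : Omega -> cumulative R R.
Hypothesis mK : martingale P F (fun t w => X t w ^+ 2 - A w t).
Local Notation E := (Ex P).
Local Notation g := (weight T).
Local Notation ls := lebesgue_stieltjes_measure.
Local Notation avg := (avg X T).
Local Notation rm := (arem X T).

Let smN : sqmart P F avg. Proof. exact: avg_sqmart. Qed.

Lemma bracket_adapted : adapted F (fun t w => A w t).
Proof.
move=> t t0; have -> : (fun w => A w t) =
    (fun w => X t w ^+ 2 - (X t w ^+ 2 - A w t)) by apply/funext => w; ring.
apply: (mwrtB (Fsig t0).1); last exact: mK.1.
by apply: (mwrtX (Fsig t0).1); case: smX => aX _ _; exact: aX.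
Qed.

Lemma bracket_Int t : 0 <= t -> Int P (fun w => A w t).
Proof.
move=> t0; have -> : (fun w => A w t) =
    (fun w => X t w ^+ 2 - (X t w ^+ 2 - A w t)) by apply/funext => w; ring.
apply: IntB; first exact: (sqmart_L2 smX t0).2.
by have [_ h _] := mK.2 t t t0 (lexx t).
Qed.

(** (X_t - X_s)^2 is the increment of X^2 minus 2 X_s (X_t - X_s), and this cross
    term has mean zero against F_s-measurable variables. *)
Lemma bracket_incr s t (f : Omega -> R) K : 0 <= s -> s <= t ->
  measurable_wrt (F s) f -> (forall w, `|f w| <= K) ->
  E (fun w => f w * (X t w - X s w) ^+ 2) = E (fun w => f w * (A w t - A w s)).
Proof.
move=> s0 st mf fK; have t0 := le_trans s0 st.
have mf' := Fmeas_fun Fsig s0 mf.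
have ibd h : Int P h -> Int P (fun w => f w * h w).
  move=> ih; apply: (Int_dom _ (IntZ K (Int_norm ih))).
    by apply: measurable_funM => //; exact: Int_meas ih.
  by move=> w; rewrite normrM ler_wpM2r.
have iK u : 0 <= u -> Int P (fun w => X u w ^+ 2 - A w u).
  by move=> u0; have [_ h _] := mK.2 u u u0 (lexx u).
have iD := IntB (iK _ t0) (iK _ s0).
have L2s := sqmart_L2 smX s0.
have L2d := sqmart_L2B smX s0 t0.
have L2f : L2 P (fun w => f w * X s w) by exact: L2bM fK L2s.
have h1 : E (fun w => f w * ((X t w ^+ 2 - A w t) - (X s w ^+ 2 - A w s))) = 0.
  apply: (pullout (Fsig s0).1 (Fsig s0).2 iD) => //; last exact: ibd.
  move=> B FB; have mB := (Fsig s0).2 _ FB.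
  have [_ _ /(_ B FB) h] := mK.2 s t s0 st.
  rewrite integralB_EFin//; last 2 first.
  - exact: integrableS (iK _ t0).
  - exact: integrableS (iK _ s0).
  rewrite -h subee//; apply: integrable_fin_num => //.
  exact: integrableS (iK _ s0).
have h2 : E (fun w => (f w * X s w) * (X t w - X s w)) = 0.
  apply: (sqmart_orth Fsig smX) => //; apply: (mwrtM (Fsig s0).1) => //.
  by case: smX => aX _ _; exact: aX.
have -> : (fun w => f w * (X t w - X s w) ^+ 2) = (fun w =>
    (f w * ((X t w ^+ 2 - A w t) - (X s w ^+ 2 - A w s)) + f w * (A w t - A w s))
    - 2 * ((f w * X s w) * (X t w - X s w))).
  by apply/funext => w; ring.
have iA : Int P (fun w => f w * (A w t - A w s)).
  by apply: ibd; apply: IntB; exact: bracket_Int.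
rewrite ExB ?ExD ?ExZ ?h1 ?h2 ?mulr0 ?subr0 ?add0r//.
- exact: L2M_Int.
- exact: ibd.
- by apply: IntD => //; exact: ibd.
- by apply: IntZ; exact: L2M_Int.
Qed.

Section Integrand.
Variables (s t : R) (c b : Omega -> R) (K : R).
Hypotheses (s0 : 0 <= s) (st : s <= t).
Hypotheses (mc : measurable_wrt (F s) c) (mb : measurable_wrt (F s) b).
Hypotheses (cK : forall w, `|c w| <= K) (bK : forall w, `|b w| <= K).

Let D w := c w * (X t w - X s w) - b w * (avg t w - avg s w).
Definition iso_integral w := \int[ls (A w)]_(r in `]s, t]) (c w - b w * g r) ^+ 2.
Local Notation J := iso_integral.

Let t0 : 0 <= t. Proof. exact: le_trans st. Qed.

Let phi_bound w r : 0 <= r -> `|c w - b w * g r| <= K * (1 + T).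
Proof.
move=> r0; apply: le_trans (ler_normB _ _) _; rewrite mulrDr mulr1 lerD// normrM.
by rewrite ler_pM// ger0_norm ?weight_ge0 ?weight_le.
Qed.

Let K0 (w : Omega) : 0 <= K. Proof. exact: le_trans (cK w). Qed.

Let phi2_lip w r v : 0 <= r -> 0 <= v ->
  `|(c w - b w * g r) ^+ 2 - (c w - b w * g v) ^+ 2| <= 2 * K ^+ 2 * (1 + T) * `|r - v|.
Proof.
move=> r0 v0; rewrite subr_sqr normrM.
have -> : c w - b w * g r - (c w - b w * g v) = b w * (g v - g r) by ring.
have h1 : `|b w * (g v - g r)| <= K * `|r - v|.
  by rewrite normrM ler_pM// distrC; exact: weight_lip.
have h2 : `|c w - b w * g r + (c w - b w * g v)| <= 2 * (K * (1 + T)).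
  apply: le_trans (ler_normD _ _) _.
  by have := phi_bound w r0; have := phi_bound w v0; lra.
apply: le_trans (ler_pM _ _ h1 h2) _ => //.
by rewrite le_eqVlt; apply/orP; left; apply/eqP; ring.
Qed.

Let phi2_meas w : measurable_fun setT (fun r => (c w - b w * g r) ^+ 2).
Proof.
apply: measurable_funX; apply: measurable_funB; first exact: measurable_cst.
by apply: measurable_funM; [exact: measurable_cst|exact: weight_meas].
Qed.

Local Notation u n := (grid s t n).
Let phi n i w := c w - b w * g (u n i).
Let S n w := \sum_(i < n.+1) phi n i w ^+ 2 * (A w (u n i.+1) - A w (u n i)).

Let su n i : s <= u n i. Proof. exact: grid_ge. Qed.
Let u0 n i : 0 <= u n i. Proof. exact: le_trans (su n i). Qed.
Let um n : {homo u n : i j / (i <= j)%N >-> i <= j}. Proof. exact: grid_le. Qed.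

Let S_cvg n w : `|J w - S n w| <=
  2 * K ^+ 2 * (1 + T) * (t - s) / n.+1%:R * (A w t - A w s).
Proof.
have e0 : 0 <= 2 * K ^+ 2 * (1 + T) * (t - s) / n.+1%:R.
  by rewrite !mulr_ge0 ?exprn_ge0 ?(K0 w) ?subr_ge0 ?addr_ge0// ltW.
have := @ls_riemann R (A w) (fun r => (c w - b w * g r) ^+ 2) (u n)
  (fun i => phi n i w ^+ 2) n.+1 _ (phi2_meas w) _ (@um n) e0.
rewrite grid0 gridn; apply.
  exists ((K * (1 + T)) ^+ 2) => v sv vt.
  rewrite normrX lerXn2r ?nnegrE ?mulr_ge0 ?(K0 w) ?addr_ge0 ?(ltW T0)//.
  by rewrite phi_bound// (le_trans s0)// ltW.
move=> i r ni ir ri; have r0 : 0 <= r by rewrite (le_trans (u0 n i))// ltW.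
apply: le_trans (phi2_lip w r0 (u0 n i)) _.
rewrite -(mulrA (2 * K ^+ 2 * (1 + T))) ler_wpM2l//.
  by rewrite !mulr_ge0 ?exprn_ge0 ?(K0 w) ?addr_ge0 ?(ltW T0).
by rewrite ger0_norm ?subr_ge0; [rewrite -(gridS s t n i) lerB|exact: ltW].
Qed.

Let phiF n i : measurable_wrt (F (u n i)) (phi n i).
Proof.
have sg := (Fsig (u0 n i)).1.
apply: (mwrtB sg); first by apply: (mwrtS Fmon s0 (su n i)).
apply: (mwrtM sg); last exact: (mwrt_cst sg).
by apply: (mwrtS Fmon s0 (su n i)).
Qed.

Let phiK n i w : `|phi n i w ^+ 2| <= (K * (1 + T)) ^+ 2.
Proof.
rewrite normrX lerXn2r ?nnegrE ?mulr_ge0 ?(K0 w) ?addr_ge0 ?(ltW T0)//.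
exact: phi_bound.
Qed.

Let S_int n : Int P (S n).
Proof.
apply: (@Int_sum _ _ _ _ _ (fun i w => phi n i w ^+ 2 * (A w (u n i.+1) - A w (u n i)))).
move=> i _; have iA : Int P (fun w => A w (u n i.+1) - A w (u n i)).
  by apply: IntB; exact: bracket_Int.
apply: (Int_dom _ (IntZ ((K * (1 + T)) ^+ 2) (Int_norm iA))).
  apply: measurable_funM; last exact: Int_meas iA.
  by apply: measurable_funX; exact: (Fmeas_fun Fsig (u0 n i)).
by move=> w; rewrite normrM ler_wpM2r.
Qed.

Let A_incr0 w : 0 <= A w t - A w s.
Proof. by rewrite subr_ge0 cumulative_le. Qed.

Let iAts : Int P (fun w => A w t - A w s).
Proof. by apply: IntB; exact: bracket_Int. Qed.

Let CK0 : 0 <= 2 * K ^+ 2 * (1 + T) * (t - s).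
Proof.
apply: mulr_ge0; last by rewrite subr_ge0.
apply: mulr_ge0; last by rewrite addr_ge0 ?ltW.
by apply: mulr_ge0 => //; exact: sqr_ge0.
Qed.

Lemma iso_integral_meas : measurable_fun setT J.
Proof.
apply: (@measurable_fun_cvg _ _ _ _ S) => [n|w _]; first exact: Int_meas (S_int n).
apply/seq_cvgP => e e0; set C := 2 * K ^+ 2 * (1 + T) * (t - s) * (A w t - A w s).
have C0 : 0 <= C.
  apply: mulr_ge0; last exact: A_incr0.
  exact: CK0.
have C1 : 0 < C + 1 by rewrite ltr_wpDl.
have [N hN] := inv_small (divr_gt0 e0 C1); exists N => n /hN {}hN.
rewrite distrC; apply: le_lt_trans (S_cvg n w) _.
rewrite -mulrA [X in _ * X]mulrC mulrA -/C.
apply: le_lt_trans (_ : (C + 1) * n.+1%:R^-1 < _); first by rewrite ler_wpM2r// lerDl.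
by rewrite mulrC -ltr_pdivlMr.
Qed.

Lemma iso_integral_Int : Int P J.
Proof.
apply: (Int_dom iso_integral_meas (IntD (Int_norm (S_int 0%N))
  (IntZ (2 * K ^+ 2 * (1 + T) * (t - s) / 1%:R) iAts))) => w.
rewrite -[J w](subrK (S 0%N w)) addrC; apply: le_trans (ler_normD _ _) _.
by rewrite lerD2l; exact: S_cvg.
Qed.

Lemma iso_L2 : L2 P D.
Proof.
apply: L2B; apply: (@L2bM _ _ _ _ K) => //; try exact: (Fmeas_fun Fsig s0).
  exact: (sqmart_L2B smX).
exact: (sqmart_L2B smN).
Qed.

Let dL n i : L2 P (fun w => c w * (X (u n i.+1) w - X (u n i) w) -
   b w * (avg (u n i.+1) w - avg (u n i) w)).
Proof.
apply: L2B; apply: (@L2bM _ _ _ _ K) => //; try exact: (Fmeas_fun Fsig s0).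
  exact: (sqmart_L2B smX).
exact: (sqmart_L2B smN).
Qed.

Let sumD n k w : \sum_(i < k) (c w * (X (u n i.+1) w - X (u n i) w) -
   b w * (avg (u n i.+1) w - avg (u n i) w)) =
   c w * (X (u n k) w - X s w) - b w * (avg (u n k) w - avg s w).
Proof.
rewrite sumrB -!mulr_sumr.
have h (f : nat -> R) : \sum_(i < k) (f i.+1 - f i) = f k - f 0%N.
  by rewrite -[RHS](telescope_sumr f (leq0n k)) big_mkord.
by rewrite (h (fun i => X (u n i) w)) (h (fun i => avg (u n i) w)) grid0.
Qed.

Let ED n : E (fun w => D w ^+ 2) = \sum_(i < n.+1)
  E (fun w => (c w * (X (u n i.+1) w - X (u n i) w) -
   b w * (avg (u n i.+1) w - avg (u n i) w)) ^+ 2).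
Proof.
rewrite -(@pythagoras _ _ _ P n.+1 (fun i w => c w * (X (u n i.+1) w - X (u n i) w) -
   b w * (avg (u n i.+1) w - avg (u n i) w))).
- by congr (Ex P _); apply/funext => w; rewrite sumD gridn.
- by move=> i _; exact: dL.
move=> i _; under eq_fun do rewrite sumD.
set V := fun w => c w * (X (u n i) w - X s w) - b w * (avg (u n i) w - avg s w).
have sg := (Fsig (u0 n i)).1.
have cF : measurable_wrt (F (u n i)) c by exact: (mwrtS Fmon s0 (su n i)).
have bF : measurable_wrt (F (u n i)) b by exact: (mwrtS Fmon s0 (su n i)).
have aF Y : adapted F Y -> measurable_wrt (F (u n i)) (fun w => Y (u n i) w - Y s w).
  by move=> aY; apply: (mwrtB sg); [exact: aY|exact: (adaptedS Fmon aY s0 (su n i))].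
have VF : measurable_wrt (F (u n i)) V.
  apply: (mwrtB sg); apply: (mwrtM sg) => //; apply: aF.
    by case: smX.
  by case: smN.
have VL : L2 P V.
  apply: L2B; apply: (@L2bM _ _ _ _ K) => //; try exact: (Fmeas_fun Fsig s0).
    exact: (sqmart_L2B smX).
  exact: (sqmart_L2B smN).
have ucL : L2 P (fun w => c w * V w).
  by apply: (@L2bM _ _ _ _ K) => //; exact: (Fmeas_fun Fsig s0).
have ubL : L2 P (fun w => b w * V w).
  by apply: (@L2bM _ _ _ _ K) => //; exact: (Fmeas_fun Fsig s0).
have -> : (fun w => V w * (c w * (X (u n i.+1) w - X (u n i) w) -
    b w * (avg (u n i.+1) w - avg (u n i) w))) =
  (fun w => (c w * V w) * (X (u n i.+1) w - X (u n i) w) -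
    (b w * V w) * (avg (u n i.+1) w - avg (u n i) w)).
  by apply/funext => w; ring.
rewrite ExB; last 2 first.
- by apply: L2M_Int => //; exact: (sqmart_L2B smX).
- by apply: L2M_Int => //; exact: (sqmart_L2B smN).
rewrite (sqmart_orth Fsig smX)//; [|exact: um|exact: (mwrtM sg)].
by rewrite (sqmart_orth Fsig smN)// ?subrr//; [exact: um|exact: (mwrtM sg)].
Qed.

Let C := E (fun w => (X t w - X s w) ^+ 2).

Let ES n : E (S n) = \sum_(i < n.+1) E (fun w => phi n i w ^+ 2 * (X (u n i.+1) w - X (u n i) w) ^+ 2).
Proof.
rewrite (@Ex_sum _ _ _ _ _ (fun i w => phi n i w ^+ 2 * (A w (u n i.+1) - A w (u n i)))).
  apply: eq_bigr => i _; rewrite (bracket_incr (u0 n i) (K := (K * (1 + T)) ^+ 2))//.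
  - exact: um.
  - by apply: (mwrtX (Fsig (u0 n i)).1); exact: phiF.
move=> i _; have iA : Int P (fun w => A w (u n i.+1) - A w (u n i)).
  by apply: IntB; exact: bracket_Int.
apply: (Int_dom _ (IntZ ((K * (1 + T)) ^+ 2) (Int_norm iA))).
  apply: measurable_funM; last exact: Int_meas iA.
  by apply: measurable_funX; exact: (Fmeas_fun Fsig (u0 n i)).
by move=> w; rewrite normrM ler_wpM2r.
Qed.

Let ES_le n : `|E (fun w => D w ^+ 2) - E (S n)| <=
  n.+1%:R^-1 * (K ^+ 2 * ((1 + T) ^+ 2 + 2 * (t - s) ^+ 2) * C).
Proof.
rewrite (ED n) ES -sumrB; apply: le_trans (ler_norm_sum _ _ _) _.
pose M : R := n.+1%:R; have M0 : 0 < M by rewrite /M ltr0n.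
have M1 : 1 <= M by rewrite /M ler1n.
have step i : `|E (fun w => (c w * (X (u n i.+1) w - X (u n i) w) -
   b w * (avg (u n i.+1) w - avg (u n i) w)) ^+ 2) -
   E (fun w => phi n i w ^+ 2 * (X (u n i.+1) w - X (u n i) w) ^+ 2)| <=
   M^-1 * (K ^+ 2 * ((1 + T) ^+ 2 + 2 * (t - s) ^+ 2)) *
     E (fun w => (X (u n i.+1) w - X (u n i) w) ^+ 2).
  have iX : Int P (fun w => (X (u n i.+1) w - X (u n i) w) ^+ 2).
    by have [] := sqmart_L2B smX (u0 n i) (u0 n i.+1).
  have [_ [mr ri] rle] := arem_bound Fsig Fmon T smX cX (u0 n i) (um n (leqnSn i)).
  have iphi : Int P (fun w => phi n i w ^+ 2 * (X (u n i.+1) w - X (u n i) w) ^+ 2).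
    apply: (Int_dom _ (IntZ ((K * (1 + T)) ^+ 2) iX)).
      apply: measurable_funM; last exact: Int_meas iX.
      by apply: measurable_funX; exact: (Fmeas_fun Fsig (u0 n i)).
    by move=> w; rewrite normrM (ger0_norm (sqr_ge0 (X _ _ - _))) ler_wpM2r ?sqr_ge0.
  rewrite -ExB//; last exact: (dL n i).2.
  apply: le_trans (Ex_norm _) _; first by apply: IntB => //; exact: (dL n i).2.
  apply: (@le_trans _ _ (E (fun w => M^-1 * (K * (1 + T)) ^+ 2 * (X (u n i.+1) w - X (u n i) w) ^+ 2
      + (1 + M) * K ^+ 2 * rm (u n i) (u n i.+1) w ^+ 2))).
    apply: Ex_le.
    - by apply: Int_norm; apply: IntB => //; exact: (dL n i).2.
    - by apply: IntD; exact: IntZ.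
    move=> w; rewrite avgB//; last exact: um.
    set x := X (u n i.+1) w - X (u n i) w; set q := rm _ _ w.
    have -> : c w * x - b w * (g (u n i) * x - q) = phi n i w * x + b w * q.
      by rewrite /phi; ring.
    have hphi : phi n i w ^+ 2 <= (K * (1 + T)) ^+ 2.
      by apply: le_trans (phiK n i w); exact: ler_norm.
    have hb : b w ^+ 2 <= K ^+ 2.
      by rewrite -(real_normK (num_real (b w))) lerXn2r ?nnegrE ?(K0 w).
    set p := phi n i w in hphi *; set y := b w * q.
    have hy : y ^+ 2 <= K ^+ 2 * q ^+ 2 by rewrite exprMn ler_wpM2r ?sqr_ge0.
    have hpx : (p * x) ^+ 2 <= (K * (1 + T)) ^+ 2 * x ^+ 2.
      by rewrite exprMn ler_wpM2r ?sqr_ge0.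
    rewrite -exprMn; set v := p * x in hpx *.
    have Mi : 0 < M^-1 by rewrite invr_gt0.
    have h1 : M^-1 * v ^+ 2 + M * y ^+ 2 + 2 * v * y = M^-1 * (v + M * y) ^+ 2.
      by field; rewrite gt_eqF.
    have h2 : M^-1 * v ^+ 2 + M * y ^+ 2 - 2 * v * y = M^-1 * (v - M * y) ^+ 2.
      by field; rewrite gt_eqF.
    have h3 : 0 <= M^-1 * (v + M * y) ^+ 2 by rewrite mulr_ge0 ?sqr_ge0 ?ltW.
    have h4 : 0 <= M^-1 * (v - M * y) ^+ 2 by rewrite mulr_ge0 ?sqr_ge0 ?ltW.
    have h5 : M^-1 * v ^+ 2 <= M^-1 * (K * (1 + T)) ^+ 2 * x ^+ 2.
      by rewrite -mulrA ler_wpM2l// ltW.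
    have h6 : (1 + M) * y ^+ 2 <= (1 + M) * K ^+ 2 * q ^+ 2.
      by rewrite -mulrA ler_wpM2l// addr_ge0// ltW.
    have h7 := sqr_ge0 y.
    have -> : (v + y) ^+ 2 - v ^+ 2 = 2 * v * y + y ^+ 2 by ring.
    rewrite -h1 in h3; rewrite -h2 in h4; rewrite mulrDl mul1r in h6.
    exact: (norm_cross_term_le h3 h4 h5 h6 h7).
  rewrite ExD ?ExZ//; try exact: IntZ.
  rewrite gridS -/M in rle.
  set Z := E (fun w => (X (u n i.+1) w - X (u n i) w) ^+ 2) in rle *.
  have Z0 : 0 <= Z by apply: Ex_ge0 => w; exact: sqr_ge0.
  apply: le_trans (lerD (lexx _) (ler_wpM2l _ rle)) _.
    by rewrite mulr_ge0 ?sqr_ge0// addr_ge0// ltW.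
  have -> : (1 + M) * K ^+ 2 * (((t - s) / M) ^+ 2 * Z) =
      ((1 + M) / M) * (M^-1 * K ^+ 2 * (t - s) ^+ 2 * Z).
    by field; rewrite gt_eqF.
  have hM : (1 + M) / M <= 2 by rewrite ler_pdivrMr//; lra.
  have W0 : 0 <= M^-1 * K ^+ 2 * (t - s) ^+ 2 * Z.
    apply: mulr_ge0 => //; apply: mulr_ge0; last exact: sqr_ge0.
    by apply: mulr_ge0; [rewrite invr_ge0 ltW|exact: sqr_ge0].
  apply: le_trans (lerD (lexx _) (ler_wpM2r W0 hM)) _.
  by rewrite le_eqVlt; apply/orP; left; apply/eqP; ring.
apply: le_trans (_ : \sum_(i < n.+1) M^-1 * (K ^+ 2 * ((1 + T) ^+ 2 + 2 * (t - s) ^+ 2)) *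
     E (fun w => (X (u n i.+1) w - X (u n i) w) ^+ 2) <= _).
  by apply: ler_sum => i _; exact: step.
rewrite -mulr_sumr (sqmart_pythagoras Fsig Fmon smX)//.
by rewrite grid0 gridn -/C -/M -mulrA.
Qed.

(** On each cell of a fine grid of [s, t],
      c dX - b dN = (c - b g(u_i)) dX + b r,
    where r has second order.  Dropping r changes the second moment by O(1/n) in
    total, [bracket_incr] turns dX^2 into dA, and the resulting sums are
    Stieltjes sums of [iso_integral].  Both errors vanish. *)
Lemma increment_isometry : E (fun w => D w ^+ 2) = E J.
Proof.
set C1 := K ^+ 2 * ((1 + T) ^+ 2 + 2 * (t - s) ^+ 2) * C.
set C2 := 2 * K ^+ 2 * (1 + T) * (t - s) * E (fun w => A w t - A w s).
have w0 : Omega := point.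
have C10 : 0 <= C1.
  apply: mulr_ge0; last by apply: Ex_ge0 => w; exact: sqr_ge0.
  apply: mulr_ge0; first exact: sqr_ge0.
  by apply: addr_ge0; [exact: sqr_ge0|apply: mulr_ge0 => //; exact: sqr_ge0].
have C20 : 0 <= C2.
  apply: mulr_ge0; last by apply: Ex_ge0 => w; exact: A_incr0.
  exact: CK0.
have h n : `|E (fun w => D w ^+ 2) - E J| <= n.+1%:R^-1 * (C1 + C2).
  rewrite -(subrKA (E (S n))); apply: le_trans (ler_normD _ _) _.
  rewrite mulrDr lerD//.
  rewrite -ExB//; last exact: iso_integral_Int.
  apply: le_trans (Ex_norm _) _; first by apply: IntB => //; exact: iso_integral_Int.
  have -> : n.+1%:R^-1 * C2 = E (fun w => 2 * K ^+ 2 * (1 + T) * (t - s) / n.+1%:R * (A w t - A w s)).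
    by rewrite ExZ// /C2; ring.
  apply: Ex_le.
  - by apply: Int_norm; apply: IntB => //; exact: iso_integral_Int.
  - exact: IntZ.
  - by move=> w; rewrite distrC; exact: S_cvg.
apply/eqP; rewrite -subr_eq0 -normr_le0; apply/ler_addgt0Pr => e e0; rewrite add0r.
have D0 : 0 < C1 + C2 + 1 by rewrite ltr_wpDl// addr_ge0.
have [N /(_ _ (leqnn N)) hN] := inv_small (divr_gt0 e0 D0).
apply: le_trans (h N) _.
apply: le_trans (_ : N.+1%:R^-1 * (C1 + C2 + 1) <= _); first by rewrite ler_wpM2l// lerDl.
by rewrite -ler_pdivlMr// ltW.
Qed.

End Integrand.

Lemma wint_Int t : 0 <= t -> Int P (fun w => wint T (A w) t).
Proof.
move=> t0; apply: (Int_dom _ (IntZ (T ^+ 2) (IntB (bracket_Int t0) (bracket_Int (lexx 0))))).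
  exact: (Fmeas_fun Fsig t0 (wint_adapted Fsig Fmon T0 bracket_adapted t0)).
move=> w; have /andP[] := wint_incr T0 (A w) (lexx 0) t0.
by rewrite (wint_nonpos _ _ (lexx 0)) subr0 => h0 h1; rewrite ger0_norm.
Qed.

Lemma wint_bracket s t B : 0 <= s -> s <= t -> F s B ->
  E (fun w => \1_B w * (avg t w - avg s w) ^+ 2) =
  E (fun w => \1_B w * (wint T (A w) t - wint T (A w) s)).
Proof.
move=> s0 st FB; have sg := (Fsig s0).1.
have mB := mwrt_indic (R := R) sg FB.
have := @increment_isometry s t (fun=> 0) (\1_B) 1 s0 st (mwrt_cst sg 0) mB _ (@ind_le1 _ _ _ B).
have indX (w : Omega) : (\1_B w : R) ^+ 2 = \1_B w.
  by rewrite indicE; case: (_ \in _); rewrite ?expr1n ?expr0n.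
have -> : iso_integral s t (fun=> 0) (\1_B) =
    fun w => \1_B w * (wint T (A w) t - wint T (A w) s).
  apply/funext => w; rewrite wintB// /iso_integral.
  rewrite -RintegralZl//; last first.
    apply: (@ls_integrable _ _ _ _ _ (T ^+ 2)); first exact: wsq_meas.
    by move=> r sr _; apply: wsq_bound => //; rewrite (le_trans s0)// ltW.
  by apply: eq_Rintegral => r _; rewrite sub0r sqrrN exprMn indX.
move=> <-; last by move=> w; rewrite normr0.
congr (Ex P _); apply/funext => w.
by rewrite mul0r sub0r sqrrN exprMn indX.
Qed.

(** The isometry with c = 0 and b the indicator of an event of F_s. *)
Lemma wint_martingale M : adapted F M ->
  (forall t, 0 <= t -> {ae P, forall w, M t w = avg t w}) ->
  martingale P F (fun t w => M t w ^+ 2 - wint T (A w) t).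
Proof.
by apply: (@compensated_martingale _ _ _ _ _ Fsig avg (fun t w => wint T (A w) t));
  [exact: smN|exact: (wint_adapted Fsig Fmon T0 bracket_adapted)|exact: wint_Int|exact: wint_bracket].
Qed.

End Isometry.

(** * Indistinguishable processes and predictability *)

Section RightContinuousVersions.
Context {d : measure_display} {Omega : measurableType d} {R : realType}.
Variable P : probability Omega R.

Lemma right_continuous_eq (f g : R -> R) :
  (forall t, 0 <= t -> f s @[s --> t^'+] --> f t) ->
  (forall t, 0 <= t -> g s @[s --> t^'+] --> g t) ->
  (forall q : rat, 0 <= ratr q :> R -> f (ratr q) = g (ratr q)) ->
  forall t, 0 <= t -> f t = g t.
Proof.
move=> fc gc fg t t0; apply/eqP; rewrite -subr_eq0 -normr_le0.
apply/ler_addgt0Pr => e e0; rewrite add0r.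
have e2 : 0 < e / 2 by rewrite divr_gt0.
have [d1 d10 h1] := (right_cvgP _ _ _).1 (fc t t0) _ e2.
have [d2 d20 h2] := (right_cvgP _ _ _).1 (gc t t0) _ e2.
have tm : t < t + Num.min d1 d2 by rewrite ltrDl lt_min d10.
have [q] := rat_in_itvoo tm; rewrite in_itv/= => /andP[tq].
rewrite -ltrBlDl lt_min !ltrBlDl => /andP[q1 q2].
have := h1 _ tq q1; have := h2 _ tq q2; rewrite fg ?(le_trans t0 (ltW tq))// => a b.
have -> : f t - g t = (g (ratr q) - g t) - (g (ratr q) - f t) by ring.
by apply: le_trans (ler_normB _ _) _; rewrite [leRHS](splitr e) lerD// ltW.
Qed.

(** Right-continuous processes are determined by their values at the countably
    many rational times. *)
Lemma indistinguishable (Y Z : R -> Omega -> R) :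
  (forall w t, 0 <= t -> Y s w @[s --> t^'+] --> Y t w) ->
  (forall w t, 0 <= t -> Z s w @[s --> t^'+] --> Z t w) ->
  (forall t, 0 <= t -> {ae P, forall w, Y t w = Z t w}) ->
  {ae P, forall w, forall t, 0 <= t -> Y t w = Z t w}.
Proof.
move=> Yc Zc YZ.
have : {ae P, forall w, forall n, if choice.unpickle n is Some q then
    0 <= ratr (q : rat) :> R -> Y (ratr q) w = Z (ratr q) w else True}.
  apply: ae_foralln => n; case: choice.unpickle => [q|]; last exact: nearW.
  have [q0|q0] := leP 0 (ratr q : R); last exact: nearW.
  by apply: filterS (YZ _ q0) => w.
apply: filterS => w h; apply: right_continuous_eq => [||q q0]; [exact: Yc|exact: Zc|].
by have := h (choice.pickle q); rewrite choice.pickleK; apply.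
Qed.

End RightContinuousVersions.

Section Predictable.
Context {d : measure_display} {Omega : measurableType d} {R : realType}.
Variable P : probability Omega R.
Variable F : R -> set (set Omega).
Hypothesis Fsig : forall t, 0 <= t -> sigma_algebra setT (F t) /\ F t `<=` measurable.
Hypothesis Fmon : forall s t, 0 <= s -> s <= t -> F s `<=` F t.

Local Notation Gr := (predictable_rectangles F).
Local Notation U := (g_sigma_algebraType Gr).
(** Predictable sets form a sigma-algebra on the half-line [0, +oo[ x Omega.  It
    is handled as the trace on this set of the sigma-algebra generated on
    R x Omega by the predictable rectangles, for which the theory of measurable
    functions is available. *)
Definition halfline : set U := [set tw : R * Omega | 0 <= tw.1].
Local Notation D := halfline.

Lemma FT t : 0 <= t -> F t setT.
Proof.
move=> t0; have [[h0 hC _] _] := Fsig t0; rewrite -(setD0 setT); exact: hC.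
Qed.

Lemma rect_oc s t B : 0 <= s -> s < t -> F s B -> measurable (`]s, t] `*` B : set U).
Proof. by move=> s0 st FB; apply: sub_sigma_algebra; right; exists s, t, B. Qed.

Lemma rect_0 B : F 0 B -> measurable ([set 0] `*` B : set U).
Proof. by move=> FB; apply: sub_sigma_algebra; left; exists B. Qed.

Lemma rect_oy s B : 0 <= s -> F s B -> measurable (`]s, +oo[ `*` B : set U).
Proof.
move=> s0 FB; rewrite (_ : _ `*` _ = \bigcup_n (`]s, s + n.+1%:R] `*` B)).
  by apply: bigcup_measurable => n _; apply: rect_oc => //; rewrite ltrDl.
apply/seteqP; split=> [[r w]/= [] |[r w] [n _] /= []].
  rewrite in_itv/= andbT => sr Bw; exists (Num.truncn (r - s)) => //=; split=> //.
  rewrite in_itv/= sr/= -lerBlDl.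
  have rs0 : 0 <= r - s by rewrite subr_ge0 ltW.
  by have /andP[_ /ltW] := truncn_itv rs0.
by rewrite !in_itv/= andbT => /andP[-> _].
Qed.

Lemma halfline_meas : measurable D.
Proof.
rewrite (_ : D = ([set 0] `*` setT) `|` (`]0, +oo[ `*` setT)).
  by apply: measurableU; [apply: rect_0|apply: rect_oy] => //; exact: FT.
apply/seteqP; split=> [[r w]|[r w]]; rewrite /halfline/= ?in_itv/=.
  by rewrite le_eqVlt => /predU1P[<-|r0]; [left|right]; rewrite ?r0.
by move=> [[-> _]//|[/andP[/ltW]]].
Qed.

Lemma predictable_setsP (S : set U) : S `<=` D -> predictable_sets F S <-> measurable S.
Proof.
move=> SD; split.
  pose C := [set S : set U | measurable S /\ S `<=` D].
  suff: predictable_sets F `<=` C by move=> h /h[].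
  apply: smallest_sub.
    split => [|A [mA AD]|A AC].
    - by split; [exact: measurable0|exact: sub0set].
    - by split; [apply: measurableD => //; exact: halfline_meas|exact: subDsetl].
    - split; first by apply: bigcup_measurable => k _; exact: (AC k).1.
      by apply: bigcup_sub => k _; exact: (AC k).2.
  move=> A GA; split; first exact: sub_sigma_algebra.
  case: GA => [[B FB ->]|[s [t [B [s0 st FB ->]]]]] [r w] /= []; rewrite /halfline/=.
    by move=> ->.
  by rewrite in_itv/= => /andP[sr _] _; rewrite (le_trans s0)// ltW.
have [p0 pC pU] : sigma_algebra D (predictable_sets F) by exact: smallest_sigma_algebra.
pose C := [set S : set U | predictable_sets F (S `&` D)].
have : <<s Gr >> `<=` C.
  apply: smallest_sub.
    split => [|A AC|A AC]; rewrite /C/=.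
    - by rewrite set0I.
    - rewrite (_ : _ `&` D = D `\` (A `&` D)); first exact: pC.
      by apply/seteqP; split=> x /=; tauto.
    - by rewrite setI_bigcupl; exact: pU.
  move=> A GA; rewrite /C/= setIidl; first exact: sub_sigma_algebra.
  case: GA => [[B FB ->]|[s [t [B [s0 st FB ->]]]]] [r w] /= []; rewrite /halfline/=.
    by move=> ->.
  by rewrite in_itv/= => /andP[sr _] _; rewrite (le_trans s0)// ltW.
by move=> h /h; rewrite /C/= setIidl.
Qed.

Lemma predictableP (H : R -> Omega -> R) :
  predictable F H <-> measurable_fun D (fun tw : U => H tw.1 tw.2).
Proof.
split=> [pH _ B mB|mH B mB].
  apply/predictable_setsP; first exact: subIsetl.
  exact: pH.
by apply/predictable_setsP; [by move=> x []|exact: (mH halfline_meas B mB)].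
Qed.

Lemma measurable_time : measurable_fun D (fst : U -> R).
Proof.
apply: (measurability _ (RGenOInfty.measurableE R)) => _ [_ [a ->] <-].
have [a0|a0] := leP 0 a.
  rewrite (_ : _ `&` _ = `]a, +oo[ `*` setT).
    by apply: rect_oy => //; exact: FT.
  apply/seteqP; split=> [[r w]/= []|[r w]/= []]; rewrite /halfline/= !in_itv/= !andbT.
    by move=> _ ->.
  by move=> ar _; split=> //; rewrite (le_trans a0)// ltW.
rewrite (_ : _ `&` _ = D); first exact: halfline_meas.
apply/seteqP; split=> [[r w]/= []//|[r w]/=]; rewrite /halfline/= in_itv/= andbT.
by move=> r0; split=> //; exact: lt_le_trans r0.
Qed.

Lemma predictable_det (f : R -> R) : measurable_fun setT f ->
  predictable F (fun t _ => f t).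
Proof.
by move=> mf; apply/predictableP; apply: (measurableT_comp mf); exact: measurable_time.
Qed.

(** The constant value Y is known at time s and used strictly after s. *)
Lemma predictable_after s (Y : Omega -> R) : 0 <= s -> measurable_wrt (F s) Y ->
  predictable F (fun t w => if s < t then Y w else 0).
Proof.
move=> s0 mY; apply/predictableP => _ B mB.
rewrite (_ : _ `&` _ = (`]s, +oo[ `*` (Y @^-1` B)) `|`
   (D `&` (fst : U -> R) @^-1` [set r | r <= s /\ B 0])).
  apply: measurableU; first by apply: rect_oy => //; exact: mY.
  apply: measurable_time; first exact: halfline_meas.
  have [B0|B0] := pselect (B 0).
    rewrite (_ : [set _ | _] = `]-oo, s]%classic) ?measurable_itv//.
    by apply/seteqP; split=> r /=; rewrite in_itv/=; [case|].
  by rewrite (_ : [set _ | _] = set0)// -subset0 => r [].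
apply/seteqP; split=> [[r w]/= []|[r w]/=]; rewrite /halfline/= ?in_itv/= ?andbT.
  by move=> r0; case: ltP => [sr|rs] BY; [left|right].
case=> [[sr BY]|[r0 [rs B0]]].
  by rewrite sr; split => //; rewrite (le_trans s0)// ltW.
by rewrite ltNge rs.
Qed.

(** Before u the stopped process is H itself, after u it is the F_u-measurable
    variable H_u. *)
Lemma predictable_stopped (H : R -> Omega -> R) u : 0 <= u -> predictable F H ->
  adapted F H -> predictable F (fun t w => H (Num.min u t) w).
Proof.
move=> u0 pH aH; apply/predictableP.
have mle : measurable_fun D (fun tw : U => if u < tw.1 then 0 else 1 : R).
  apply/(predictableP (fun t _ => if u < t then 0 else 1)); apply: predictable_det.
  apply: measurable_fun_ifT => //.
  by apply: measurable_fun_ltr => //; exact: measurable_cst.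
have mg := (predictableP _).1 (predictable_after u0 (aH u u0)).
have mH := (predictableP _).1 pH.
apply: (@eq_measurable_fun _ _ _ _ D (fun tw : U =>
   H tw.1 tw.2 * (if u < tw.1 then 0 else 1) + (if u < tw.1 then H u tw.2 else 0))).
  move=> [t w] _ /=; rewrite /Order.min.
  by case: ltP; rewrite ?mulr0 ?add0r ?mulr1 ?addr0.
by apply: measurable_funD => //; exact: measurable_funM.
Qed.

Lemma predictable_cvg (H_ : nat -> R -> Omega -> R) H :
  (forall n, predictable F (H_ n)) ->
  (forall t w, 0 <= t -> H_ n t w @[n --> \oo] --> H t w) -> predictable F H.
Proof.
move=> pH hc; apply/predictableP.
apply: (@measurable_fun_cvg _ U R D (fun n tw => H_ n tw.1 tw.2)).
  by move=> n; exact: (predictableP _).1.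
by move=> [t w] t0; exact: hc.
Qed.

(** Reading H at the earlier time c t keeps it predictable: the preimage of the
    rectangle ]s, t] x B is ]s/c, t/c] x B, and B is in F_{s/c} because
    s <= s/c. *)
Lemma predictable_scaled (H : R -> Omega -> R) c : 0 < c -> c <= 1 ->
  predictable F H -> predictable F (fun t w => H (c * t) w).
Proof.
move=> c0 c1 /predictableP mH; apply/predictableP.
pose phi (x : U) : U := (c * x.1, x.2).
have mphi : measurable_fun setT phi.
  apply: (@measurability _ _ U U setT phi Gr) => // _ [A GA <-]; rewrite setTI.
  case: GA => [[B FB ->]|[s [t [B [s0 st FB ->]]]]].
    rewrite (_ : _ @^-1` _ = [set 0] `*` B); first exact: rect_0.
    apply/seteqP; split=> [[r w]/= [/eqP + Bw]|[r w]/= [-> Bw]]; last by rewrite mulr0.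
    by rewrite mulf_eq0 gt_eqF//= => /eqP.
  rewrite (_ : _ @^-1` _ = `]s / c, t / c] `*` B).
    apply: rect_oc; [exact: divr_ge0 (ltW c0)|by rewrite ltr_pM2r ?invr_gt0|].
    by apply: (Fmon s0) FB; rewrite ler_pdivlMr// ler_piMr.
  apply/seteqP; split=> [[r w]/= []|[r w]/= []]; rewrite !in_itv/=.
    by rewrite ltr_pdivrMr// ler_pdivlMr// mulrC.
  by rewrite ltr_pdivrMr// ler_pdivlMr// mulrC.
apply: (@measurable_comp _ _ _ _ _ _ D (fun tw : U => H tw.1 tw.2) D phi) => //.
- exact: halfline_meas.
- by move=> _ [[r w] r0 <-]; rewrite /halfline/= mulr_ge0// ltW.
- exact: measurable_funTS.
Qed.

Section Disintegration.
Variable tau : R.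
Local Notation kernel := (Omega -> {measure set (measurableTypeR R) -> \bar R}).

(** The path measures are abstract kernels here, known only through the mass
    [dist_of] that they give to intervals ]s, t] with s >= 0. *)
Definition Lint (al : kernel) (H : R * Omega -> R) w : \bar R :=
  (\int[al w]_(s in `]0%R, tau]) (H (s, w))%:E)%E.

Definition dist_of (al : kernel) (A : Omega -> R -> R) :=
  forall w s t, 0 <= s -> s <= t -> al w (`]s, t]%classic : set R) = (A w t - A w s)%:E.

Variables al be : kernel.
Variables A B : Omega -> R -> R.
Hypothesis alA : dist_of al A.
Hypothesis beB : dist_of be B.
Hypothesis tau0 : 0 <= tau.
Hypothesis iA : forall t, 0 <= t -> Int P (fun w => A w t).
Hypothesis iB : forall t, 0 <= t -> Int P (fun w => B w t).
Hypothesis hAB : forall s t C, 0 <= s -> s <= t -> F s C ->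
  Ex P (fun w => \1_C w * (A w t - A w s)) = Ex P (fun w => \1_C w * (B w t - B w s)).

(** The nonnegative integrands H that the two random measures integrate to
    measurable variables with the same mean.  The class contains predictable
    rectangles by hypothesis and is closed under sums and increasing limits, so a
    Dynkin argument extends it to all predictable H >= 0. *)
Definition matched (H : R * Omega -> R) := [/\ forall x, 0 <= H x,
  forall w, measurable_fun setT (fun s => H (s, w)),
  measurable_fun setT (Lint al H), measurable_fun setT (Lint be H) &
  (\int[P]_w Lint al H w = \int[P]_w Lint be H w)%E].

Let Lint_ge0 (C : kernel) (H : R * Omega -> R) w : (forall x, 0 <= H x) -> (0 <= Lint C H w)%E.
Proof. by move=> H0; apply: integral_ge0 => s _; rewrite lee_fin. Qed.

Let mH (H : R * Omega -> R) w :
  measurable_fun setT (fun s => H (s, w)) ->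
  measurable_fun (`]0, tau]%classic : set R) (fun s => (H (s, w))%:E).
Proof. by move=> m; apply/measurable_EFinP; exact: measurable_funTS. Qed.

Lemma matched_add H1 H2 : matched H1 -> matched H2 -> matched (fun x => H1 x + H2 x).
Proof.
move=> [p1 s1 a1 b1 e1] [p2 s2 a2 b2 e2].
have LE (C : kernel) : Lint C (fun x => H1 x + H2 x) = (fun w => Lint C H1 w + Lint C H2 w)%E.
  apply/funext => w; rewrite /Lint -ge0_integralD//=.
  - by move=> s _; rewrite lee_fin.
  - exact: mH.
  - by move=> s _; rewrite lee_fin.
  - exact: mH.
split.
- by move=> x; exact: addr_ge0.
- by move=> w; exact: measurable_funD.
- by rewrite LE; exact: emeasurable_funD.
- by rewrite LE; exact: emeasurable_funD.
- have iE (C : kernel) : measurable_fun setT (Lint C H1) ->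
      measurable_fun setT (Lint C H2) -> (\int[P]_w Lint C (fun x => (H1 x + H2 x)%R) w =
      \int[P]_w Lint C H1 w + \int[P]_w Lint C H2 w)%E.
    move=> m1 m2; rewrite LE; apply: ge0_integralD => // w _; exact: Lint_ge0.
  by rewrite !iE// e1 e2.
Qed.

Lemma matched_scale k H : 0 <= k -> matched H -> matched (fun x => k * H x).
Proof.
move=> k0 [p1 s1 a1 b1 e1].
have LE (C : kernel) : Lint C (fun x => k * H x) = (fun w => k%:E * Lint C H w)%E.
  apply/funext => w; rewrite /Lint -ge0_integralZl//=.
  - exact: mH.
  - by move=> s _; rewrite lee_fin.
split.
- by move=> x; exact: mulr_ge0.
- by move=> w; apply: measurable_funM => //; exact: measurable_cst.
- by rewrite LE; exact: measurable_funeM.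
- by rewrite LE; exact: measurable_funeM.
- have iE (C : kernel) : measurable_fun setT (Lint C H) ->
      (\int[P]_w Lint C (fun x => (k * H x)%R) w = k%:E * \int[P]_w Lint C H w)%E.
    by move=> m1; rewrite LE; apply: ge0_integralZl => // w _; exact: Lint_ge0.
  by rewrite !iE// e1.
Qed.

Lemma matched_lim (H_ : nat -> R * Omega -> R) H : (forall n, matched (H_ n)) ->
  (forall x, {homo H_ ^~ x : n m / (n <= m)%N >-> n <= m}) ->
  (forall x, H_ n x @[n --> \oo] --> H x) -> matched H.
Proof.
move=> gH nd hc.
have p x : 0 <= H x.
  rewrite -(cvg_lim _ (hc x))//; apply: limr_ge; first by apply/cvg_ex; eexists; exact: hc.
  by apply: nearW => n; have [p _ _ _ _] := gH n; exact: p.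
have ms w : measurable_fun setT (fun s => H (s, w)).
  apply: (@measurable_fun_cvg _ _ R setT (fun n s => H_ n (s, w))) => [n|s _].
    by have [_ m _ _ _] := gH n; exact: m.
  exact: hc.
have LE (C : kernel) w : Lint C (H_ n) w @[n --> \oo] --> Lint C H w.
  have := @cvg_monotone_convergence _ _ _ (C w) `]0, tau]%classic
    (measurable_itv _) (fun n s => (H_ n (s, w))%:E).
  rewrite (_ : (\int[_]_(x in _) _)%E = Lint C H w); last first.
    apply: eq_integral => s _; apply/cvg_lim => //.
    by apply: cvg_toEFin; exact: hc.
  apply.
  - by move=> n; apply: mH => //; have [_ m _ _ _] := gH n; exact: m.
  - by move=> n s _; rewrite lee_fin; have [q _ _ _ _] := gH n; exact: q.
  - by move=> s _ n m nm; rewrite lee_fin; exact: nd.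
have Lnd (C : kernel) w : {homo (fun n => Lint C (H_ n) w) : n m / (n <= m)%N >-> (n <= m)%E}.
  move=> n m nm; apply: ge0_le_integral => //.
  - by move=> s _; rewrite lee_fin; have [q _ _ _ _] := gH n; exact: q.
  - by apply: mH => //; have [_ q _ _ _] := gH n; exact: q.
  - by apply: mH => //; have [_ q _ _ _] := gH m; exact: q.
  - by move=> s _; rewrite lee_fin; exact: nd.
have PE (C : kernel) : (forall n, measurable_fun setT (Lint C (H_ n))) ->
    (\int[P]_w Lint C (H_ n) w)%E @[n --> \oo] --> (\int[P]_w Lint C H w)%E.
  move=> mC; have := @cvg_monotone_convergence _ _ _ P setT measurableT
    (fun n => Lint C (H_ n)) mC.
  rewrite (_ : (\int[_]_(x in _) _)%E = (\int[P]_w Lint C H w)%E); last first.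
    by apply: eq_integral => w _; apply/cvg_lim => //; exact: LE.
  apply.
  - by move=> n w _; apply: Lint_ge0; have [q _ _ _ _] := gH n.
  - by move=> w _; exact: Lnd.
have mA n : measurable_fun setT (Lint al (H_ n)) by have [] := gH n.
have mB n : measurable_fun setT (Lint be (H_ n)) by have [] := gH n.
split => //.
- by apply: (emeasurable_fun_cvg (fun n => Lint al (H_ n))) => // w _; exact: LE.
- by apply: (emeasurable_fun_cvg (fun n => Lint be (H_ n))) => // w _; exact: LE.
- have h1 := PE al mA; have h2 := PE be mB.
  have hE : (fun n => \int[P]_w Lint al (H_ n) w)%E = (fun n => \int[P]_w Lint be (H_ n) w)%E.
    by apply/funext => n; have [] := gH n.
  by rewrite hE in h1; exact: cvg_unique h1 h2.
Qed.

Let indic_prod (C1 : set R) (C2 : set Omega) s w :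
  \1_(C1 `*` C2) (s, w) = \1_C1 s * \1_C2 w :> R.
Proof. by rewrite !indicE in_setX/=; case: (_ \in C1); case: (_ \in C2); rewrite ?mulr0 ?mulr1. Qed.

Let ls_itvI (C : kernel) Q w s t : dist_of C Q -> 0 <= s -> s <= t ->
  C w (`]s, t] `&` `]0, tau]) = (Q w (Num.min t tau) - Q w (Num.min s tau))%:E.
Proof.
move=> CQ s0 st; rewrite -CQ; last 2 first.
- by rewrite le_min s0.
- by rewrite le_min !ge_min st lexx orbT.
congr (C w _); apply/seteqP; split=> r /=; rewrite !in_itv/= gt_min le_min.
  by move=> [/andP[-> ->] /andP[_ ->]].
move=> /andP[/orP[sr|tr] /andP[rt rtau]].
  by rewrite sr rt rtau (le_lt_trans s0 sr).
by have := lt_le_trans tr rtau; rewrite ltxx.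
Qed.

Let Lint_rect (C : kernel) Q s t C2 w : dist_of C Q -> 0 <= s -> s <= t ->
  Lint C (\1_(`]s, t] `*` C2)) w =
  (\1_C2 w * (Q w (Num.min t tau) - Q w (Num.min s tau)))%:E.
Proof.
move=> CQ s0 st; rewrite /Lint; under eq_integral do rewrite indic_prod mulrC EFinM.
rewrite ge0_integralZl//=.
- by rewrite integral_indic// (ls_itvI _ CQ)// EFinM.
- by apply/measurable_EFinP; exact: measurable_indic.
Qed.

Lemma matched_rect S : Gr S -> matched \1_S.
Proof.
have i0 (S' : set (R * Omega)) x : 0 <= (\1_S' x : R) by rewrite indicE; case: (_ \in _).
case=> [[C FC ->]|[s [t [C [s0 st FC ->]]]]].
  have LE (Q : kernel) : Lint Q \1_([set 0] `*` C) = cst 0%E.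
    apply/funext => w; rewrite /Lint integral0_eq// => r /=.
    rewrite in_itv/= => /andP[r0 _]; rewrite indic_prod indicE memNset ?mul0r//=.
    by move=> rE; rewrite rE ltxx in r0.
  split=> //; rewrite ?LE//.
  move=> w; under eq_fun do rewrite indic_prod.
  by apply: measurable_funM; [exact: measurable_indic|exact: measurable_cst].
have mC : measurable C by exact: (Fsig s0).2.
have LE (K : kernel) Q : dist_of K Q -> Lint K \1_(`]s, t] `*` C) =
    fun w => (\1_C w * (Q w (Num.min t tau) - Q w (Num.min s tau)))%:E.
  by move=> KQ; apply/funext => w; apply: Lint_rect => //; exact: ltW.
have t0 : 0 <= t by rewrite (le_trans s0)// ltW.
have iI (Q : Omega -> R -> R) : (forall t, 0 <= t -> Int P (fun w => Q w t)) ->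
    Int P (fun w => \1_C w * (Q w (Num.min t tau) - Q w (Num.min s tau))).
  move=> iQ; have i1 := IntB (iQ (Num.min t tau) _) (iQ (Num.min s tau) _).
  apply: (Int_dom _ (Int_norm (i1 _ _))); rewrite ?le_min ?t0 ?s0 ?tau0//.
    apply: measurable_funM; first exact: measurable_indic.
    by apply: Int_meas; apply: i1; rewrite le_min ?t0 ?s0.
  by move=> w; rewrite normrM ler_piMl// ind_le1.
split=> //.
- move=> w; under eq_fun do rewrite indic_prod.
  by apply: measurable_funM; [exact: measurable_indic|exact: measurable_cst].
- by rewrite (LE _ _ alA); apply/measurable_EFinP; exact: Int_meas (iI _ iA).
- by rewrite (LE _ _ beB); apply/measurable_EFinP; exact: Int_meas (iI _ iB).
rewrite (LE _ _ alA) (LE _ _ beB) -Ex_EFin; last exact: iI.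
rewrite -Ex_EFin; last exact: iI.
congr EFin; have [stau|taus] := leP s tau.
  by apply: hAB => //; rewrite le_min (ltW st).
rewrite (min_r (ltW (lt_trans taus st))).
have z (Q : Omega -> R -> R) : Ex P (fun w => \1_C w * (Q w tau - Q w tau)) = 0.
  by under eq_fun do rewrite subrr mulr0; rewrite Ex_cst mul0r.
by rewrite !z.
Qed.

Let Lint_fin (C : kernel) Q (H : R * Omega -> R) w k : dist_of C Q ->
  (forall x, 0 <= H x) -> measurable_fun setT (fun s => H (s, w)) ->
  (forall x, H x <= k) -> (Lint C H w <= (k * (Q w tau - Q w 0))%:E)%E.
Proof.
move=> CQ H0 m Hk; apply: le_trans (_ : (\int[C w]_(s in `]0%R, tau]) k%:E <= _)%E).
  apply: ge0_le_integral => //.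
  - by move=> *; rewrite lee_fin.
  - exact: mH.
  - by move=> *; rewrite lee_fin.
by rewrite integral_cst// EFinM CQ.
Qed.

Let FI t C C' : 0 <= t -> F t C -> F t C' -> F t (C `&` C').
Proof.
move=> t0; rewrite -(sigma_algebra_id (Fsig t0).1).
exact: (@measurableI _ (g_sigma_algebraType (F t))).
Qed.

Let F0 t : 0 <= t -> F t set0.
Proof. by move=> t0; have [[]] := Fsig t0. Qed.

Let rectI : setI_closed Gr.
Proof.
have rect0 : Gr set0 by left; exists set0; [exact: F0|rewrite setX0].
move=> S S'; case=> [[C FC ->]|[s [t [C [s0 st FC ->]]]]];
  case=> [[C' FC' ->]|[s' [t' [C' [s0' st' FC' ->]]]]]; rewrite -setXI.
- by left; exists (C `&` C'); [exact: FI|rewrite setIid].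
- rewrite (_ : [set 0] `&` _ = set0) ?set0X//.
  rewrite -subset0 => r [/= ->]; rewrite in_itv/= => /andP[].
  by rewrite ltNge s0'.
- rewrite (_ : _ `&` [set 0] = set0) ?set0X//.
  rewrite -subset0 => r [/= + rE]; rewrite rE in_itv/= => /andP[].
  by rewrite ltNge s0.
have iE : `]s, t] `&` `]s', t'] = `]Num.max s s', Num.min t t']%classic :> set R.
  apply/seteqP; split=> r /=; rewrite !in_itv/= gt_max le_min.
    by move=> [/andP[-> ->] /andP[-> ->]].
  by move=> /andP[/andP[-> ->] /andP[-> ->]].
rewrite iE; have [h|h] := ltP (Num.max s s') (Num.min t t'); last first.
  by rewrite set_itv_ge ?set0X// bnd_simp -leNgt.
right; exists (Num.max s s'), (Num.min t t'), (C `&` C'); split => //.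
  by rewrite le_max s0.
have m0 : 0 <= Num.max s s' by rewrite le_max s0.
by apply: FI => //; [apply: (Fmon s0) FC|apply: (Fmon s0') FC']; rewrite le_max lexx ?orbT.
Qed.

Let matched_ext H H' : matched H -> H =1 H' -> matched H'.
Proof. by move=> gH /funext <-. Qed.

Let indic_ge0 (S : set (R * Omega)) x : 0 <= (\1_S x : R).
Proof. by rewrite indicE; case: (_ \in _). Qed.

Let indic_le1 (S : set (R * Omega)) x : (\1_S x : R) <= 1.
Proof. by rewrite indicE; case: (_ \in _). Qed.

Let matchedT : matched \1_(setT : set (R * Omega)).
Proof.
have LE (K : kernel) Q : dist_of K Q -> Lint K \1_setT = fun w => (Q w tau - Q w 0)%:E.
  move=> KQ; apply/funext => w; rewrite /Lint; under eq_integral do rewrite indicT.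
  by rewrite (integral_cst (K w) (measurable_itv _) 1) mul1e KQ.
split => //.
- by move=> w; under eq_fun do rewrite indicT; exact: measurable_cst.
- rewrite (LE _ _ alA); apply/measurable_EFinP; apply: Int_meas.
  by apply: IntB; exact: iA.
- rewrite (LE _ _ beB); apply/measurable_EFinP; apply: Int_meas.
  by apply: IntB; exact: iB.
rewrite (LE _ _ alA) (LE _ _ beB) -Ex_EFin; last by apply: IntB; exact: iA.
rewrite -Ex_EFin; last by apply: IntB; exact: iB.
congr EFin; have := hAB (lexx 0) tau0 (FT (lexx 0)).
have z (Q : Omega -> R -> R) : Ex P (fun w => \1_(setT : set Omega) w * (Q w tau - Q w 0)) =
    Ex P (fun w => Q w tau - Q w 0) by under eq_fun do rewrite indicT mul1r.
by rewrite !z.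
Qed.

Let Lint_lty (H : R * Omega -> R) k (C : kernel) Q w : dist_of C Q ->
  (forall x, 0 <= H x) -> measurable_fun setT (fun s => H (s, w)) ->
  (forall x, H x <= k) -> (Lint C H w \is a fin_num)%E.
Proof.
move=> CQ H0 m Hk; rewrite ge0_fin_numE; last exact: Lint_ge0.
by apply: le_lt_trans (Lint_fin CQ H0 m Hk) _; rewrite ltry.
Qed.

(** Finiteness is needed to subtract equal means in the Dynkin argument. *)
Lemma Eint_fin (H : R * Omega -> R) k (C : kernel) Q : dist_of C Q ->
  (forall t, 0 <= t -> Int P (fun w => Q w t)) ->
  (forall x, 0 <= H x) -> (forall w, measurable_fun setT (fun s => H (s, w))) ->
  measurable_fun setT (Lint C H) ->
  (forall x, H x <= k) -> ((\int[P]_w Lint C H w)%E \is a fin_num)%E.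
Proof.
move=> CQ iQ H0 m mL Hk; have iT := IntZ k (IntB (iQ _ tau0) (iQ _ (lexx 0))).
rewrite ge0_fin_numE; last by apply: integral_ge0 => w _; exact: Lint_ge0.
apply: le_lt_trans (_ : (\int[P]_w (k * (Q w tau - Q w 0))%:E < +oo)%E).
  apply: ge0_le_integral => //.
  - by move=> w _; exact: Lint_ge0.
  - by apply/measurable_EFinP; exact: Int_meas iT.
  - by move=> w _; exact: Lint_fin.
by rewrite -Ex_EFin// ltry.
Qed.

Lemma matched_measurable S : measurable (S : set U) -> matched \1_S.
Proof.
move: S; apply: (@lambda_system_subset _ Gr rectI setT [set S | matched \1_S]); [|exact: matched_rect|by []].
split; [by []|exact: matchedT| |].
- move=> S1 S2 S21 /= g1 g2.
  have iE x : (\1_S1 x : R) = \1_(S1 `\` S2) x + \1_S2 x.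
    rewrite !indicE in_setD; have [xS2|xS2] := boolP (x \in S2); last by rewrite andbT addr0.
    by rewrite andbF add0r mem_set//; apply: S21; exact: set_mem.
  have [_ s1 a1 b1 e1] := g1; have [_ s2 a2 b2 e2] := g2.
  have s3 w : measurable_fun setT (fun s => \1_(S1 `\` S2) (s, w) : R).
    apply: (@eq_measurable_fun _ _ _ _ _ (fun s : R => \1_S1 (s, w) - \1_S2 (s, w) : R)).
      by move=> s _; rewrite iE addrK.
    exact: measurable_funB.
  have LD (C : kernel) w : (Lint C \1_S1 w = Lint C \1_(S1 `\` S2) w + Lint C \1_S2 w)%E.
    rewrite /Lint -ge0_integralD//=.
    - by apply: eq_integral => s _; rewrite iE.
    - exact: mH.
    - exact: mH.
  have LB (C : kernel) Q w : dist_of C Q ->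
      (Lint C \1_(S1 `\` S2) w = Lint C \1_S1 w - Lint C \1_S2 w)%E.
    by move=> CQ; rewrite LD addeK//; exact: (@Lint_lty _ 1 _ Q).
  have a3 : measurable_fun setT (Lint al \1_(S1 `\` S2)).
    apply: (@eq_measurable_fun _ _ _ _ _ (Lint al \1_S1 \- Lint al \1_S2)%E).
      by move=> w _; rewrite (LB _ A).
    exact: emeasurable_funB.
  have b3 : measurable_fun setT (Lint be \1_(S1 `\` S2)).
    apply: (@eq_measurable_fun _ _ _ _ _ (Lint be \1_S1 \- Lint be \1_S2)%E).
      by move=> w _; rewrite (LB _ B).
    exact: emeasurable_funB.
  split; [exact: indic_ge0|exact: s3|exact: a3|exact: b3|].
  have iD (C : kernel) : measurable_fun setT (Lint C \1_(S1 `\` S2)) ->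
      measurable_fun setT (Lint C \1_S2) -> (\int[P]_w Lint C \1_S1 w =
      \int[P]_w Lint C \1_(S1 `\` S2) w + \int[P]_w Lint C \1_S2 w)%E.
    move=> m1 m2; under eq_integral do rewrite LD.
    by apply: ge0_integralD => // w _; exact: Lint_ge0.
  have fy : (\int[P]_w Lint be \1_S2 w)%E \is a fin_num.
    exact: (@Eint_fin _ 1 _ B beB iB (indic_ge0 S2) s2 b2 (indic_le1 S2)).
  move: e1; rewrite (iD al a3 a2) (iD be b3 b2) e2.
  by move=> /(congr1 (fun z => z - \int[P]_w Lint be \1_S2 w)%E); rewrite !addeK.
- move=> S_ nd gS /=.
  apply: (matched_lim gS) => [x n m nm|x].
    rewrite !indicE; have [xS|xS] := boolP (x \in S_ n); last by case: (_ \in _).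
    rewrite mem_set//; move/set_mem: xS; have := nd _ _ nm => /subsetPset; exact.
  have [xS|xS] := pselect ((\bigcup_n S_ n) x); last first.
    rewrite indicE memNset//; apply: cvg_near_cst; apply: nearW => n.
    by rewrite indicE memNset// => xSn; apply: xS; exists n.
  rewrite indicE mem_set//; case: xS => n _ xSn; apply: cvg_near_cst.
  exists n => // m /= nm; rewrite indicE mem_set//.
  by have := nd _ _ nm => /subsetPset; exact.
Qed.

Lemma matched_predictable H : measurable_fun setT (H : U -> R) -> (forall x, 0 <= H x) -> matched H.
Proof.
move=> mHU H0.
have mHe : measurable_fun setT (EFin \o H : U -> \bar R) by exact/measurable_EFinP.
pose h n := nnsfun_approx (@measurableT _ U) mHe n.
have hc x : h n x @[n --> \oo] --> H x.
  have := @cvg_nnsfun_approx _ U R setT measurableT _ mHe (fun x _ => H0 x) x I.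
  by move=> /fine_cvg; apply.
apply: (matched_lim (H_ := fun n => h n)) => [n|x n m nm|x]; last exact: hc.
- have hE : h n =1 (fun x => \sum_(y <- fset_set (range (h n))) `|y| * \1_(h n @^-1` [set y]) x).
    move=> x; rewrite {1}fimfunE fsbig_finite//=; apply: eq_bigr => y _.
    have [y0|y0] := leP 0 y; first by rewrite ger0_norm.
    rewrite indicE memNset ?mulr0//= => xy.
    by move: y0; rewrite -xy ltNge fun_ge0.
  apply: (matched_ext _ (fsym hE)); elim: (fset_set _ : seq R) => [|y l IHl].
    apply: (@matched_ext (fun x => 0 * \1_setT x)); last by move=> x; rewrite big_nil mul0r.
    by apply: matched_scale => //; exact: matchedT.
  apply: (@matched_ext (fun x => `|y| * \1_(h n @^-1` [set y]) x +
    \sum_(y <- l) `|y| * \1_(h n @^-1` [set y]) x)); last by move=> x; rewrite big_cons.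
  apply: matched_add; last exact: IHl.
  apply: matched_scale; first exact: normr_ge0.
  apply: matched_measurable.
  exact: measurable_sfunP.
- by have /lefP := nd_nnsfun_approx measurableT mHe nm; exact.
Qed.

End Disintegration.

End Predictable.

(** * Uniqueness of the compensator *)

Section TriangleSplit.
Context {R : realType}.
Variables a b : {sigma_finite_measure set (measurableTypeR R) -> \bar R}.

(** Fubini on the square J x J, cut along its diagonal; the diagonal itself goes
    with the first triangle. *)
Lemma triangle_split (J : set R) : measurable J ->
  (\int[b]_(s in J) a (J `&` [set r : R | (r <= s :> R)%R]) +
   \int[a]_(r in J) b (J `&` [set s : R | (s < r :> R)%R]) = a J * b J)%E.
Proof.
move=> mJ.
pose A1 : set (measurableTypeR R * measurableTypeR R) := [set p | J p.1 /\ p.1 <= p.2].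
pose A2 : set (measurableTypeR R * measurableTypeR R) := [set p | [/\ J p.1, J p.2 & p.2 < p.1]].
have mfst : measurable_fun setT (fst : measurableTypeR R * measurableTypeR R -> R).
  exact: measurable_fst.
have msnd : measurable_fun setT (snd : measurableTypeR R * measurableTypeR R -> R).
  exact: measurable_snd.
have mt : measurable [set true] by [].
have mA1 : measurable A1.
  rewrite (_ : A1 = (fst @^-1` J) `&` [set p | p.1 <= p.2]) //.
  apply: measurableI; first by rewrite -[X in measurable X]setTI; exact: mfst.
  have := measurable_fun_ler mfst msnd measurableT mt.
  by rewrite setTI.
have mA2 : measurable A2.
  rewrite (_ : A2 = (fst @^-1` J) `&` (snd @^-1` J) `&` [set p | p.2 < p.1]); last first.
    by apply/seteqP; split=> p /=; [case|case=> -[]].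
  apply: measurableI.
    apply: measurableI; first by rewrite -[X in measurable X]setTI; exact: mfst.
    by rewrite -[X in measurable X]setTI; exact: msnd.
  have := measurable_fun_ltr msnd mfst measurableT mt.
  by rewrite setTI.
have E2 : (\int[a]_(r in J) b (J `&` [set s : R | (s < r :> R)%R]) = \int[a]_r b (xsection A2 r))%E.
  rewrite integral_mkcond; apply: eq_integral => r _; rewrite patchE.
  case: ifPn => rJ; [congr (b _)|rewrite (_ : xsection _ _ = set0) ?measure0//].
    apply/seteqP; split=> s; rewrite /xsection/=.
      by move=> [Js sr]; apply/mem_set; split => //; exact: set_mem.
    by move=> /set_mem[].
  rewrite -subset0 => s; rewrite /xsection/= => /set_mem[/= Jr _ _].
  by move/negP: rJ; apply; exact: mem_set.
have F2 : (\int[a]_r b (xsection A2 r) = \int[b]_s a (ysection A2 s))%E.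
  have := @indic_fubini_tonelli _ _ _ _ R a b A2 mA2.
  by rewrite indic_fubini_tonelli_FE// indic_fubini_tonelli_GE.
have E3 : (\int[b]_s a (ysection A2 s) = \int[b]_(s in J) a (ysection A2 s))%E.
  rewrite [RHS]integral_mkcond; apply: eq_integral => s _; rewrite patchE.
  case: ifPn => // sJ; rewrite (_ : ysection _ _ = set0) ?measure0//.
  rewrite -subset0 => r; rewrite /ysection/= => /set_mem[/= _ Js _].
  by move/negP: sJ; apply; exact: mem_set.
have E1 s : ysection A1 s = J `&` [set r : R | (r <= s)%R].
  apply/seteqP; split=> r; rewrite /ysection/=; first by move=> /set_mem[].
  by move=> [Jr rs]; apply/mem_set.
rewrite E2 F2 E3 -ge0_integralD//.
- rewrite (@eq_integral _ _ _ _ _ (cst (a J))) ?integral_cst//.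
  move=> s /set_mem Js; rewrite -E1 -measureU//=.
  - congr (a _); apply/seteqP; split=> r; rewrite /ysection/=.
      by case=> /set_mem[].
    move=> Jr; have [rs|sr] := leP (r : R) s; [left|right]; apply/mem_set; split => //.
  - exact: measurable_ysection.
  - exact: measurable_ysection.
  - rewrite -subset0 => r []; rewrite /ysection/= => /set_mem[/= _ rs] /set_mem[/= _ _].
    by rewrite ltNge rs.
- apply: (@eq_measurable_fun _ _ _ _ J (a \o ysection A1)) => [s _|].
    by rewrite /= E1.
  by apply: measurable_funTS; exact: measurable_fun_ysection.
- by apply: measurable_funTS; exact: measurable_fun_ysection.
Qed.

End TriangleSplit.

Section DoobMeyer.
Context {d : measure_display} {Omega : measurableType d} {R : realType}.
Variable P : probability Omega R.
Variable F : R -> set (set Omega).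
Hypothesis Fsig : forall t, 0 <= t -> sigma_algebra setT (F t) /\ F t `<=` measurable.
Hypothesis Fmon : forall s t, 0 <= s -> s <= t -> F s `<=` F t.
Local Notation ls := lebesgue_stieltjes_measure.
Local Notation U := (g_sigma_algebraType (predictable_rectangles F)).
Local Notation D := ([set tw : R * Omega | 0 <= tw.1] : set U).

(** The left limit A_{t-}, as the mass of the open interval ]0, t[; it is the
    limit of A at the earlier times c_n t with c_n increasing to 1, hence
    predictable. *)
Definition left_value (A : Omega -> cumulative R R) t w : R :=
  fine (ls (A w) (`]0, t[%classic : set R)).

Section LeftValue.
Variable A : Omega -> cumulative R R.
Hypothesis A0 : forall w, A w 0 = 0.

Lemma cumulative_ge0 t w : 0 <= t -> 0 <= A w t.
Proof. by move=> t0; rewrite -(A0 w) cumulative_le. Qed.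

Lemma ls_open_le t w : 0 <= t -> (ls (A w) (`]0%R, t[%classic : set R) <= (A w t)%:E)%E.
Proof.
move=> t0; have -> : (A w t)%:E = ls (A w) (`]0, t]%classic : set R).
  by rewrite ls_itv// A0 subr0.
apply: le_measure.
- by apply/mem_set; exact: (@measurable_itv R _).
- by apply/mem_set; exact: (@measurable_itv R _).
- by apply: subset_itvl; rewrite bnd_simp.
Qed.

Lemma left_valueE t w : 0 <= t ->
  (left_value A t w)%:E = ls (A w) (`]0%R, t[%classic : set R).
Proof.
move=> t0; rewrite fineK// ge0_fin_numE//.
by apply: le_lt_trans (ls_open_le w t0) _; rewrite ltry.
Qed.

Lemma left_value_bound t w : 0 <= t -> 0 <= left_value A t w <= A w t.
Proof.
by move=> t0; rewrite -!lee_fin left_valueE// ls_open_le// measure_ge0.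
Qed.

Let c n : R := 1 - n.+2%:R^-1.
Let c0 n : 0 < c n. Proof. by rewrite subr_gt0 invf_lt1// ltr1n. Qed.
Let c1 n : c n <= 1. Proof. by rewrite gerBl. Qed.

Lemma left_value_cvg t w : 0 <= t -> A w (c n * t) @[n --> \oo] --> left_value A t w.
Proof.
move=> t0; have hE n : (A w (c n * t))%:E = ls (A w) (`]0%R, (c n * t)]%classic : set R).
  by rewrite ls_itv ?A0 ?subr0// mulr_ge0// ltW.
have nd : {homo (fun n => `]0, (c n * t)]%classic : set R) : n m / (n <= m)%N >-> (n <= m)%O}.
  move=> n m nm; apply/subsetPset; apply: subset_itvl; rewrite bnd_simp ler_wpM2r//.
  by rewrite lerD2l lerN2 lef_pV2 ?posrE// ler_nat.
have cupE : `]0, t[%classic = \bigcup_n (`]0, (c n * t)]%classic : set R).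
  apply/seteqP; split=> [r|r [n _]] /=; rewrite !in_itv/=; last first.
    move=> /andP[r0 rc]; rewrite r0 (le_lt_trans rc)// gtr_pMl ?gtrBl//.
    by rewrite lt_neqAle t0 andbT; apply: contraTneq rc => <-; rewrite mulr0 -ltNge.
  move=> /andP[r0 rt]; have t0' := lt_trans r0 rt.
  have e0 : 0 < 1 - r / t by rewrite subr_gt0 ltr_pdivrMr// mul1r.
  have [N hN] := inv_small e0; exists N => //=; rewrite in_itv/= r0/=.
  rewrite -ler_pdivrMr// /c lerBrDl -lerBrDr ltW//; exact: (hN N.+1 (leqnSn N)).
have := @nondecreasing_cvg_mu _ _ _ (ls (A w)) (fun n => `]0, (c n * t)]%classic)
  (fun n => measurable_itv _) _ nd.
rewrite -cupE => /(_ (measurable_itv _)).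
move=> h; have {}h : (ls (A w) \o (fun n => `]0, (c n * t)]%classic)) n @[n --> \oo] -->
    (left_value A t w)%:E by rewrite left_valueE.
have -> : (fun n => A w (c n * t)) =
    fine \o (ls (A w) \o (fun n => `]0, (c n * t)]%classic)).
  by apply/funext => n; rewrite -[LHS]/(fine (A w (c n * t))%:E) hE.
exact: fine_cvg h.
Qed.

Lemma left_value_predictable : predictable F (fun t w => A w t) ->
  predictable F (left_value A).
Proof.
move=> pA; apply: (@predictable_cvg _ _ _ _ Fsig (fun n t w => A w (c n * t))).
  by move=> n; apply: (@predictable_scaled _ _ _ _ Fsig Fmon (fun t w => A w t)).
by move=> t w t0; exact: left_value_cvg.
Qed.

End LeftValue.

Lemma Lint_mkcond (al : Omega -> {measure set (measurableTypeR R) -> \bar R}) tau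
    (S : set (R * Omega)) (H : R * Omega -> R) w :
  Lint tau al (H \_ S) w =
  (\int[al w]_(s in `]0%R, tau]%classic `&` [set s : R | S (s, w)]) (H (s, w))%:E)%E.
Proof.
rewrite integral_mkcondr /Lint; apply: eq_integral => s _.
rewrite !patchE; have [h|h] := boolP ((s, w) \in S).
  by rewrite mem_set//; exact: set_mem.
by rewrite memNset//= => /mem_set; exact/negP.
Qed.

(** Equality in E a^2 + E b^2 = 2 E a b forces E (a - b)^2 = 0. *)
Lemma balance_ae_eq (a b : Omega -> R) (x y : Omega -> \bar R) :
  measurable_fun setT a -> measurable_fun setT b ->
  measurable_fun setT x -> measurable_fun setT y ->
  (forall w, 0 <= x w)%E -> (forall w, 0 <= y w)%E ->
  (\int[P]_w (a w ^+ 2)%:E = \int[P]_w x w)%E ->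
  (\int[P]_w (b w ^+ 2)%:E = \int[P]_w y w)%E ->
  (\int[P]_w x w \is a fin_num)%E -> (\int[P]_w y w \is a fin_num)%E ->
  (forall w, x w + y w = (2 * (a w * b w))%:E)%E -> {ae P, forall w, a w = b w}.
Proof.
move=> ma mb mx my x0 y0 ax byy fx fy xy.
have La : L2 P a.
  split => //; apply: Int_ge0; [exact: measurable_funX|by move=> w; exact: sqr_ge0|].
  by rewrite ax -ge0_fin_numE// integral_ge0.
have Lb : L2 P b.
  split => //; apply: Int_ge0; [exact: measurable_funX|by move=> w; exact: sqr_ge0|].
  by rewrite byy -ge0_fin_numE// integral_ge0.
have iab := L2M_Int La Lb.
have E : Ex P (fun w => a w ^+ 2) + Ex P (fun w => b w ^+ 2) = 2 * Ex P (fun w => a w * b w).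
  rewrite -ExZ//; apply: EFin_inj; rewrite EFinD !Ex_EFin; [|exact: IntZ|exact: Lb.2|exact: La.2].
  rewrite ax byy -ge0_integralD//.
  by apply: eq_integral => w _; rewrite xy.
have E0 : Ex P (fun w => (a w - b w) ^+ 2) = 0.
  have -> : (fun w => (a w - b w) ^+ 2) = (fun w => a w ^+ 2 + b w ^+ 2 - 2 * (a w * b w)).
    by apply/funext => w; ring.
  rewrite ExB; [|exact: IntD La.2 Lb.2|exact: IntZ].
  by rewrite ExD; [rewrite E ExZ// subrr|exact: La.2|exact: Lb.2].
have := Ex_eq0 (L2B La Lb).2 (fun w => sqr_ge0 _) E0.
by apply: filterS => w /eqP; rewrite sqrf_eq0 subr_eq0 => /eqP.
Qed.

Section Uniqueness.
Variables A B : Omega -> cumulative R R.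
Hypothesis A0 : forall w, A w 0 = 0.
Hypothesis B0 : forall w, B w 0 = 0.
Hypothesis pA : predictable F (fun t w => A w t).
Hypothesis pB : predictable F (fun t w => B w t).
Hypothesis iA : forall t, 0 <= t -> Int P (fun w => A w t).
Hypothesis iB : forall t, 0 <= t -> Int P (fun w => B w t).
Hypothesis hAB : forall s t C, 0 <= s -> s <= t -> F s C ->
  Ex P (fun w => \1_C w * (A w t - A w s)) = Ex P (fun w => \1_C w * (B w t - B w s)).

Section Horizon.
Variables (tau : R) (k : nat).
Hypothesis tau0 : 0 <= tau.

Let S : set (R * Omega) := [set x | 0 <= x.1 /\ A x.2 x.1 + B x.2 x.1 <= k%:R].
Let J w : set R := `]0, tau]%classic `&` [set s : R | S (s, w)].

Let mS : measurable (S : set U).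
Proof.
have m : measurable_fun D (fun x : U => A x.2 x.1 + B x.2 x.1).
  by apply: measurable_funD; [exact/(predictableP Fsig (fun t w => A w t))|
     exact/(predictableP Fsig (fun t w => B w t))].
have := m (halfline_meas Fsig) `]-oo, (k%:R : R)]%classic (measurable_itv _).
congr measurable; apply/seteqP; split=> x /=; rewrite in_itv/=.
Qed.

Let mJ w : measurable (J w).
Proof.
rewrite (_ : J w = `]0, tau]%classic `&` (fun s => A w s + B w s) @^-1` `]-oo, (k%:R : R)]).
  have mc (Q : cumulative R R) : measurable_fun (setT : set R) Q.
    by apply: nondecreasing_measurable => //; move=> x y; exact: cumulative_le.
  apply: (measurable_funD (measurable_funTS (mc (A w))) (measurable_funTS (mc (B w)))) => //.
rewrite /J/S; apply/seteqP; split=> s /=; rewrite !in_itv/=; first by move=> [-> []].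
by move=> [/andP[s0 ->] h]; rewrite s0; split => //; split => //; exact: ltW.
Qed.

Let J_initial w s : J w s -> `]0, s]%classic = J w `&` [set r : R | r <= s].
Proof.
move=> [+ [/= _ sk]]; rewrite /= in_itv/= => /andP[s0 st].
rewrite /J/S; apply/seteqP; split=> r /=; rewrite !in_itv/=; last by move=> [[/andP[r0 _] _] rs]; rewrite r0 rs.
move=> /andP[r0 rs]; rewrite r0 rs (le_trans rs st); split => //; split => //.
split; first exact: ltW.
by apply: le_trans sk; rewrite lerD// cumulative_le.
Qed.

Let J_initial_open w s : J w s -> `]0, s[%classic = J w `&` [set r : R | r < s].
Proof.
move=> Js; have := J_initial Js; move=> /seteqP[h1 h2].
apply/seteqP; split=> r /=; rewrite in_itv/=.
  move=> /andP[r0 rs]; split => //.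
  by have := h1 r; rewrite /= in_itv/= r0 (ltW rs) => /(_ isT)[].
by move=> [[/= + _] rs]; rewrite in_itv/= => /andP[-> _].
Qed.

(** The predictable integrand A + A_- (and B + B_-), cut off outside
    A + B <= k. *)
Let bal (Q : Omega -> cumulative R R) : R * Omega -> R :=
  (fun x => Q x.2 x.1 + left_value Q x.1 x.2) \_ S.

Let bal_meas (Q : Omega -> cumulative R R) : (forall w, Q w 0 = 0) -> predictable F (fun t w => Q w t) ->
  measurable_fun setT (bal Q : U -> R).
Proof.
move=> Q0 pQ; apply/(measurable_restrict _ mS) => //.
apply: (@measurable_funS _ _ _ _ D) => //.
- exact: (halfline_meas Fsig).
- by move=> x [_ []].
- apply: measurable_funD; first exact/(predictableP Fsig (fun t w => Q w t)).
  by apply/(predictableP Fsig); exact: left_value_predictable.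
Qed.

Let bal_ge0 (Q : Omega -> cumulative R R) : (forall w, Q w 0 = 0) -> forall x, 0 <= bal Q x.
Proof.
move=> Q0 x; rewrite /bal patchE; case: ifPn => // /set_mem[x0 _].
by apply: addr_ge0; [exact: cumulative_ge0|have /andP[] := left_value_bound Q0 x.2 x0].
Qed.

Let bal_le (Q : Omega -> cumulative R R) : (forall w, Q w 0 = 0) -> (forall x, S x -> Q x.2 x.1 <= k%:R) ->
  forall x, bal Q x <= 2 * k%:R.
Proof.
move=> Q0 Qk x; rewrite /bal patchE; case: ifPn => [/set_mem Sx|_]; last by rewrite mulr_ge0.
have /andP[_ h1] := left_value_bound Q0 x.2 Sx.1; have := Qk x Sx; lra.
Qed.

(** Since J is an initial interval of ]0, tau], for s in J the values A_s and
    A_{s-} are the masses of the parts of J up to s and strictly before s. *)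
Let bal_int (al : Omega -> {measure set (measurableTypeR R) -> \bar R}) (Q : Omega -> cumulative R R) w :
  (forall w, Q w 0 = 0) -> Lint tau al (bal Q) w =
  (\int[al w]_(s in J w) ls (Q w) (J w `&` [set r : R | (r <= s)%R]) +
   \int[al w]_(s in J w) ls (Q w) (J w `&` [set r : R | (r < s)%R]))%E.
Proof.
move=> Q0; rewrite Lint_mkcond -/(J w).
have mnd (Q' : cumulative R R) : measurable_fun (setT : set R) Q'.
  by apply: nondecreasing_measurable => //; move=> x y; exact: cumulative_le.
have e1 s : J w s -> (Q w s)%:E = ls (Q w) (J w `&` [set r : R | r <= s]).
  by move=> Js; rewrite -J_initial// ls_itv ?Q0 ?subr0// ; case: Js => _ [].
have e2 s : J w s -> (left_value Q s w)%:E = ls (Q w) (J w `&` [set r : R | r < s]).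
  by move=> Js; rewrite -J_initial_open// left_valueE//; case: Js => _ [].
have s0 s : J w s -> 0 <= s by case=> _ [].
have mlv : measurable_fun (J w) (fun s => left_value Q s w).
  pose c n : R := 1 - n.+2%:R^-1.
  apply: (@measurable_fun_cvg _ _ _ _ (fun n s => Q w (c n * s))) => [n|s Js].
    apply: measurable_funTS; apply: (measurableT_comp (mnd (Q w))).
    by apply: measurable_funM => //; exact: measurable_cst.
  by apply: left_value_cvg => //; exact: s0.
under eq_integral do rewrite EFinD.
rewrite ge0_integralD//=.
- congr (_ + _)%E; apply: eq_integral => s /set_mem Js; [exact: e1|exact: e2].
- exact: mJ.
- by move=> s Js; rewrite lee_fin cumulative_ge0//; exact: s0.
- by apply/measurable_EFinP; apply: (@measurable_funTS _ _ _ _ (J w) _ (mnd (Q w))).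
- by move=> s Js; rewrite lee_fin; have /andP[] := left_value_bound Q0 w (s0 s Js).
- exact/measurable_EFinP.
Qed.

Local Notation kernel := (Omega -> {measure set (measurableTypeR R) -> \bar R}).
Let cA : kernel := fun w => ls (A w).
Let cB : kernel := fun w => ls (B w).

Let cA_dist : dist_of cA (fun w => A w).
Proof. by move=> w s t s0 st; exact: ls_itv. Qed.

Let cB_dist : dist_of cB (fun w => B w).
Proof. by move=> w s t s0 st; exact: ls_itv. Qed.

Let al w := cA w (J w).
Let be w := cB w (J w).

Let mass_fin (Q : Omega -> cumulative R R) w : (ls (Q w) (J w) \is a fin_num)%E.
Proof.
have m0 : measurable (`]0, tau]%classic : set (measurableTypeR R)) by exact: (@measurable_itv R _).
rewrite ge0_fin_numE; last exact: measure_ge0.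
apply: (@le_lt_trans _ _ (ls (Q w) (`]0, tau]%classic : set R))).
  by apply: le_measure; [apply/mem_set; exact: mJ|exact/mem_set|exact: subIsetl].
by rewrite ls_itv// ltry.
Qed.

Let alE w : Lint tau cA (bal A) w = (al w * al w)%E.
Proof. by rewrite bal_int// triangle_split//; exact: mJ. Qed.

Let beE w : Lint tau cB (bal B) w = (be w * be w)%E.
Proof. by rewrite bal_int// triangle_split//; exact: mJ. Qed.

Let crossE w : (Lint tau cB (bal A) w + Lint tau cA (bal B) w = al w * be w + al w * be w)%E.
Proof.
rewrite !bal_int// -[X in (_ = X + _)%E](triangle_split (ls (A w)) (ls (B w)) (mJ w)).
rewrite [X in (_ = _ + X)%E]muleC -[X in (_ = _ + X)%E](triangle_split (ls (B w)) (ls (A w)) (mJ w)).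
move: (\int[_]_(_ in _) _)%E (\int[_]_(_ in _) _)%E (\int[_]_(_ in _) _)%E (\int[_]_(_ in _) _)%E => a b c e.
by rewrite addeACA [RHS]addeACA; congr (_ + _)%E; exact: addeC.
Qed.

(** With H = A + A_- on the set A + B <= k, integration against dA over J gives
    dA(J)^2, and likewise for B; the two mixed integrals add up to
    2 dA(J) dB(J).  The truncation at k makes these integrands bounded, so
    that all means are finite as soon as A_t and B_t are integrable. *)
Lemma mass_ae_eq : {ae P, forall w, ls (A w) (J w) = ls (B w) (J w)}.
Proof.
have g H := @matched_predictable _ _ _ P F Fsig Fmon tau cA cB _ _ cA_dist cB_dist tau0 iA iB hAB H.
have [_ sa1 ma1 mb1 e1] := g _ (bal_meas A0 pA) (bal_ge0 A0).
have [_ sb1 ma2 mb2 e2] := g _ (bal_meas B0 pB) (bal_ge0 B0).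
have mS1 : measurable_fun setT (\1_S : U -> R) by exact: measurable_indic.
have [_ s1 ma3 mb3 _] := g _ mS1 (fun x => ltac:(by rewrite indicE)).
have LS (C : kernel) w : Lint tau C \1_S w = C w (J w).
  have mJ' : measurable (J w : set (measurableTypeR R)) by exact: mJ.
  have -> : \1_S = (fun=> 1 : R) \_ S.
    by apply/funext => x; rewrite patchE indicE; case: (_ \in _).
  by rewrite Lint_mkcond -/(J w) (integral_cst _ mJ') mul1e.
pose a w := fine (al w); pose b w := fine (be w).
have aE w : (a w)%:E = al w := fineK (mass_fin A w).
have bE w : (b w)%:E = be w := fineK (mass_fin B w).
have ma : measurable_fun setT a.
  apply/measurable_EFinP; apply: eq_measurable_fun ma3 => w _.
  by rewrite LS -[cA w _]/(al w) -aE.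
have mb : measurable_fun setT b.
  apply/measurable_EFinP; apply: eq_measurable_fun mb3 => w _.
  by rewrite LS -[cB w _]/(be w) -bE.
have SA x : S x -> A x.2 x.1 <= k%:R.
  by move=> [x0 h]; have := cumulative_ge0 B0 x.2 x0; lra.
have SB x : S x -> B x.2 x.1 <= k%:R.
  by move=> [x0 h]; have := cumulative_ge0 A0 x.2 x0; lra.
have f1 := Eint_fin tau0 cB_dist iB (bal_ge0 A0) sa1 mb1 (bal_le A0 SA).
have f2 := Eint_fin tau0 cA_dist iA (bal_ge0 B0) sb1 ma2 (bal_le B0 SB).
have a2 w : Lint tau cA (bal A) w = (a w ^+ 2)%:E by rewrite alE -aE -EFinM expr2.
have b2 w : Lint tau cB (bal B) w = (b w ^+ 2)%:E by rewrite beE -bE -EFinM expr2.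
have : {ae P, forall w, a w = b w}.
  apply: (@balance_ae_eq a b (Lint tau cB (bal A)) (Lint tau cA (bal B)) ma mb mb1 ma2 _ _ _ _ f1 f2).
  - by move=> w; apply: integral_ge0 => s _; rewrite lee_fin bal_ge0.
  - by move=> w; apply: integral_ge0 => s _; rewrite lee_fin bal_ge0.
  - by rewrite -e1; apply: eq_integral => w _; rewrite a2.
  - by rewrite e2; apply: eq_integral => w _; rewrite b2.
  - by move=> w; rewrite crossE -aE -bE -EFinM -EFinD; congr EFin; ring.
apply: filterS => w ab.
by rewrite -[LHS]/(al w) -[RHS]/(be w) -aE -bE ab.
Qed.

End Horizon.
(** As soon as k exceeds A_tau + B_tau, the interval J is all of ]0, tau]. *)
Lemma compensator_ae_eq_at tau : 0 <= tau -> {ae P, forall w, A w tau = B w tau}.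
Proof.
move=> tau0.
have := (@ae_foralln _ _ _ P _ (fun k : nat => mass_ae_eq k tau0)).
apply: filterS => w hw.
have [k hk] : exists k : nat, A w tau + B w tau <= k%:R.
  by exists (Num.truncn (A w tau + B w tau)).+1; rewrite ltW// truncnS_gt.
have e : `]0, tau]%classic `&` [set s : R | 0 <= s /\ A w s + B w s <= k%:R] = `]0, tau]%classic.
  rewrite setIidl// => s /=; rewrite in_itv/= => /andP[s0 st]; split; first exact: ltW.
  by apply: le_trans hk; rewrite lerD// cumulative_le.
have := hw k; rewrite /= e !ls_itv// A0 B0 !subr0 => h.
exact: EFin_inj h.
Qed.

Lemma compensator_ae_eq : {ae P, forall w, forall t, 0 <= t -> A w t = B w t}.
Proof.
apply: (@indistinguishable _ _ _ _ (fun t w => A w t) (fun t w => B w t)).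
- by move=> w t _; exact: cumulative_is_right_continuous.
- by move=> w t _; exact: cumulative_is_right_continuous.
- exact: compensator_ae_eq_at.
Qed.

End Uniqueness.

Lemma wint_predictable T (A : Omega -> cumulative R R) : 0 < T ->
  predictable F (fun t w => A w t) -> adapted F (fun t w => A w t) ->
  predictable F (fun t w => wint T (A w) t).
Proof.
move=> T0 pA aA; apply: (@predictable_cvg _ _ _ _ Fsig (fun n t w =>
  \sum_(i < n.+1) weight T (grid 0 T n i) ^+ 2 *
   (A w (Num.min (grid 0 T n i.+1) t) - A w (Num.min (grid 0 T n i) t)))); last first.
  by move=> t w t0; exact: wint_riemann.
move=> n; apply/(predictableP Fsig (fun t w => \sum_(i < n.+1) weight T (grid 0 T n i) ^+ 2 *
   (A w (Num.min (grid 0 T n i.+1) t) - A w (Num.min (grid 0 T n i) t)))).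
have ms j : measurable_fun D (fun x : U => A x.2 (Num.min (grid 0 T n j) x.1)).
  apply/(predictableP Fsig (fun t w => A w (Num.min (grid 0 T n j) t))).
  by apply: (predictable_stopped Fsig (H := fun t w => A w t)) => //; rewrite grid_ge// ltW.
apply: (@measurable_sum _ U R D _ _ (fun (i : 'I_n.+1) (x : U) => weight T (grid 0 T n i) ^+ 2 *
   (A x.2 (Num.min (grid 0 T n i.+1) x.1) - A x.2 (Num.min (grid 0 T n i) x.1)))) => i.
apply: measurable_funM; first exact: measurable_cst.
by apply: measurable_funB.
Qed.

End DoobMeyer.

(** * The Ito integral of the remaining time *)

Section ItoIntegral.
Context {d : measure_display} {Omega : measurableType d} {R : realType}.
Variable P : probability Omega R.
Variable F : R -> set (set Omega).
Hypothesis Fsig : forall t, 0 <= t -> sigma_algebra setT (F t) /\ F t `<=` measurable.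
Hypothesis Fmon : forall s t, 0 <= s -> s <= t -> F s `<=` F t.
Variables (X : R -> Omega -> R) (T : R).
Hypothesis smX : sqmart P F X.
Hypothesis cX : forall w, cadlag_path (X ^~ w).
Hypothesis T0 : 0 < T.
Variable A : Omega -> cumulative R R.
Hypothesis mK : martingale P F (fun t w => X t w ^+ 2 - A w t).
Local Notation E := (Ex P).
Local Notation g := (weight T).
Local Notation ls := lebesgue_stieltjes_measure.
Local Notation avg := (avg X T).

(** The distance of a simple process to the weight, in L^2(dP x dA), against the
    distance of its integral to the averaged martingale, in L^2(dP). *)
Section SimpleProcess.
Variable h : simple_process F.
Local Notation n := (size (sp_times h)).
Local Notation p := (part_pt (sp_times h)).

Lemma part_pt_lt i : (i < n)%N -> p i < p i.+1.
Proof. by move=> il; have /(pathP 0)/(_ i il) := sp_sorted h. Qed.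

Lemma part_pt_mono i j : (i <= j)%N -> (j <= n)%N -> p i <= p j.
Proof.
move=> ij jn; rewrite -(subnKC ij); have : (i + (j - i) <= n)%N by rewrite subnKC.
elim: (j - i)%N => [|k IHk]; first by rewrite addn0.
rewrite addnS => kn; apply: le_trans (IHk (ltnW kn)) _.
by rewrite ltW// part_pt_lt.
Qed.

Let dev w s := (sp_eval h s w - g s) ^+ 2.

Lemma sp_dev_meas w : measurable_fun setT (fun s => (sp_eval h s w - g s) ^+ 2).
Proof.
apply: measurable_funX; apply: measurable_funB; last exact: weight_meas.
apply: measurable_sum => i; apply: measurable_funM; first exact: measurable_cst.
by apply: measurable_indic; exact: measurable_itv.
Qed.

Let dev_meas w : measurable_fun setT (dev w). Proof. exact: sp_dev_meas. Qed.

Let dev_bound t w : exists K, forall v, 0 < v -> v <= t -> `|dev w v| <= K.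
Proof.
exists ((\sum_(i < n) `|sp_coef h i w| + T) ^+ 2) => v v0 vt.
rewrite /dev normrX lerXn2r ?nnegrE ?addr_ge0 ?sumr_ge0 ?(ltW T0)//.
apply: le_trans (ler_normB _ _) _; apply: lerD.
  apply: le_trans (ler_norm_sum _ _ _) _; apply: ler_sum => i _.
  by rewrite normrM ler_piMr// indicE; case: (_ \in _); rewrite ?normr1 ?normr0.
by rewrite ger0_norm ?weight_ge0// weight_le// ltW.
Qed.

Lemma sp_evalE i s w : (i < n)%N -> p i < s -> s <= p i.+1 -> sp_eval h s w = sp_coef h i w.
Proof.
move=> il ps h2; rewrite /sp_eval (bigD1 (Ordinal il))//= big1 ?addr0.
  by rewrite indicE mem_set ?mulr1//= in_itv/= ps h2.
move=> j ji; rewrite indicE memNset ?mulr0//= in_itv/= => /andP[js sj].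
have [ij|ji'|/esym e] := ltngtP i j.
- have := lt_le_trans js h2; rewrite ltNge part_pt_mono//; exact: ltnW (ltn_ord j).
- by have := lt_le_trans ps sj; rewrite ltNge part_pt_mono// ltnW.
- by move: ji; rewrite -val_eqE/= e eqxx.
Qed.

Section Horizon.
Variable t : R.
Hypothesis t0 : 0 <= t.

(** With default value t these are the subdivision points stopped at t, followed
    by t.  The coefficient [c] is set to 0 on cells that start after t, so that
    it is known at the stopped time u i in every case. *)
Let u i := Num.min (nth t (0 :: sp_times h) i) t.
Let c i w := if (i < n)%N && (p i <= t) then sp_coef h i w else 0.

Let uE i : (i <= n)%N -> u i = Num.min (p i) t.
Proof. by move=> il; rewrite /u (set_nth_default 0). Qed.

Let u_last i : (n < i)%N -> u i = t.
Proof. by move=> il; rewrite /u nth_default// minxx. Qed.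

Let u0 : u 0%N = 0. Proof. by rewrite /u/= min_l. Qed.

Let u_le i : u i <= t. Proof. by rewrite /u ge_min lexx orbT. Qed.

Let um : {homo u : i j / (i <= j)%N >-> i <= j}.
Proof.
move=> i j ij; have [jn|nj] := leqP j n; last by rewrite (u_last nj).
by rewrite !uE ?(leq_trans ij)// le_min !ge_min lexx orbT part_pt_mono.
Qed.

Let ui i : 0 <= u i. Proof. by rewrite -u0; exact: um. Qed.

Let cF i : measurable_wrt (F (u i)) (c i).
Proof.
have [/andP[il pt]|h0] := boolP ((i < n)%N && (p i <= t)); last first.
  rewrite (_ : c i = fun=> 0); first exact: (mwrt_cst (Fsig (ui i)).1).
  by apply/funext => w; rewrite /c (negPf h0).
rewrite (_ : c i = sp_coef h i); last by apply/funext => w; rewrite /c il pt.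
by rewrite uE ?(ltnW il)// min_l//; exact: sp_measurable.
Qed.

Let cK i : exists2 K, 1 <= K & forall w, `|c i w| <= K.
Proof.
have [/andP[il pt]|h0] := boolP ((i < n)%N && (p i <= t)); last first.
  by exists 1 => // w; rewrite /c (negPf h0) normr0.
have [K hK] := sp_bounded il; exists (Num.max K 1); first by rewrite le_max lexx orbT.
by move=> w; rewrite /c il pt le_max hK.
Qed.

Let sp_eval_cell i s w : (i <= n)%N -> u i < s -> s <= u i.+1 -> sp_eval h s w = c i w.
Proof.
move=> il; have st' j : s <= u j -> s <= t by move=> /le_trans; apply.
move: (il); rewrite leq_eqVlt => /predU1P[->|il1].
  rewrite uE// gt_min => h1 h2; have st := st' _ h2.
  move: h1; rewrite [t < s]ltNge st orbF => ps.
  rewrite /c ltnn/= /sp_eval big1// => j _.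
  rewrite indicE memNset ?mulr0//= in_itv/= => /andP[_ sj].
  have := lt_le_trans ps sj; rewrite ltNge part_pt_mono//; exact: ltn_ord j.
rewrite !uE// gt_min le_min => h1 /andP[h2 st].
move: h1; rewrite [t < s]ltNge st orbF => ps.
have pt : p i <= t by rewrite (le_trans (ltW ps)).
by rewrite /c il1 pt; exact: sp_evalE.
Qed.

Let f i w := c i w * (X (u i.+1) w - X (u i) w) - 1 * (avg (u i.+1) w - avg (u i) w).

Definition ito_error w := sp_integral h X t w - (avg t w - avg 0 w).
Definition ito_distance w := \int[ls (A w)]_(s in `]0, t]) (sp_eval h s w - g s) ^+ 2.

Let sum_f k w : (k <= n.+1)%N -> \sum_(i < k) f i w =
  \sum_(i < k) c i w * (X (u i.+1) w - X (u i) w) - (avg (u k) w - avg 0 w).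
Proof.
move=> kn; rewrite sumrB; congr (_ - _).
have -> : avg 0 w = avg (u 0%N) w by rewrite u0.
rewrite -(telescope_sumr (fun i => avg (u i) w) (leq0n k)) big_mkord.
by apply: eq_bigr => i _; rewrite mul1r.
Qed.

Let errorE w : ito_error w = \sum_(i < n.+1) f i w.
Proof.
rewrite sum_f// u_last// /ito_error; congr (_ - _).
rewrite big_ord_recr/= {2}/c ltnn/= mul0r addr0 /sp_integral.
apply: eq_bigr => i _; rewrite !uE//; last exact: ltnW.
rewrite /c ltn_ord/=; case: leP => // tp.
rewrite min_r ?subrr ?mulr0//.
by apply: le_trans (ltW tp) _; rewrite ltW// part_pt_lt.
Qed.

Let distanceE w : ito_distance w = \sum_(i < n.+1) iso_integral T A (u i) (u i.+1) (c i) (fun=> 1) w.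
Proof.
have ind k : (k <= n.+1)%N -> \int[ls (A w)]_(s in `]0, u k]) dev w s =
    \sum_(i < k) iso_integral T A (u i) (u i.+1) (c i) (fun=> 1) w.
  elim: k => [_|k IHk kn].
    by rewrite u0 set_itv_ge ?bnd_simp ?ltxx// Rintegral_set0 big_ord0.
  rewrite big_ord_recr/= -IHk ?(ltnW kn)// (@ls_cat _ (A w) (dev w) 0 (u k) (u k.+1))//.
  - congr (_ + _); rewrite /iso_integral; apply: eq_Rintegral => s /set_mem; rewrite /= in_itv/= => /andP[s1 s2].
    by rewrite /dev (@sp_eval_cell k)// mul1r.
  - exact: um.
by rewrite -ind// u_last.
Qed.

Let f_L2 i : L2 P (f i).
Proof.
have [K K1 hK] := cK i.
apply: (@iso_L2 _ _ _ _ _ Fsig Fmon X T smX cX T0 (u i) (u i.+1) (c i) (fun=> 1) K) => //.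
- exact: um.
- exact: (mwrt_cst (Fsig (ui i)).1).
- by move=> w; rewrite normr1.
Qed.

Let iso_cell i : E (fun w => f i w ^+ 2) =
  E (iso_integral T A (u i) (u i.+1) (c i) (fun=> 1)) /\
  Int P (iso_integral T A (u i) (u i.+1) (c i) (fun=> 1)).
Proof.
have [K K1 hK] := cK i; split.
  apply: (@increment_isometry _ _ _ P F Fsig Fmon X T smX cX T0 A mK (u i) (u i.+1) (c i) (fun=> 1) K) => //.
  - exact: um.
  - exact: (mwrt_cst (Fsig (ui i)).1).
  - by move=> w; rewrite normr1.
apply: (@iso_integral_Int _ _ _ P F Fsig Fmon X T smX T0 A mK (u i) (u i.+1) (c i) (fun=> 1) K) => //.
- exact: um.
- exact: (mwrt_cst (Fsig (ui i)).1).
- by move=> w; rewrite normr1.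
Qed.

Lemma ito_error_L2 : L2 P ito_error.
Proof.
have -> : ito_error = fun w => \sum_(i < n.+1) f i w by apply/funext; exact: errorE.
by apply: L2_sum => i _; exact: f_L2.
Qed.

Lemma ito_distance_Int : Int P ito_distance.
Proof.
have -> : ito_distance = fun w => \sum_(i < n.+1)
    iso_integral T A (u i) (u i.+1) (c i) (fun=> 1) w by apply/funext; exact: distanceE.
by apply: (@Int_sum _ _ _ _ _ (fun i => iso_integral T A (u i) (u i.+1) (c i) (fun=> 1))) => i _; have [] := iso_cell i.
Qed.

(** Cell by cell this is [increment_isometry] with b = 1; the contributions of
    different cells are orthogonal. *)
Lemma ito_isometry : E (fun w => ito_error w ^+ 2) = E ito_distance.
Proof.
have -> : ito_distance = fun w => \sum_(i < n.+1)
    iso_integral T A (u i) (u i.+1) (c i) (fun=> 1) w by apply/funext; exact: distanceE.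
rewrite (@Ex_sum _ _ _ _ _ (fun i => iso_integral T A (u i) (u i.+1) (c i) (fun=> 1))); last first.
  by move=> i _; have [] := iso_cell i.
under eq_fun do rewrite errorE.
rewrite (@pythagoras _ _ _ _ _ f); first by apply: eq_bigr => i _; have [] := iso_cell i.
  by move=> i _; exact: f_L2.
move=> i il; set V := fun w => \sum_(j < i) f j w.
have sg := (Fsig (ui i)).1.
have aF Y j : adapted F Y -> (j <= i)%N -> measurable_wrt (F (u i)) (Y (u j)).
  by move=> aY ji; exact: (adaptedS Fmon aY (ui j) (um ji)).
have smN := avg_sqmart Fsig Fmon smX cX T0.
have aX : adapted F X by case: smX.
have aN : adapted F avg by case: smN.
have VF : measurable_wrt (F (u i)) V.
  rewrite (_ : V = fun w => \sum_(j < i) (if (j < i)%N then f j w else 0)); last first.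
    by apply/funext => w; apply: eq_bigr => j _; rewrite ltn_ord.
  apply: (mwrt_sum sg (f := fun j w => if (j < i)%N then f j w else 0)) => j _.
  have [ji|_] := ltnP j i; last exact: (mwrt_cst sg).
  apply: (mwrtB sg).
    apply: (mwrtM sg); first by apply: (mwrtS Fmon (ui j) (um (ltnW ji))).
    by apply: (mwrtB sg); apply: aF => //; exact: ltnW.
  by apply: (mwrtZ sg); apply: (mwrtB sg); apply: aF => //; exact: ltnW.
have VL : L2 P V by apply: L2_sum => j _; exact: f_L2.
have [K K1 hK] := cK i.
have cV : L2 P (fun w => c i w * V w).
  by apply: (@L2bM _ _ _ _ K) => //; exact: (Fmeas_fun Fsig (ui i)).
have -> : (fun w => V w * f i w) = (fun w => (c i w * V w) * (X (u i.+1) w - X (u i) w) -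
    V w * (avg (u i.+1) w - avg (u i) w)).
  by apply/funext => w; rewrite /f; ring.
have uu : u i <= u i.+1 by exact: um.
rewrite ExB; last 2 first.
- by apply: L2M_Int => //; exact: (sqmart_L2B smX).
- by apply: L2M_Int => //; exact: (sqmart_L2B smN).
rewrite (sqmart_orth Fsig smX)//; last exact: (mwrtM sg).
by rewrite (sqmart_orth Fsig smN)// subrr.
Qed.

End Horizon.

Lemma ito_distance_le s t w : 0 <= s -> s <= t -> ito_distance s w <= ito_distance t w.
Proof.
move=> s0 st; rewrite /ito_distance [leRHS](@ls_cat _ (A w) (dev w) 0 s t)//.
  by rewrite lerDl; apply: Rintegral_ge0 => v _; exact: sqr_ge0.
Qed.

Lemma approximation_errorE :
  (\int[P]_w \int[ls (A w)]_(s in `]0%R, T]) ((sp_eval h s w - (T - s)) ^+ 2)%:E =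
   (E (ito_distance T))%:E)%E.
Proof.
rewrite Ex_EFin; last exact: (ito_distance_Int (ltW T0)).
apply: eq_integral => w _; rewrite /ito_distance /Rintegral fineK; last first.
  have [K hK] := dev_bound T w.
  exact: integrable_fin_num (@ls_integrable _ (A w) (dev w) 0 T K (dev_meas w) hK).
apply: eq_integral => s /set_mem; rewrite /= in_itv/= => /andP[_ sT].
by rewrite weightE.
Qed.

End SimpleProcess.

Section Averaged.
Variable M : R -> Omega -> R.
Hypothesis aM : adapted F M.
Hypothesis MN : forall t, 0 <= t -> {ae P, forall w, M t w = avg t w}.

Lemma integral_errorE (h : simple_process F) t : 0 <= t ->
  (\int[P]_w ((sp_integral h X t w - (M t w - M 0%R w)) ^+ 2)%:E =
   (E (ito_distance h t))%:E)%E.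
Proof.
move=> t0; rewrite -(ito_isometry h t0) Ex_EFin; last exact: (ito_error_L2 h t0).2.
have mM s : 0 <= s -> measurable_fun setT (M s).
  by move=> s0; exact: (Fmeas_fun Fsig s0 (aM s0)).
have mN s : 0 <= s -> measurable_fun setT (avg s).
  by move=> s0; have /L2_Int/Int_meas := avg_L2 Fsig Fmon smX cX T0 s0.
have mI : measurable_fun setT (ito_error h t) by have [] := ito_error_L2 h t0.
apply: ae_eq_integral => //.
- apply/measurable_EFinP; apply: measurable_funX.
  apply: measurable_funB; last by apply: measurable_funB; exact: mM.
  rewrite (_ : sp_integral h X t = fun w => ito_error h t w + (avg t w - avg 0 w)); last first.
    by apply/funext => w; rewrite subrK.
  by apply: measurable_funD => //; apply: measurable_funB; exact: mN.
- by apply/measurable_EFinP; apply: measurable_funX.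
- by apply: filterS2 (MN t0) (MN (lexx 0)) => w e1 e2 _; rewrite /ito_error e1 e2.
Qed.

(** The distance on ]0, t] is at most the distance on ]0, T], which tends to 0 by
    hypothesis. *)
Lemma integral_error_cvg (h : nat -> simple_process F) t :
  approximates P A T (fun t _ => T - t) h -> 0 <= t -> t <= T ->
  (\int[P]_w ((sp_integral (h n) X t w - (M t w - M 0%R w)) ^+ 2)%:E)%E
    @[n --> \oo] --> 0%E.
Proof.
rewrite /approximates; under eq_fun do rewrite approximation_errorE.
move=> hh t0 tT; under eq_fun do rewrite integral_errorE//.
apply: (@squeeze_cvge _ _ _ _ (fun=> 0%E) _ (fun n => (E (ito_distance (h n) T))%:E)) => //.
  apply: nearW => n; rewrite !lee_fin; apply/andP; split.
    by apply: Ex_ge0 => w; apply: Rintegral_ge0 => s _; exact: sqr_ge0.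
  apply: Ex_le; [exact: ito_distance_Int|exact: (ito_distance_Int _ (ltW T0))|].
  by move=> w; exact: ito_distance_le.
exact: cvg_cst.
Qed.

End Averaged.

Section GridProcess.
Variable n : nat.
Let times := mkseq (fun i => grid 0 T n i.+1) n.+1.

Let ptE i : (i <= n.+1)%N -> part_pt times i = grid 0 T n i.
Proof.
case: i => [|i] il; first by rewrite grid0.
by rewrite /part_pt/= nth_mkseq.
Qed.

Let grid_lt i : grid 0 T n i < grid 0 T n i.+1.
Proof. by rewrite -subr_gt0 gridS subr0 divr_gt0. Qed.

Let times_sorted : path <%R 0 times.
Proof.
apply/(pathP 0) => i; rewrite size_mkseq => il.
by rewrite -/(part_pt times i) ptE ?(ltnW il)// nth_mkseq.
Qed.

Let coef_meas i : (i < size times)%N ->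
  measurable_wrt (F (part_pt times i)) (fun _ : Omega => g (grid 0 T n i)).
Proof.
rewrite size_mkseq => il; apply: mwrt_cst.
by apply: (Fsig _).1; rewrite ptE ?(ltnW il)// grid_ge// ltW.
Qed.

Let coef_bound i : (i < size times)%N ->
  exists K : R, forall w : Omega, `|g (grid 0 T n i)| <= K.
Proof. by move=> _; exists `|g (grid 0 T n i)|. Qed.

(** The weight frozen at the left endpoint of each cell of a uniform grid. *)
Definition grid_process : simple_process F :=
  @SimpleProcess _ Omega R F times (fun i _ => g (grid 0 T n i))
    times_sorted coef_meas coef_bound.

Let grid_eval s w : 0 < s -> s <= T ->
  exists2 i, sp_eval grid_process s w = g (grid 0 T n i) &
    grid 0 T n i < s /\ s <= grid 0 T n i.+1.
Proof.
move=> s0 sT.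
have [i il [i1 i2]] : exists2 i, (i < n.+1)%N & grid 0 T n i < s /\ s <= grid 0 T n i.+1.
  have : s <= grid 0 T n n.+1 by rewrite gridn.
  elim: n.+1 => [|k IHk]; first by rewrite grid0 leNgt s0.
  have [ks|sk] := leP s (grid 0 T n k); last by exists k.
  by have [i il h] := IHk ks; exists i => //; exact: ltnW.
exists i => //; have iz : (i < size times)%N by rewrite size_mkseq.
by rewrite (@sp_evalE grid_process i)// ptE// ltnW.
Qed.

Lemma grid_process_distance w :
  ito_distance grid_process T w <= (T / n.+1%:R) ^+ 2 * (A w T - A w 0).
Proof.
have := @ls_cst_bound _ (A w) (fun s => (sp_eval grid_process s w - g s) ^+ 2) 0
  ((T / n.+1%:R) ^+ 2) 0 T (sp_dev_meas _ _) (ltW T0) (sqr_ge0 _).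
rewrite mul0r subr0 -/(ito_distance grid_process T w) => h.
apply: le_trans (ler_norm _) (h _) => s s0 sT.
have [i -> [i1 i2]] := grid_eval w s0 sT.
rewrite subr0 normrX lerXn2r ?nnegrE ?divr_ge0 ?(ltW T0)//.
apply: le_trans (weight_lip _ _ _) _; rewrite ler0_norm ?opprB; last by rewrite subr_le0 ltW.
by rewrite -[X in X / _]subr0 -(gridS 0 T n i) lerB.
Qed.

End GridProcess.

Lemma grid_process_approximates : approximates P A T (fun t _ => T - t) grid_process.
Proof.
rewrite /approximates; under eq_fun do rewrite approximation_errorE.
apply: cvg_toEFin; apply/seq_cvgP => e e0.
have iA : Int P (fun w => A w T - A w 0).
  by apply: IntB; apply: (bracket_Int smX mK) => //; exact: ltW.
set C := T ^+ 2 * E (fun w => A w T - A w 0).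
have C0 : 0 <= C.
  apply: mulr_ge0; first exact: sqr_ge0.
  by apply: Ex_ge0 => w; rewrite subr_ge0 cumulative_le// ltW.
have C1 : 0 < C + 1 by rewrite ltr_wpDl.
have [N hN] := inv_small (divr_gt0 e0 C1); exists N => n /hN {}hN.
rewrite subr0 ger0_norm; last by apply: Ex_ge0 => w; apply: Rintegral_ge0 => s _; exact: sqr_ge0.
apply: (@le_lt_trans _ _ ((n.+1%:R^-1) ^+ 2 * C)).
  rewrite /C mulrA -exprMn [_^-1 * T]mulrC -ExZ//.
  apply: Ex_le; [exact: (ito_distance_Int _ (ltW T0))|exact: IntZ|].
  by move=> w; exact: grid_process_distance.
have n1 : n.+1%:R^-1 <= 1 :> R by rewrite invf_le1 ?ler1n.
apply: le_lt_trans (_ : n.+1%:R^-1 * (C + 1) < _).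
  rewrite expr2 -mulrA ler_wpM2l// ; apply: le_trans (_ : C <= _); last by rewrite lerDl.
  by rewrite ler_piMl.
by rewrite -ltr_pdivlMr.
Qed.

Lemma averaged_ito_integral M : adapted F M -> cadlag M ->
  (forall t, 0 <= t -> {ae P, forall w, M t w = avg t w}) ->
  is_ito_integral P F X A T (fun t _ => T - t) (fun t w => M t w - M 0 w).
Proof.
move=> aM cM MN; split.
- apply: (predictable_det Fsig (f := fun t => T - t)).
  by apply: measurable_funB => //; exact: measurable_cst.
- move=> t t0; apply: (mwrtB (Fsig t0).1); first exact: aM.
  exact: (adaptedS Fmon aM (lexx 0) t0).
- move=> w; have [rc ll] := cM w; split=> t t0.
    by apply: cvgB; [exact: rc|exact: cvg_cst].
  by apply: is_cvgB; [exact: ll|exact: is_cvg_cst].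
- by exists grid_process; exact: grid_process_approximates.
- by move=> h hh t /andP[t0 tT]; exact: integral_error_cvg.
Qed.

End ItoIntegral.

(** * Jumps *)

Section Jumps.
Context {d : measure_display} {Omega : measurableType d} {R : realType}.
Variables (X : R -> Omega -> R) (T : R).
Hypothesis cX : forall w, cadlag_path (X ^~ w).
Hypothesis T0 : 0 < T.

(** The equality with the averaged path is needed at all times, since the left
    limit of M at t depends on the values of M just before t. *)
Lemma averaged_jump (M : R -> Omega -> R) w :
  (forall t, 0 <= t -> M t w = avg X T t w) ->
  forall t, 0 <= t -> jump M t w = weight T t * jump X t w.
Proof.
move=> MN t; rewrite le_eqVlt /jump => /predU1P[<-|t0]; first by rewrite eqxx mulr0.
rewrite gt_eqF//; set l := lim (X s w @[s --> t^'-]).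
suff -> : lim (M s w @[s --> t^'-]) = avg X T t w - weight T t * (X t w - l).
  by rewrite MN 1?ltW//; ring.
apply: cvg_lim => //; apply/left_cvgP => e e0.
have [dl dl0 h] := (left_cvgP _ _ _).1 (avg_jump (cX w) T0 t0) e e0.
exists (Num.min dl t); first by rewrite lt_min dl0.
move=> s; rewrite ltrBlDr -ltrBlDl lt_min => /andP[sd st'] st.
rewrite MN; last by lra.
by apply: h => //; lra.
Qed.

End Jumps.

(** * Convergence in probability *)

Section ConvergenceInProbability.
Context {d : measure_display} {Omega : measurableType d} {R : realType}.
Variable P : probability Omega R.
Implicit Types (Z : Omega -> R) (S : nat -> Omega -> R).

(** The mean of the truncated absolute value metrizes convergence in
    probability, so that the latter can be handled by the triangle inequality and
    dominated convergence. *)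
Definition prob_norm Z : R := Ex P (fun w => Num.min 1 `|Z w|).

Let mn Z : measurable_fun setT Z -> measurable_fun setT (fun w => Num.min 1 `|Z w|).
Proof.
move=> mZ; apply: measurable_minr; first exact: measurable_cst.
exact: measurableT_comp.
Qed.

Let min_ge0 Z w : 0 <= Num.min 1 `|Z w|. Proof. by rewrite le_min ler01/=. Qed.

Let Int_min Z : measurable_fun setT Z -> Int P (fun w => Num.min 1 `|Z w|).
Proof.
move=> mZ; apply: (@Int_bd _ _ _ _ _ 1); first exact: mn.
by move=> w; rewrite ger0_norm// ge_min lexx.
Qed.

Lemma prob_norm_ge0 Z : 0 <= prob_norm Z.
Proof. by apply: Ex_ge0 => w. Qed.

Lemma prob_norm_leD Z Z1 Z2 : measurable_fun setT Z ->
  measurable_fun setT Z1 -> measurable_fun setT Z2 ->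
  (forall w, `|Z w| <= `|Z1 w| + `|Z2 w|) -> prob_norm Z <= prob_norm Z1 + prob_norm Z2.
Proof.
move=> mZ m1 m2 h; rewrite /prob_norm -ExD; [|exact: Int_min..].
apply: Ex_le; [exact: Int_min|by apply: IntD; exact: Int_min|] => w.
have := h w; have := normr_ge0 (Z1 w); have := normr_ge0 (Z2 w).
by rewrite /Order.min; case: ifPn; case: ifPn; case: ifPn; rewrite -?leNgt; lra.
Qed.

Lemma prob_norm_le_scale c Z Z1 : 1 <= c -> measurable_fun setT Z ->
  measurable_fun setT Z1 -> (forall w, `|Z w| <= c * `|Z1 w|) ->
  prob_norm Z <= c * prob_norm Z1.
Proof.
move=> c1 mZ m1 h; rewrite /prob_norm -ExZ; last exact: Int_min.
apply: Ex_le; [exact: Int_min|by apply: IntZ; exact: Int_min|] => w.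
have := h w; have := normr_ge0 (Z1 w).
by rewrite /Order.min; case: ifPn; case: ifPn; rewrite -?leNgt; nra.
Qed.

Lemma prob_norm_le_Ex Z : Int P Z -> prob_norm Z <= Ex P (fun w => `|Z w|).
Proof.
move=> iZ; apply: Ex_le; [exact: (Int_min (Int_meas iZ))|exact: Int_norm|] => w.
by rewrite ge_min lexx orbT.
Qed.

Lemma prob_norm_ae Z1 Z2 : measurable_fun setT Z1 -> measurable_fun setT Z2 ->
  {ae P, forall w, Z1 w = Z2 w} -> prob_norm Z1 = prob_norm Z2.
Proof.
move=> m1 m2 h; apply: Ex_ae; [exact: mn..|].
by apply: filterS h => w ->.
Qed.

Lemma prob_norm_eq0 Z : measurable_fun setT Z -> prob_norm Z = 0 ->
  {ae P, forall w, Z w = 0}.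
Proof.
move=> mZ h; have := Ex_eq0 (Int_min mZ) (min_ge0 Z) h.
apply: filterS => w; rewrite /Order.min; case: ifPn => [_ /eqP|_ /eqP]; first by rewrite oner_eq0.
by rewrite normr_eq0 => /eqP.
Qed.

Lemma prob_norm_cvg S L : (forall n, measurable_fun setT (S n)) ->
  (forall w, S n w @[n --> \oo] --> L w) ->
  prob_norm (fun w => S n w - L w) @[n --> \oo] --> 0.
Proof.
move=> mS SL.
have mL : measurable_fun setT L by apply: (@measurable_fun_cvg _ _ _ _ S).
have := @Ex_cvg _ _ _ P (fun n w => Num.min 1 `|S n w - L w|) (fun=> 0) (fun=> 1).
rewrite Ex_cst mul0r; case; last by [].
- by move=> n; apply: mn; exact: measurable_funB.
- move=> w; apply/seq_cvgP => e e0; have [N hN] := (seq_cvgP _ _).1 (SL w) e e0.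
  exists N => n Nn; rewrite subr0 ger0_norm; last by rewrite le_min ler01 normr_ge0.
  by rewrite gt_min hN ?orbT.
- exact: Int_cst.
- by move=> n w; rewrite ger0_norm ?ge_min ?lexx// le_min ler01 normr_ge0.
Qed.

(** For 0 < e, min(1, e) P(|Z| >= e) <= E min(1, |Z|) <= e + P(|Z| >= e). *)
Lemma cvg_in_probabilityP S L : (forall n, measurable_fun setT (S n)) ->
  measurable_fun setT L ->
  cvg_in_probability P S L <-> prob_norm (fun w => S n w - L w) @[n --> \oo] --> 0.
Proof.
move=> mS mL.
have mD n : measurable_fun setT (fun w => S n w - L w) by exact: measurable_funB.
have mE n e : measurable [set w | e <= `|S n w - L w|].
  have : measurable_fun setT (fun w => `|S n w - L w|) by exact: measurableT_comp.
  move=> /(_ measurableT `[e, +oo[%classic (measurable_itv _)); rewrite setTI.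
  by congr measurable; apply/seteqP; split=> w /=; rewrite in_itv/= andbT.
have iE n e : Int P (\1_[set w | e <= `|S n w - L w|]).
  apply: (@Int_bd _ _ _ _ _ 1); first exact: measurable_indic.
  by move=> w; exact: ind_le1.
have EP n e : (Ex P (\1_[set w | e <= `|S n w - L w|]))%:E = P [set w | e <= `|S n w - L w|].
  by rewrite Ex_EFin// integral_indic// setIT.
split=> [h|h e e0].
  apply/seq_cvgP => e e0; have e2 : 0 < e / 2 by rewrite divr_gt0.
  have := h _ e2; rewrite (_ : (fun n => P _) = fun n => (Ex P (\1_[set w | e / 2 <= `|S n w - L w|]))%:E); last first.
    by apply/funext => n; rewrite EP.
  move=> /fine_cvgP[_ /seq_cvgP/(_ _ e2)[N hN]]; exists N => n Nn.
  have := hN n Nn; rewrite /= subr0 subr0.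
  rewrite ger0_norm; last by apply: Ex_ge0 => w; rewrite indicE.
  rewrite ger0_norm ?prob_norm_ge0// => h1.
  apply: (@le_lt_trans _ _ (e / 2 + Ex P (\1_[set w | e / 2 <= `|S n w - L w|]))); last lra.
  rewrite -[X in X + _](Ex_cstP P) -ExD//; last exact: Int_cst.
  apply: Ex_le; [exact: Int_min|by apply: IntD => //; exact: Int_cst|] => w.
  rewrite indicE; have [hw|hw] := leP (e / 2) `|S n w - L w|.
    by rewrite mem_set//= ge_min; apply/orP; left; rewrite lerDr ltW.
  by rewrite memNset/= ?addr0 ?ge_min ?(ltW hw) ?orbT//; apply/negP; rewrite -ltNge.
rewrite (_ : (fun n => P _) = fun n => (Ex P (\1_[set w | e <= `|S n w - L w|]))%:E); last first.
  by apply/funext => n; rewrite EP.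
apply: cvg_toEFin; apply/seq_cvgP => c c0.
set k := Num.min 1 e; have k0 : 0 < k by rewrite lt_min ltr01.
have [N hN] := (seq_cvgP _ _).1 h (c * k) (mulr_gt0 c0 k0); exists N => n /hN.
rewrite !subr0 ger0_norm ?prob_norm_ge0// => h1.
rewrite ger0_norm; last by apply: Ex_ge0 => w; rewrite indicE.
rewrite -(ltr_pM2r k0); apply: le_lt_trans h1; rewrite mulrC -ExZ//.
apply: Ex_le; [exact: IntZ|exact: Int_min|] => w.
rewrite indicE; have [hw|hw] := boolP (e <= `|S n w - L w|).
  by rewrite mem_set//= mulr1 /k le_min !ge_min lexx hw !orbT.
by rewrite memNset/= ?mulr0// ; apply/negP.
Qed.

Lemma cvg_in_probability_unique S L1 L2 : (forall n, measurable_fun setT (S n)) ->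
  measurable_fun setT L1 -> measurable_fun setT L2 ->
  cvg_in_probability P S L1 -> cvg_in_probability P S L2 ->
  {ae P, forall w, L1 w = L2 w}.
Proof.
move=> mS m1 m2 /(cvg_in_probabilityP mS m1) h1 /(cvg_in_probabilityP mS m2) h2.
have mL : measurable_fun setT (fun w => L1 w - L2 w) by exact: measurable_funB.
have : {ae P, forall w, L1 w - L2 w = 0}.
  apply: prob_norm_eq0 => //; apply/eqP; rewrite eq_le prob_norm_ge0 andbT.
  have h : prob_norm (fun w => S n w - L1 w) + prob_norm (fun w => S n w - L2 w)
      @[n --> \oo] --> (0 : R).
    by rewrite -[X in _ --> X](addr0 0); exact: cvgD.
  rewrite -(cvg_lim _ h)//; apply: limr_ge; first by apply/cvg_ex; eexists; exact: h.
  apply: nearW => n; apply: prob_norm_leD => //; try exact: measurable_funB.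
  move=> w; have -> : L1 w - L2 w = (S n w - L2 w) - (S n w - L1 w) by ring.
  by rewrite [leRHS]addrC; exact: ler_normB.
by apply: filterS => w /eqP; rewrite subr_eq0 => /eqP.
Qed.

End ConvergenceInProbability.

(** * Sums over the cells of a partition *)

Section PartitionSums.
Context {R : realType}.
Implicit Types (f : R -> R -> R) (x : R -> R) (s : seq R).

(** The sum of f over the cells of the subdivision a :: s.  The starting point is
    a parameter so that sums can be analysed by induction on s. *)
Definition cell_sum f a s : R :=
  \sum_(i < size s) f (nth 0 (a :: s) i) (nth 0 (a :: s) i.+1).

Lemma cell_sum_nil f a : cell_sum f a [::] = 0.
Proof. by rewrite /cell_sum big_ord0. Qed.

Lemma cell_sum_cons f a b s : cell_sum f a (b :: s) = f a b + cell_sum f b s.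
Proof. by rewrite /cell_sum big_ord_recl. Qed.

Lemma path_lt_last a s : path <%R a s -> a <= last a s.
Proof.
elim: s a => [|b s IHs] a //= /andP[ab /IHs]; exact: le_trans (ltW ab).
Qed.

Lemma cell_sum_le f1 f2 a s : path <%R a s ->
  (forall u v, a <= u -> u < v -> v <= last a s -> f1 u v <= f2 u v) ->
  cell_sum f1 a s <= cell_sum f2 a s.
Proof.
elim: s a => [|b s IHs] a; first by rewrite !cell_sum_nil.
rewrite /= !cell_sum_cons => /andP[ab bs] h; apply: lerD.
  by apply: h => //; exact: path_lt_last.
by apply: IHs => // u v bu; apply: h; exact: le_trans (ltW ab) bu.
Qed.

Lemma cell_sum_norm f a s : `|cell_sum f a s| <= cell_sum (fun u v => `|f u v|) a s.
Proof. exact: ler_norm_sum. Qed.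

Definition gap_le (e a b : R) := b - a <= e.

(** A bound on the mesh becomes a path condition, which restricts well to
    sub-partitions. *)
Lemma mesh_leP e s : 0 <= e -> mesh s <= e <-> path (gap_le e) 0 s.
Proof.
move=> e0; split=> [h|/(pathP 0) h].
  apply/(pathP 0) => i il; apply: le_trans h.
  exact: (le_bigmax _ (fun i : 'I_(size s) => part_pt s i.+1 - part_pt s i) (Ordinal il)).
by apply: bigmax_le => // i _; exact: h.
Qed.

Lemma mesh_ge0 s : 0 <= mesh s.
Proof.
rewrite /mesh; elim/big_rec: _ => // i y _ y0.
by rewrite le_max y0 orbT.
Qed.

Definition sq_incr x (a b : R) : R := (x b - x a) ^+ 2.
Definition stopped_sq x (t a b : R) : R := sq_incr x (Num.min a t) (Num.min b t).

Lemma filter_lt_nil t a s : t <= a -> path <%R a s -> [seq r <- s | r < t] = [::].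
Proof.
elim: s a => [|b s IHs] a ta //= /andP[ab bs].
have tb : t <= b by rewrite (le_trans ta)// ltW.
by rewrite ltNge tb/=; exact: IHs bs.
Qed.

Lemma stopped_after x t a s : t <= a -> path <%R a s -> cell_sum (stopped_sq x t) a s = 0.
Proof.
elim: s a => [|b s IHs] a ta /=; first by rewrite cell_sum_nil.
move=> /andP[ab bs]; have tb : t <= b by rewrite (le_trans ta)// ltW.
by rewrite cell_sum_cons IHs// /stopped_sq /sq_incr !min_r// subrr expr0n addr0.
Qed.

(** The sum of squares of the path stopped at t is its sum of squares over the
    partition of [a, t] that keeps the points before t; this is how the
    convergence of sums of squares up to time t is obtained from a partition of a
    longer interval. *)
Lemma cell_sum_stopped x t a s : a < t -> path <%R a s -> t <= last a s ->
  cell_sum (sq_incr x) a (itv_partitionL s t) = cell_sum (stopped_sq x t) a s.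
Proof.
elim: s a => [|b s IHs] a a_t /=; first by move=> _ /(lt_le_trans a_t); rewrite ltxx.
move=> /andP[ab bs] tl; rewrite /itv_partitionL/=; have [bt|tb] := ltP b t.
  rewrite rcons_cons !cell_sum_cons -/(itv_partitionL s t) IHs//.
  by rewrite /stopped_sq !min_l// ltW.
rewrite (filter_lt_nil tb)//= !cell_sum_cons cell_sum_nil (stopped_after _ tb)// !addr0.
by rewrite /stopped_sq (min_l (ltW a_t)) (min_r tb).
Qed.

Lemma itv_partitionL_lt t a s : a < t -> path <%R a s -> path <%R a (itv_partitionL s t).
Proof.
elim: s a => [|b s IHs] a a_t /=; first by rewrite a_t.
move=> /andP[ab bs]; rewrite /itv_partitionL/=; have [bt|tb] := ltP b t.
  by rewrite rcons_cons /= ab; exact: IHs.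
by rewrite (filter_lt_nil tb)//= a_t.
Qed.

Lemma itv_partitionL_gap e t a s : a < t -> path <%R a s -> t <= last a s ->
  path (gap_le e) a s -> path (gap_le e) a (itv_partitionL s t).
Proof.
elim: s a => [|b s IHs] a a_t /=; first by move=> _ /(lt_le_trans a_t); rewrite ltxx.
move=> /andP[ab bs] tl /andP[abe bse]; rewrite /itv_partitionL/=; have [bt|tb] := ltP b t.
  by rewrite rcons_cons /= abe; exact: IHs.
by rewrite (filter_lt_nil tb)//= andbT; apply: le_trans abe; rewrite lerB.
Qed.

(** What is lost when the cell ]a, b] contains t in its interior and the squared
    increment is attributed as a whole to the times after t. *)
Definition straddle x (t a b : R) : R :=
  if (a < t) && (t < b) then `|sq_incr x a t - sq_incr x a b| else 0.

Lemma straddle_ge0 x t a b : 0 <= straddle x t a b.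
Proof. by rewrite /straddle; case: ifP. Qed.

Lemma straddle_after x t a s : t <= a -> path <%R a s -> cell_sum (straddle x t) a s = 0.
Proof.
elim: s a => [|b s IHs] a ta /=; first by rewrite cell_sum_nil.
move=> /andP[ab bs]; have tb : t <= b by rewrite (le_trans ta)// ltW.
by rewrite cell_sum_cons IHs// /straddle ltNge ta/= addr0.
Qed.

(** At most one cell contains t in its interior. *)
Lemma straddle_sum_le x t a s e c : path <%R a s -> path (gap_le e) a s -> 0 <= c ->
  (forall u v, a <= u -> u < t -> t < v -> v <= t + e -> v <= last a s ->
    `|sq_incr x u t - sq_incr x u v| <= c) ->
  cell_sum (straddle x t) a s <= c.
Proof.
elim: s a => [|b s IHs] a /=; first by rewrite cell_sum_nil.
move=> /andP[ab bs] /andP[abe bse] c0 h; rewrite cell_sum_cons.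
have [bt|tb] := leP b t.
  rewrite {1}/straddle [t < b]ltNge bt andbF add0r; apply: IHs => // u v bu.
  by apply: h; exact: le_trans (ltW ab) bu.
rewrite (straddle_after _ (ltW tb))// addr0 /straddle tb andbT.
case: ifP => // a_t; apply: h => //; last exact: path_lt_last.
by move: abe; rewrite /gap_le; lra.
Qed.

Section Weighted.
Variables (T t : R) (m : nat).
Hypotheses (T0 : 0 < T) (t0 : 0 <= t).
Local Notation g := (weight T).
Local Notation tau := (grid 0 t m).
Let dlt : R := t / m.+1%:R.
Let tau0 k : 0 <= tau k. Proof. exact: grid_ge. Qed.
Let tauS k : tau k.+1 - tau k = dlt. Proof. by rewrite gridS subr0. Qed.
Let tau_le k : tau k <= tau k.+1. Proof. exact: grid_le. Qed.

(** If no coarse point lies inside ]a, b], the sum over k telescopes to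
    g(tau_k)^2 (x_b - x_a)^2, where tau_k is the last coarse point before a, and
    g(tau_k)^2 is close to g(a)^2.  [D] is the value that the stopped square would
    have in that case and [e] the correction at coarse points inside the
    cell. *)
Lemma coarse_cell x a b : 0 <= a -> a < b -> b <= t ->
  `|g a ^+ 2 * sq_incr x a b - \sum_(k < m.+1) g (tau k) ^+ 2 *
     (stopped_sq x (tau k.+1) a b - stopped_sq x (tau k) a b)| <=
  2 * T * dlt * sq_incr x a b + 2 * T ^+ 2 * \sum_(k < m.+2) straddle x (tau k) a b.
Proof.
move=> a0 ab bt; set y := sq_incr x a b; have y0 : 0 <= y by exact: sqr_ge0.
pose D k : R := if a < tau k then y else 0.
pose e k := stopped_sq x (tau k) a b - D k.
have e_le k : `|e k| <= straddle x (tau k) a b.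
  rewrite /e /D /straddle /stopped_sq; have [a_t|ta] := ltP a (tau k); last first.
    by rewrite min_r ?(le_trans ta (ltW ab))// /sq_incr subrr expr0n subr0 normr0.
  by case: ltP => _ /=; rewrite ?subrr ?normr0.
have D_incr k : 0 <= D k.+1 - D k.
  rewrite /D; have [h|h] := ltP a (tau k); first by rewrite (lt_le_trans h)// subrr.
  by rewrite subr0; case: ifP.
have D_dist k : `|(g a ^+ 2 - g (tau k) ^+ 2) * (D k.+1 - D k)| <= 2 * T * dlt * (D k.+1 - D k).
  rewrite normrM (ger0_norm (D_incr k)); move: (D_incr k); rewrite /D.
  have [h|h] := ltP a (tau k); first by rewrite (lt_le_trans h)// subrr !mulr0.
  case: ifP => [h2 q|_ _]; last by rewrite subrr !mulr0.
  apply: ler_wpM2r => //; apply: le_trans (wsq_lip T0 a0 (tau0 k)) _.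
  apply: ler_wpM2l; first by rewrite mulr_ge0// ltW.
  by rewrite ger0_norm ?subr_ge0// -(tauS k) lerB// ltW.
have D_sum : \sum_(k < m.+1) (D k.+1 - D k) = y.
  rewrite -(big_mkord xpredT (fun k => D k.+1 - D k)) telescope_sumr// /D.
  by rewrite gridn grid0 (lt_le_trans ab bt) ltNge a0 subr0.
have -> : g a ^+ 2 * y - \sum_(k < m.+1) g (tau k) ^+ 2 *
     (stopped_sq x (tau k.+1) a b - stopped_sq x (tau k) a b) =
  \sum_(k < m.+1) (g a ^+ 2 - g (tau k) ^+ 2) * (D k.+1 - D k) -
  \sum_(k < m.+1) g (tau k) ^+ 2 * (e k.+1 - e k).
  rewrite -D_sum mulr_sumr -!sumrB; apply: eq_bigr => k _; rewrite /e; ring.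
apply: le_trans (ler_normB _ _) _; apply: lerD.
  apply: le_trans (ler_norm_sum _ _ _) _; rewrite -D_sum mulr_sumr.
  by apply: ler_sum => k _; exact: D_dist.
apply: le_trans (ler_norm_sum _ _ _) _.
apply: (@le_trans _ _ (\sum_(k < m.+1) T ^+ 2 * (straddle x (tau k.+1) a b + straddle x (tau k) a b))).
  apply: ler_sum => k _; rewrite normrM; apply: ler_pM => //; first exact: wsq_bound.
  by apply: le_trans (ler_normB _ _) _; exact: lerD.
rewrite -mulr_sumr big_split/= -mulrA [leRHS]mulrCA ler_wpM2l ?sqr_ge0// mulrDl mul1r lerD//.
  by rewrite [leRHS]big_ord_recl lerDr; exact: straddle_ge0.
by rewrite [leRHS]big_ord_recr lerDl; exact: straddle_ge0.
Qed.

Lemma coarse_sum x s : itv_partition 0 t s ->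
  `|cell_sum (fun a b => g a ^+ 2 * sq_incr x a b) 0 s -
    \sum_(k < m.+1) g (tau k) ^+ 2 *
     (cell_sum (stopped_sq x (tau k.+1)) 0 s - cell_sum (stopped_sq x (tau k)) 0 s)| <=
  2 * T * dlt * cell_sum (sq_incr x) 0 s +
  2 * T ^+ 2 * \sum_(k < m.+2) cell_sum (straddle x (tau k)) 0 s.
Proof.
move=> [ps /eqP ls_].
have -> : cell_sum (fun a b => g a ^+ 2 * sq_incr x a b) 0 s -
    \sum_(k < m.+1) g (tau k) ^+ 2 *
     (cell_sum (stopped_sq x (tau k.+1)) 0 s - cell_sum (stopped_sq x (tau k)) 0 s) =
    cell_sum (fun a b => g a ^+ 2 * sq_incr x a b - \sum_(k < m.+1) g (tau k) ^+ 2 *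
     (stopped_sq x (tau k.+1) a b - stopped_sq x (tau k) a b)) 0 s.
  rewrite /cell_sum sumrB; congr (_ - _); rewrite exchange_big/=; apply: eq_bigr => k _.
  by rewrite -sumrB mulr_sumr.
have -> : 2 * T * dlt * cell_sum (sq_incr x) 0 s +
  2 * T ^+ 2 * \sum_(k < m.+2) cell_sum (straddle x (tau k)) 0 s =
  cell_sum (fun a b => 2 * T * dlt * sq_incr x a b +
     2 * T ^+ 2 * \sum_(k < m.+2) straddle x (tau k) a b) 0 s.
  rewrite /cell_sum big_split/= -!mulr_sumr; congr (_ + _ * _).
  by rewrite exchange_big.
apply: le_trans (cell_sum_norm _ _ _) _; apply: cell_sum_le => // u v u0 uv.
by rewrite ls_; exact: coarse_cell.
Qed.

Lemma coarse_wint (Q : cumulative R R) :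
  `|wint T Q t - \sum_(k < m.+1) g (tau k) ^+ 2 * (Q (tau k.+1) - Q (tau k))| <=
  2 * T * dlt * (Q t - Q 0).
Proof.
have := @ls_riemann _ Q (fun r => g r ^+ 2) tau (fun k => g (tau k) ^+ 2) m.+1 (2 * T * dlt)
  (wsq_meas T).
rewrite grid0 gridn; apply.
- by exists (T ^+ 2) => v v0 _; apply: wsq_bound => //; exact: ltW.
- exact: grid_le.
- by rewrite !mulr_ge0// ?ltW// /dlt divr_ge0.
- move=> i r _ ir ri; have r0 : 0 <= r by rewrite (le_trans (tau0 i))// ltW.
  apply: le_trans (wsq_lip T0 r0 (tau0 i)) _; apply: ler_wpM2l; first by rewrite mulr_ge0// ltW.
  by rewrite ger0_norm ?subr_ge0 ?(ltW ir)// -(tauS i) lerB.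
Qed.

End Weighted.
End PartitionSums.

Section NullSequences.
Context {d : measure_display} {Omega : measurableType d} {R : realType}.
Variable P : probability Omega R.
Implicit Types Z : nat -> Omega -> R.

Definition null_seq Z := (forall n, measurable_fun setT (Z n)) /\
  (prob_norm P (Z n) @[n --> \oo] --> (0 : R)).

Lemma null_seq_dom Z Z1 c : 1 <= c -> (forall n, measurable_fun setT (Z n)) ->
  null_seq Z1 -> (forall n w, `|Z n w| <= c * `|Z1 n w|) -> null_seq Z.
Proof.
move=> c1 mZ [m1 h1] h; split => //.
apply: (@squeeze_cvgr _ _ _ _ (fun=> 0) (fun n => c * prob_norm P (Z1 n))).
- by apply: nearW => n; rewrite prob_norm_ge0 prob_norm_le_scale.
- exact: cvg_cst.
- by rewrite -[X in _ --> X](mulr0 c); apply: cvgMr.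
Qed.

Lemma null_seqD Z1 Z2 : null_seq Z1 -> null_seq Z2 ->
  null_seq (fun n w => Z1 n w + Z2 n w).
Proof.
move=> [m1 h1] [m2 h2].
have mD n : measurable_fun setT (fun w => Z1 n w + Z2 n w) by exact: measurable_funD.
split => //.
apply: (@squeeze_cvgr _ _ _ _ (fun=> 0) (fun n => prob_norm P (Z1 n) + prob_norm P (Z2 n))).
- apply: nearW => n; rewrite prob_norm_ge0 prob_norm_leD// => w; exact: ler_normD.
- exact: cvg_cst.
- by rewrite -[X in _ --> X](addr0 0); apply: cvgD.
Qed.

Lemma null_seqZ c Z : null_seq Z -> null_seq (fun n w => c * Z n w).
Proof.
move=> nZ; apply: (@null_seq_dom _ Z (Num.max 1 `|c|)) => //.
- by rewrite le_max lexx.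
- by move=> n; apply: measurable_funM; [exact: measurable_cst|exact: nZ.1].
- by move=> n w; rewrite normrM ler_wpM2r// le_max lexx orbT.
Qed.

Lemma null_seq_norm Z : null_seq Z -> null_seq (fun n w => `|Z n w|).
Proof.
move=> nZ; apply: (@null_seq_dom _ Z 1) => //.
- by move=> n; apply: measurableT_comp => //; exact: nZ.1.
- by move=> n w; rewrite normr_id mul1r.
Qed.

Lemma null_seq_cvg0 Z : (forall n, measurable_fun setT (Z n)) ->
  (forall w, Z n w @[n --> \oo] --> (0 : R)) -> null_seq Z.
Proof.
move=> mZ h; split => //; have := prob_norm_cvg P mZ h.
by under eq_fun do under [X in prob_norm _ X]eq_fun do rewrite subr0.
Qed.

Lemma null_seq_sum k (Z : nat -> nat -> Omega -> R) : (forall i, (i < k)%N -> null_seq (Z i)) ->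
  null_seq (fun n w => \sum_(i < k) Z i n w).
Proof.
elim: k => [_|k IHk hZ].
  apply: null_seq_cvg0 => [n|w]; last by under eq_fun do rewrite big_ord0; exact: cvg_cst.
  by under eq_fun do rewrite big_ord0; exact: measurable_cst.
rewrite (_ : (fun n w => _) = fun n w => \sum_(i < k) Z i n w + Z k n w); last first.
  by apply/funext => n; apply/funext => w; rewrite big_ord_recr.
by apply: null_seqD; [apply: IHk => i ik; apply: hZ; exact: ltnW|exact: hZ].
Qed.

Lemma cvg_in_probability_null S L : (forall n, measurable_fun setT (S n)) ->
  measurable_fun setT L ->
  cvg_in_probability P S L <-> null_seq (fun n w => S n w - L w).
Proof.
move=> mS mL; split=> [/(cvg_in_probabilityP P mS mL) h|[_ h]].
  by split => // n; exact: measurable_funB.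
exact/(cvg_in_probabilityP P mS mL).
Qed.

(** The first term of the bound tends to 0 as m grows, because Y is finite; then,
    for that m, the second one tends to 0 as n grows. *)
Lemma null_seq_approx Z (Y : Omega -> R) c : measurable_fun setT Y ->
  (forall n, measurable_fun setT (Z n)) ->
  (forall m, exists2 Z1, null_seq Z1 &
    forall n w, `|Z n w| <= `|m.+1%:R^-1 * (c * Y w)| + `|Z1 n w|) -> null_seq Z.
Proof.
move=> mY mZ h; split => //; apply/seq_cvgP => e e0.
have e2 : 0 < e / 2 by rewrite divr_gt0.
have mc m : measurable_fun setT (fun w => m.+1%:R^-1 * (c * Y w)).
  by apply: measurable_funM; [exact: measurable_cst|apply: measurable_funM => //; exact: measurable_cst].
have [||_ /seq_cvgP/(_ _ e2)[m hm]] := @null_seq_cvg0 (fun m w => m.+1%:R^-1 * (c * Y w)).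
- exact: mc.
- move=> w; rewrite -[X in _ --> X](mul0r (c * Y w)); apply: cvgMl.
  apply/seq_cvgP => r r0; have [N hN] := inv_small r0; exists N => n /hN.
  by rewrite subr0 ger0_norm.
have [Z1 [m1 /seq_cvgP/(_ _ e2)[N hN]] hZ] := h m; exists N => n Nn.
rewrite subr0 ger0_norm ?prob_norm_ge0//.
apply: le_lt_trans (prob_norm_leD P (mZ n) (mc m) (m1 n) (hZ n)) _.
have := hm m (leqnn m); have := hN n Nn.
rewrite !subr0 ger0_norm ?prob_norm_ge0// => a.
by rewrite ger0_norm ?prob_norm_ge0// => b; rewrite [ltRHS](splitr e) ltrD.
Qed.

End NullSequences.

(** * Quadratic variation *)

Section QuadraticVariation.
Context {d : measure_display} {Omega : measurableType d} {R : realType}.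
Variable P : probability Omega R.
Variable F : R -> set (set Omega).
Hypothesis Fsig : forall t, 0 <= t -> sigma_algebra setT (F t) /\ F t `<=` measurable.
Hypothesis Fmon : forall s t, 0 <= s -> s <= t -> F s `<=` F t.
Local Notation E := (Ex P).

Lemma node_ge0 (a : R) s i : 0 <= a -> path <%R a s -> 0 <= nth 0 (a :: s) i.
Proof.
elim: s a i => [|b s IHs] a [|i] a0 //=; first by rewrite nth_nil.
by move=> /andP[ab bs]; apply: IHs => //; rewrite (le_trans a0)// ltW.
Qed.

Lemma cell_sum_measurable (f : Omega -> R -> R -> R) s : path <%R 0 s ->
  (forall u v, 0 <= u -> 0 <= v -> measurable_fun setT (fun w => f w u v)) ->
  measurable_fun setT (fun w => cell_sum (f w) 0 s).
Proof.
move=> ps h; apply: measurable_sum => i.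
by apply: h; [exact: node_ge0|exact: (@node_ge0 0 s i.+1)].
Qed.

Lemma adapted_meas Y t : adapted F Y -> 0 <= t -> measurable_fun setT (Y t).
Proof. by move=> aY t0; apply: (Fmeas_fun Fsig t0); exact: aY. Qed.

Lemma sq_incr_measurable Y u v : adapted F Y -> 0 <= u -> 0 <= v ->
  measurable_fun setT (fun w => sq_incr (Y ^~ w) u v).
Proof.
by move=> aY u0 v0; apply: measurable_funX; apply: measurable_funB; exact: adapted_meas.
Qed.

Lemma sum_squares_measurable Y s : adapted F Y -> path <%R 0 s ->
  measurable_fun setT (sum_squares Y s).
Proof.
move=> aY ps; apply: (@cell_sum_measurable (fun w => sq_incr (Y ^~ w))) => // u v u0 v0.
exact: sq_incr_measurable.
Qed.

Lemma grid_partition t : 0 < t -> exists pi : nat -> seq R,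
  (forall n, itv_partition 0 t (pi n)) /\ (mesh (pi n) @[n --> \oo] --> (0 : R)).
Proof.
move=> t0; pose pi n := mkseq (fun i => grid 0 t n i.+1) n.+1.
have sz n : size (pi n) = n.+1 by rewrite size_mkseq.
have ptE n i : (i <= n.+1)%N -> nth 0 (0 :: pi n) i = grid 0 t n i.
  case: i => [|i] il; first by rewrite grid0.
  by rewrite /= nth_mkseq.
have nthE n i : (i < n.+1)%N -> nth 0 (pi n) i = grid 0 t n i.+1 by move=> il; rewrite nth_mkseq.
exists pi; split=> [n|].
  split; last by rewrite -nth_last sz/= -/(pi n) (set_nth_default 0) ?sz// nthE// gridn.
  apply/(pathP 0) => i; rewrite sz => il.
  by rewrite ptE ?nthE ?(ltnW il)// -subr_gt0 gridS subr0 divr_gt0.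
apply/seq_cvgP => e e0; have [N hN] := inv_small (divr_gt0 e0 t0).
exists N => n /hN h; rewrite subr0 ger0_norm ?mesh_ge0//.
apply: (@le_lt_trans _ _ (t / n.+1%:R)); last by rewrite mulrC -ltr_pdivlMr.
apply/mesh_leP; first by rewrite divr_ge0// ltW.
apply/(pathP 0) => i; rewrite sz => il.
by rewrite ptE ?nthE ?(ltnW il)// /gap_le gridS subr0.
Qed.

(** Along uniform partitions of [0, t] both candidates are limits in probability
    of the same sums of squares. *)
Lemma quadratic_variation_unique Y (Q1 Q2 : Omega -> cumulative R R) : adapted F Y ->
  is_quadratic_variation P F Y Q1 -> is_quadratic_variation P F Y Q2 ->
  {ae P, forall w, forall t, 0 <= t -> Q1 w t = Q2 w t}.
Proof.
move=> aY [a1 z1 h1] [a2 z2 h2].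
apply: (@indistinguishable _ _ _ _ (fun t w => Q1 w t) (fun t w => Q2 w t)).
- by move=> w t _; exact: cumulative_is_right_continuous.
- by move=> w t _; exact: cumulative_is_right_continuous.
move=> t; rewrite le_eqVlt => /predU1P[<-|t0]; first by apply: nearW => w; rewrite z1 z2.
have [pi [hpi hm]] := grid_partition t0; have t0' := ltW t0.
apply: (@cvg_in_probability_unique _ _ _ _ (fun n => sum_squares Y (pi n))).
- by move=> n; apply: sum_squares_measurable => //; have [] := hpi n.
- exact: (adapted_meas a1).
- exact: (adapted_meas a2).
- exact: h1.
- exact: h2.
Qed.

Section Averaged.
Variables (X : R -> Omega -> R) (T : R).
Hypothesis smX : sqmart P F X.
Hypothesis cX : forall w, cadlag_path (X ^~ w).
Hypothesis T0 : 0 < T.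
Local Notation g := (weight T).
Local Notation avg := (avg X T).
Variable Q : Omega -> cumulative R R.
Hypothesis hQ : is_quadratic_variation P F X Q.

Let aX : adapted F X. Proof. by case: smX. Qed.
Let aQ : adapted F (fun t w => Q w t). Proof. by case: hQ. Qed.
Let Q0 w : Q w 0 = 0. Proof. by case: hQ. Qed.
Let Qc t (pi : nat -> seq R) : 0 <= t -> (forall n, itv_partition 0 t (pi n)) ->
  mesh (pi n) @[n --> \oo] --> (0 : R) ->
  cvg_in_probability P (fun n => sum_squares X (pi n)) (fun w => Q w t).
Proof. by case: hQ => _ _; exact. Qed.

Section FixedTime.
Variables (t : R) (pi : nat -> seq R).
Hypothesis t0 : 0 <= t.
Hypothesis hpi : forall n, itv_partition 0 t (pi n).
Hypothesis hm : mesh (pi n) @[n --> \oo] --> (0 : R).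

Let pi_lt n : path <%R 0 (pi n). Proof. by have [] := hpi n. Qed.
Let pi_last n : last 0 (pi n) = t. Proof. by have [_ /eqP] := hpi n. Qed.
Let pi_gap n : path (gap_le (mesh (pi n))) 0 (pi n).
Proof. exact/(mesh_leP _ (mesh_ge0 _)). Qed.

Let S tau n w := cell_sum (stopped_sq (X ^~ w) tau) 0 (pi n).
Let V n w := cell_sum (fun a b => g a ^+ 2 * sq_incr (X ^~ w) a b) 0 (pi n).

Let S_meas tau n : 0 <= tau -> measurable_fun setT (S tau n).
Proof.
move=> tau0; apply: (@cell_sum_measurable (fun w => stopped_sq (X ^~ w) tau)) => // u v u0 v0.
by apply: (sq_incr_measurable aX); rewrite le_min tau0 andbT.
Qed.

Let V_meas n : measurable_fun setT (V n).
Proof.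
apply: (@cell_sum_measurable (fun w a b => g a ^+ 2 * sq_incr (X ^~ w) a b)) => // u v u0 v0.
apply: measurable_funM; first exact: measurable_cst.
exact: (sq_incr_measurable aX).
Qed.

Let S_null tau : 0 <= tau -> tau <= t -> null_seq P (fun n w => S tau n w - Q w tau).
Proof.
move=> tau0 taut; apply/cvg_in_probability_null; [by move=> n; exact: S_meas|exact: (adapted_meas aQ)|].
move: tau0; rewrite le_eqVlt => /predU1P[e|tau0].
  apply/cvg_in_probability_null; [by move=> n; apply: S_meas; rewrite -e|by apply: (adapted_meas aQ); rewrite -e|].
  apply: null_seq_cvg0 => [n|w].
    by apply: measurable_funB; [apply: S_meas; rewrite -e|apply: (adapted_meas aQ); rewrite -e].
  rewrite -e Q0; under eq_fun do rewrite subr0 /S stopped_after//.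
  exact: cvg_cst.
have hL n : itv_partition 0 tau (itv_partitionL (pi n) tau).
  split; first exact: itv_partitionL_lt.
  by rewrite /itv_partitionL last_rcons.
have -> : S tau = fun n => sum_squares X (itv_partitionL (pi n) tau).
  apply/funext => n; apply/funext => w.
  by rewrite -[RHS]/(cell_sum (sq_incr (X ^~ w)) 0 _) cell_sum_stopped// pi_last.
apply: Qc => //; first exact: ltW.
apply: (@squeeze_cvgr _ _ _ _ (fun=> 0) (fun n => mesh (pi n))) => //; last exact: cvg_cst.
apply: nearW => n; rewrite mesh_ge0; apply/mesh_leP; first exact: mesh_ge0.
by apply: itv_partitionL_gap => //; rewrite pi_last.
Qed.

Let straddle_null tau : 0 <= tau -> tau <= t ->
  null_seq P (fun n w => cell_sum (straddle (X ^~ w) tau) 0 (pi n)).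
Proof.
move=> tau0 taut; apply: null_seq_cvg0 => [n|w].
  apply: (@cell_sum_measurable (fun w => straddle (X ^~ w) tau)) => // u v u0 v0.
  rewrite /straddle; case: ((u < tau) && (tau < v)); last exact: measurable_cst.
  by apply: measurableT_comp => //; apply: measurable_funB; exact: (sq_incr_measurable aX).
have [K0 hK0] := cadlag_path_bounded t (cX w).
pose K := Num.max K0 1; have K1 : 1 <= K by rewrite le_max lexx orbT.
have hK u : 0 <= u -> u <= t -> `|X u w| <= K.
  by move=> u0 ut; rewrite le_max hK0.
have K0' : 0 < K by lra.
have K4 : 4 * K != 0 by rewrite gt_eqF// mulr_gt0.
apply/seq_cvgP => e e0.
have e4 : 0 < e / 2 / (4 * K) by rewrite divr_gt0 ?mulr_gt0 ?divr_gt0.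
have [dl dl0 hdl] := (right_cvgP _ _ _).1 ((cX w).1 tau tau0) _ e4.
have [N hN] := (seq_cvgP _ _).1 hm dl dl0; exists N => n /hN.
rewrite subr0 ger0_norm ?mesh_ge0// => md.
rewrite subr0 ger0_norm; last by apply: sumr_ge0 => i _; exact: straddle_ge0.
apply: (@le_lt_trans _ _ (e / 2)); last by lra.
apply: (straddle_sum_le (pi_lt n) (pi_gap n)); first by rewrite ltW// divr_gt0.
move=> u v u0 ut tv vm; rewrite pi_last => vt.
have -> : sq_incr (X ^~ w) u tau - sq_incr (X ^~ w) u v =
    - ((X v w - X tau w) * (X tau w + X v w - 2 * X u w)).
  by rewrite /sq_incr; ring.
rewrite normrN normrM -[leRHS](divfK K4).
apply: ler_pM => //.
  by apply/ltW/hdl => //; apply: le_lt_trans vm _; rewrite ltrD2l.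
have hu := hK _ u0 (le_trans (ltW ut) taut).
have ht := hK _ tau0 taut.
have hv := hK _ (le_trans tau0 (ltW tv)) vt.
apply: le_trans (ler_normB _ _) _; rewrite normrM (ger0_norm (ler0n R 2)).
by have := ler_normD (X tau w) (X v w); lra.
Qed.

Let V_null : null_seq P (fun n w => V n w - wint T (Q w) t).
Proof.
have mQ s : 0 <= s -> measurable_fun setT (fun w => Q w s) by exact: (adapted_meas aQ).
have mW : measurable_fun setT (fun w => wint T (Q w) t).
  exact: (adapted_meas (wint_adapted Fsig Fmon T0 aQ)).
have UQ : null_seq P (fun n w => sum_squares X (pi n) w - Q w t).
  apply/cvg_in_probability_null; [|exact: mQ|exact: Qc].
  by move=> n; apply: (sum_squares_measurable aX).
apply: (@null_seq_approx _ _ _ _ _ (fun w => Q w t) (4 * T * t)); [exact: mQ| |move=> m].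
  by move=> n; apply: measurable_funB.
pose tau := grid 0 t m.
have tau0 k : 0 <= tau k by exact: grid_ge.
have taut k : (k < m.+2)%N -> tau k <= t by move=> km; exact: grid_leb.
exists (fun n w => 2 * T * (t / m.+1%:R) * `|sum_squares X (pi n) w - Q w t| +
   (2 * T ^+ 2 * \sum_(k < m.+2) cell_sum (straddle (X ^~ w) (tau k)) 0 (pi n) +
   T ^+ 2 * \sum_(k < m.+1) (`|S (tau k.+1) n w - Q w (tau k.+1)| + `|S (tau k) n w - Q w (tau k)|))).
  apply: null_seqD; first by apply: null_seqZ; exact: null_seq_norm.
  apply: null_seqD; apply: null_seqZ.
    apply: (null_seq_sum (Z := fun k n w => cell_sum (straddle (X ^~ w) (tau k)) 0 (pi n))) => k km.
    by apply: straddle_null; [exact: tau0|exact: taut].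
  apply: (null_seq_sum (Z := fun k n w => `|S (tau k.+1) n w - Q w (tau k.+1)| +
     `|S (tau k) n w - Q w (tau k)|)) => k km.
  by apply: null_seqD; apply: null_seq_norm; apply: S_null => //; apply: taut => //; exact: ltnW.
move=> n w.
have h1 := coarse_sum m T0 t0 (X ^~ w) (hpi n).
have h3 := coarse_wint m T0 t0 (Q w).
rewrite -/tau -/(V n w) in h1 h3.
set C := \sum_(k < m.+1) _ in h1.
set CQ := \sum_(k < m.+1) _ in h3.
set A1 := \sum_(k < m.+2) _ in h1 *.
set A2 := \sum_(k < m.+1) (`|_| + `|_|).
have h2 : `|C - CQ| <= T ^+ 2 * A2.
  rewrite /C /CQ /A2 -sumrB mulr_sumr; apply: le_trans (ler_norm_sum _ _ _) _.
  apply: ler_sum => k _; rewrite -mulrBr normrM; apply: ler_pM => //; first exact: wsq_bound.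
  apply: le_trans (ler_normB _ _); rewrite /S le_eqVlt; apply/orP; left; apply/eqP.
  by congr (`| _ |); ring.
have A10 : 0 <= A1.
  by apply: sumr_ge0 => k _; apply: sumr_ge0 => i _; exact: straddle_ge0.
have A20 : 0 <= A2 by apply: sumr_ge0 => k _; exact: addr_ge0.
have dl0 : 0 <= 2 * T * (t / m.+1%:R) by rewrite !mulr_ge0// ?invr_ge0// ltW.
have Qt0 : 0 <= Q w t by rewrite -(Q0 w) cumulative_le.
rewrite Q0 subr0 in h3.
have h4 : cell_sum (sq_incr (X ^~ w)) 0 (pi n) <= Q w t + `|sum_squares X (pi n) w - Q w t|.
  rewrite -[leLHS](subrK (Q w t)) addrC lerD2l; exact: ler_norm.
have h5 := le_trans h1 (lerD (ler_wpM2l dl0 h4) (lexx _)).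
have -> : `|m.+1%:R^-1 * (4 * T * t * Q w t)| = 2 * (2 * T * (t / m.+1%:R) * Q w t).
  rewrite ger0_norm; first by ring.
  by rewrite !mulr_ge0// ?invr_ge0// ltW.
rewrite [X in _ <= _ + X]ger0_norm; last first.
  have TT := sqr_ge0 T; apply: addr_ge0; first exact: mulr_ge0.
  by apply: addr_ge0; apply: mulr_ge0 => //; exact: mulr_ge0.
have -> : V n w - wint T (Q w) t = (V n w - C) + (C - CQ) - (wint T (Q w) t - CQ) by ring.
apply: le_trans (ler_normB _ _) _; have := ler_normD (V n w - C) (C - CQ).
rewrite mulrDr in h5; set q := 2 * T * _ in h3 h5 *.
by move: h2 h3 h5; set a := _ * A1; set b := _ * A2; lra.
Qed.

Let C := E (fun w => (X t w - X 0 w) ^+ 2).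

(** With p = g_a dX and dN = p - r, Young's inequality gives
    |dN^2 - p^2| <= eta p^2 + (1 + 1/eta) r^2, and E r^2 <= eta^2 E dX^2. *)
Let cell_error a b eta : 0 <= a -> a < b -> b - a <= eta -> 0 < eta -> eta <= 1 ->
  Int P (fun w => `|sq_incr (avg ^~ w) a b - g a ^+ 2 * sq_incr (X ^~ w) a b|) /\
  E (fun w => `|sq_incr (avg ^~ w) a b - g a ^+ 2 * sq_incr (X ^~ w) a b|) <=
  eta * (T ^+ 2 + 2) * E (fun w => sq_incr (X ^~ w) a b).
Proof.
move=> a0 ab abe eta0 eta1; have b0 : 0 <= b by rewrite (le_trans a0)// ltW.
have smN := avg_sqmart Fsig Fmon smX cX T0.
have iX : Int P (fun w => sq_incr (X ^~ w) a b) by have [] := sqmart_L2B smX a0 b0.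
have iN : Int P (fun w => sq_incr (avg ^~ w) a b) by have [] := sqmart_L2B smN a0 b0.
have [_ [mr ri] rle] := arem_bound Fsig Fmon T smX cX a0 (ltW ab).
have iD : Int P (fun w => `|sq_incr (avg ^~ w) a b - g a ^+ 2 * sq_incr (X ^~ w) a b|).
  by apply: Int_norm; apply: IntB => //; exact: IntZ.
split => //.
apply: (@le_trans _ _ (E (fun w => eta * T ^+ 2 * sq_incr (X ^~ w) a b +
    (eta^-1 + 1) * arem X T a b w ^+ 2))).
  apply: Ex_le => //; first by apply: IntD; exact: IntZ.
  move=> w; rewrite /sq_incr avgB//; last exact: ltW.
  set x := X b w - X a w; set r := arem X T a b w.
  have hp : (g a * x) ^+ 2 <= T ^+ 2 * x ^+ 2.
    rewrite exprMn ler_wpM2r ?sqr_ge0//; apply: le_trans (wsq_bound T0 a0).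
    exact: ler_norm.
  rewrite -exprMn; set p := g a * x in hp *.
  have h1 : eta * p ^+ 2 + eta^-1 * r ^+ 2 + 2 * p * r = eta^-1 * (eta * p + r) ^+ 2.
    by field; rewrite gt_eqF.
  have h2 : eta * p ^+ 2 + eta^-1 * r ^+ 2 - 2 * p * r = eta^-1 * (eta * p - r) ^+ 2.
    by field; rewrite gt_eqF.
  have ei : 0 <= eta^-1 by rewrite invr_ge0 ltW.
  have h3 : 0 <= eta^-1 * (eta * p + r) ^+ 2 by rewrite mulr_ge0 ?sqr_ge0.
  have h4 : 0 <= eta^-1 * (eta * p - r) ^+ 2 by rewrite mulr_ge0 ?sqr_ge0.
  have h5 : eta * p ^+ 2 <= eta * T ^+ 2 * x ^+ 2 by rewrite -mulrA ler_wpM2l// ltW.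
  have -> : (p - r) ^+ 2 - p ^+ 2 = r ^+ 2 - 2 * p * r by ring.
  rewrite -h1 in h3; rewrite -h2 in h4; rewrite mulrDl mul1r.
  by have := sqr_ge0 r; rewrite ler_norml; lra.
rewrite ExD ?ExZ//; try exact: IntZ.
set Z := E (fun w => sq_incr (X ^~ w) a b) in rle *.
have Z0 : 0 <= Z by apply: Ex_ge0 => w; exact: sqr_ge0.
have ba0 : 0 <= b - a by rewrite subr_ge0 ltW.
have rle' : E (fun w => arem X T a b w ^+ 2) <= eta ^+ 2 * Z.
  by apply: le_trans rle _; rewrite ler_wpM2r// lerXn2r ?nnegrE// ltW.
have ei : 0 <= eta^-1 + 1 by rewrite addr_ge0// invr_ge0 ltW.
apply: le_trans (lerD (lexx _) (ler_wpM2l ei rle')) _.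
have -> : (eta^-1 + 1) * (eta ^+ 2 * Z) = (1 + eta) * (eta * Z).
  by field; rewrite gt_eqF.
have eZ : 0 <= eta * Z by rewrite mulr_ge0// ltW.
have : (1 + eta) * (eta * Z) <= 2 * (eta * Z) by rewrite ler_wpM2r//; lra.
by lra.
Qed.

Let avg_squares_null : null_seq P (fun n w => sum_squares avg (pi n) w - V n w).
Proof.
have aN : adapted F avg by case: (avg_sqmart Fsig Fmon smX cX T0).
have mN n : measurable_fun setT (sum_squares avg (pi n)) by exact: (sum_squares_measurable aN).
have mD n : measurable_fun setT (fun w => sum_squares avg (pi n) w - V n w).
  exact: measurable_funB.
split => //.
have C0 : 0 <= C by apply: Ex_ge0 => w; exact: sqr_ge0.
apply/seq_cvgP => e e0; have D0 : 0 < (T ^+ 2 + 2) * C + 1.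
  by rewrite ltr_wpDl// mulr_ge0// addr_ge0// sqr_ge0.
(* mesh and weight eta in Young's inequality are taken equal *)
pose eta := Num.min 1 (e / ((T ^+ 2 + 2) * C + 1)).
have eta0 : 0 < eta by rewrite lt_min ltr01 divr_gt0.
have eta1 : eta <= 1 by rewrite ge_min lexx.
have [N hN] := (seq_cvgP _ _).1 hm eta eta0; exists N => n /hN.
rewrite subr0 ger0_norm ?mesh_ge0// => /ltW md.
rewrite subr0 ger0_norm ?prob_norm_ge0//.
pose p i := nth t (0 :: pi n) i.
have pE i : (i <= size (pi n))%N -> nth 0 (0 :: pi n) i = p i.
  by move=> il; rewrite /p (set_nth_default 0).
have pgap := (pathP 0 (pi_gap n)); have plt := (pathP 0 (pi_lt n)).
have pE' i : (i < size (pi n))%N -> nth 0 (pi n) i = p i.+1.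
  by move=> il; rewrite -(pE i.+1).
have p_size i : (size (pi n) <= i)%N -> p i = t.
  rewrite leq_eqVlt => /predU1P[<-|h]; last by rewrite /p nth_default.
  exact: (itv_partition_nth_size t (hpi n)).
have pm : {homo p : i j / (i <= j)%N >-> i <= j}.
  apply: homo_leq => // [|i]; first exact: le_trans.
  have [il|li] := ltnP i (size (pi n)); last by rewrite !p_size// leqW.
  by rewrite -pE' // -pE ?(ltnW il)// ltW// plt.
pose phi i w := `|sq_incr (avg ^~ w) (p i) (p i.+1) - g (p i) ^+ 2 * sq_incr (X ^~ w) (p i) (p i.+1)|.
have ce i : (i < size (pi n))%N -> Int P (phi i) /\
    E (phi i) <= eta * (T ^+ 2 + 2) * E (fun w => (X (p i.+1) w - X (p i) w) ^+ 2).
  move=> il; apply: cell_error => //; first exact: (pm 0%N).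
  - by rewrite -pE' // -pE ?(ltnW il)// plt.
  - apply: le_trans md; rewrite -pE' // -pE ?(ltnW il)//; exact: pgap.
have dE w : `|sum_squares avg (pi n) w - V n w| <= \sum_(i < size (pi n)) phi i w.
  have -> : sum_squares avg (pi n) w - V n w = \sum_(i < size (pi n))
     (sq_incr (avg ^~ w) (p i) (p i.+1) - g (p i) ^+ 2 * sq_incr (X ^~ w) (p i) (p i.+1)).
    rewrite -sumrB; apply: eq_bigr => i _.
    by rewrite /part_pt /sq_incr !pE// ltnW.
  exact: ler_norm_sum.
have iphi : Int P (fun w => \sum_(i < size (pi n)) phi i w).
  by apply: (@Int_sum _ _ _ _ _ phi) => i il; have [] := ce i il.
have iD : Int P (fun w => sum_squares avg (pi n) w - V n w) by exact: Int_dom iphi dE.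
apply: le_lt_trans (prob_norm_le_Ex iD) _.
apply: (@le_lt_trans _ _ (eta * (T ^+ 2 + 2) * C)).
  apply: le_trans (Ex_le (Int_norm iD) iphi dE) _.
  rewrite (@Ex_sum _ _ _ _ _ phi); last by move=> i il; have [] := ce i il.
  have -> : C = \sum_(i < size (pi n)) E (fun w => (X (p i.+1) w - X (p i) w) ^+ 2).
    by rewrite (sqmart_pythagoras Fsig Fmon smX)// (p_size (size (pi n))).
  rewrite mulr_sumr; apply: ler_sum => i _; exact: (ce i (ltn_ord i)).2.
apply: (@lt_le_trans _ _ (eta * ((T ^+ 2 + 2) * C + 1))).
  by rewrite -mulrA ltr_pM2l// ltrDl.
by rewrite -ler_pdivlMr// ge_min lexx orbT.
Qed.

(** Two approximations: the sums of squares of N are close to the g^2-weighted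
    sums of squares of X, and these are close to the Stieltjes integral. *)
Lemma averaged_sum_squares M : adapted F M ->
  (forall s, 0 <= s -> {ae P, forall w, M s w = avg s w}) ->
  cvg_in_probability P (fun n => sum_squares M (pi n)) (fun w => wint T (Q w) t).
Proof.
move=> aM MN; have aN : adapted F avg by case: (avg_sqmart Fsig Fmon smX cX T0).
have mW : measurable_fun setT (fun w => wint T (Q w) t).
  exact: (adapted_meas (wint_adapted Fsig Fmon T0 aQ)).
have mS Y n : adapted F Y -> measurable_fun setT (sum_squares Y (pi n)).
  by move=> aY; exact: (sum_squares_measurable aY).
apply/cvg_in_probabilityP => //; first by move=> n; exact: mS.
have [_] := null_seqD avg_squares_null V_null.
have eqn n : prob_norm P (fun w => sum_squares avg (pi n) w - V n w + (V n w - wint T (Q w) t)) =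
    prob_norm P (fun w => sum_squares M (pi n) w - wint T (Q w) t); last first.
  by under eq_fun do rewrite eqn.
apply: prob_norm_ae.
- by apply: measurable_funD; apply: measurable_funB => //; exact: mS.
- by apply: measurable_funB => //; exact: mS.
have : {ae P, forall w, forall i, M (part_pt (pi n) i) w = avg (part_pt (pi n) i) w}.
  by apply: ae_foralln => i; apply: MN; exact: node_ge0.
apply: filterS => w h; rewrite addrA subrK; congr (_ - _).
by apply: eq_bigr => i _; rewrite !h.
Qed.

End FixedTime.
Lemma averaged_quadratic_variation M : adapted F M ->
  (forall s, 0 <= s -> {ae P, forall w, M s w = avg s w}) ->
  is_quadratic_variation P F M (fun w => wint_cumulative T0 (Q w)).
Proof.
move=> aM MN; split.
- exact: (wint_adapted Fsig Fmon T0 aQ).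
- by move=> w; exact: wint_nonpos.
- by move=> t pi t0 hpi hm; exact: averaged_sum_squares.
Qed.

End Averaged.

End QuadraticVariation.

(** * The four identities *)

Section Assembly.
Context {d : measure_display} {Omega : measurableType d} {R : realType}.
Variable P : probability Omega R.
Variable F : R -> set (set Omega).
Hypothesis Fsig : forall t, 0 <= t -> sigma_algebra setT (F t) /\ F t `<=` measurable.
Hypothesis Fmon : forall s t, 0 <= s -> s <= t -> F s `<=` F t.

(** Means on events do not see null sets. *)
Lemma sqmart_version N M : sqmart P F N -> adapted F M ->
  (forall t, 0 <= t -> {ae P, forall w, M t w = N t w}) -> sqmart P F M.
Proof.
move=> smN aM MN; have mM t (t0 : 0 <= t) := Fmeas_fun Fsig t0 (aM t t0).
have mN t (t0 : 0 <= t) : measurable_fun setT (N t) by have [] := sqmart_L2 smN t0.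
split=> // [t t0|s t s0 st B FB].
  split; first exact: mM.
  apply: (Int_ae _ (sqmart_L2 smN t0).2); first by apply: measurable_funX; exact: mM.
  by apply: filterS (MN t t0) => w ->.
have t0 := le_trans s0 st; have mB := (Fsig s0).2 B FB.
have [_ _ /(_ s t s0 st B FB) <-] := smN.
apply: ae_eq_integral => //.
- by apply/measurable_EFinP; apply: measurable_funTS; apply: measurable_funB; exact: mM.
- by apply/measurable_EFinP; apply: measurable_funTS; apply: measurable_funB; exact: mN.
- by apply: filterS2 (MN t t0) (MN s s0) => w -> -> _.
Qed.

(** Both brackets have the conditional increments of Y^2, by [bracket_incr]. *)
Lemma predictable_quadratic_variation_unique Y (A B : Omega -> cumulative R R) :
  sqmart P F Y -> is_predictable_quadratic_variation P F Y A ->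
  is_predictable_quadratic_variation P F Y B ->
  {ae P, forall w, forall t, 0 <= t -> A w t = B w t}.
Proof.
move=> smY [pA A0 mA] [pB B0 mB].
have iA t : 0 <= t -> Int P (fun w => A w t) by exact: (bracket_Int smY mA).
have iB t : 0 <= t -> Int P (fun w => B w t) by exact: (bracket_Int smY mB).
apply: (compensator_ae_eq Fsig Fmon) => // s t C s0 st FC.
have mC := mwrt_indic (R := R) (Fsig s0).1 FC.
by rewrite -(bracket_incr Fsig smY mA s0 st mC (@ind_le1 _ _ _ C))
  -(bracket_incr Fsig smY mB s0 st mC (@ind_le1 _ _ _ C)).
Qed.

Lemma wint_integral (T t : R) (Q : cumulative R R) : t <= T ->
  wint T Q t = \int[lebesgue_stieltjes_measure Q]_(s in `]0, t]) (T - s) ^+ 2.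
Proof.
move=> tT; rewrite /wint; apply: eq_Rintegral => s /set_mem; rewrite /= in_itv/=.
by move=> /andP[_ st]; rewrite weightE// (le_trans st).
Qed.

End Assembly.

Theorem proposition3p3 (R : realType) (d : measure_display)
    (Omega : measurableType d) (P : probability Omega R)
    (F : R -> set (set Omega)) (X M : R -> Omega -> R) (T : R) :
  usual_conditions P F ->
  martingale P F X -> cadlag X -> square_integrable P X ->
  0 < T ->
  (forall t, 0 <= t ->
     is_cond_exp P (F t)
       (fun w => \int[lebesgue_measure]_(u in `[0, T]) X u w) (M t)) ->
  cadlag M ->
  [/\ forall A : Omega -> cumulative R R,
        is_predictable_quadratic_variation P F X A ->
        is_ito_integral P F X A T (fun t _ => T - t)
          (fun t w => M t w - M 0 w),
      {ae P, forall w, forall t, 0 <= t <= T ->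
         jump M t w = (T - t) * jump X t w},
      forall Q : Omega -> cumulative R R,
        is_quadratic_variation P F X Q ->
        (exists QM : Omega -> cumulative R R,
           is_quadratic_variation P F M QM) /\
        (forall QM : Omega -> cumulative R R,
           is_quadratic_variation P F M QM ->
           {ae P, forall w, forall t, 0 <= t <= T ->
              QM w t = \int[lebesgue_stieltjes_measure (Q w)]_(s in `]0, t])
                         (T - s) ^+ 2})
    & forall A : Omega -> cumulative R R,
        is_predictable_quadratic_variation P F X A ->
        (exists AM : Omega -> cumulative R R,
           is_predictable_quadratic_variation P F M AM) /\
        (forall AM : Omega -> cumulative R R,
           is_predictable_quadratic_variation P F M AM ->
           {ae P, forall w, forall t, 0 <= t <= T ->
              AM w t = \int[lebesgue_stieltjes_measure (A w)]_(s in `]0, t])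
                         (T - s) ^+ 2})].
Proof.
move=> [Fsig Fmon _ _] mX cX sX T0 hM cM.
have smX := martingale_sqmart Fsig mX sX.
have cX' w : cadlag_path (X ^~ w) := cX w.
have aM : adapted F M by move=> t t0; have [] := hM t t0.
have smN := avg_sqmart Fsig Fmon smX cX' T0.
have MN t : 0 <= t -> {ae P, forall w, M t w = avg X T t w}.
  exact: (cond_exp_avg Fsig Fmon smX cX' T0 hM).
have smM := sqmart_version Fsig smN aM MN.
have ind : {ae P, forall w, forall t, 0 <= t -> M t w = avg X T t w}.
  apply: indistinguishable => // [w|w]; first exact: (cM w).1.
  by have [] := avg_cadlag (cX' w) T0.
split.
- move=> A [pA A0 mA]; exact: averaged_ito_integral.
- apply: filterS ind => w h t /andP[t0 tT].
  by rewrite (averaged_jump cX' T0 h)// weightE.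
- move=> Q hQ; have hW := averaged_quadratic_variation Fsig Fmon smX cX' T0 hQ aM MN.
  split=> [|QM hQM]; first by eexists; exact: hW.
  have := quadratic_variation_unique Fsig aM hQM hW.
  by apply: filterS => w h t /andP[t0 tT]; rewrite h//; exact: wint_integral.
- move=> A hA; have [pA A0 mA] := hA.
  have aA := bracket_adapted Fsig smX mA.
  have hW : is_predictable_quadratic_variation P F M (fun w => wint_cumulative T0 (A w)).
    split.
    + exact: (wint_predictable Fsig T0 pA aA).
    + by move=> w; exact: wint_nonpos.
    + exact: (wint_martingale Fsig Fmon smX cX' T0 mA aM MN).
  split=> [|AM hAM]; first by eexists; exact: hW.
  have := predictable_quadratic_variation_unique Fsig Fmon smM hAM hW.
  by apply: filterS => w h t /andP[t0 tT]; rewrite h//; exact: wint_integral.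
Qed.
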